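(* Suppose $X$ is an unbounded locally compact metric space that is uniformly bi-Lipschitz homogeneous, quasi-invertible, and contains a non-degenerate curve. (1) The metric space $X$ is path connected, locally path connected, proper, and Ahlfors regular. (2) If $X$ has a cut point, then, for some $\alpha\in(0,1]$, $X$ is bi-Lipschitz homeomorphic to $(\mathbb{R},|\cdot|^\alpha)$. (3) If $X$ has no cut points, then $X$ is linearly locally connected. Furthermore, (a) if $X$ contains a non-degenerate rectifiable curve, then $X$ is annularly quasi-convex; (b) if $X$ does not contain a non-degenerate rectifiable curve, then, for some $\alpha\in(0,1)$, $X$ is bi-Lipschitz homeomorphic to an $\alpha$-snowflake.
   Context: Write $a\simeq_L b$ for $L^{-1}b\le a\le Lb$. A homeomorphism $f$ is $L$-bi-Lipschitz if $d(f(x),f(y))\simeq_L d(x,y)$ for all $x,y$. $X$ is uniformly bi-Lipschitz homogeneous if there is $L\ge1$ such that for all $x,y\in X$ there is an $L$-bi-Lipschitz homeomorphism $f:X\to X$ with $f(x)=y$. $X$ is quasi-invertible if for some $p\in X$ and $L\ge1$ there is a homeomorphism $\sigma_p:X\setminus\{p\}\to X\setminus\{p\}$ with $d(\sigma_p(x),\sigma_p(y))\simeq_L\dfrac{d(x,y)}{d(x,p)\,d(y,p)}$ for all $x,y\in X\setminus\{p\}$. A curve is a continuous image of a compact interval; it is non-degenerate if it contains more than one point. $X$ is proper if closed balls are compact. $X$ is Ahlfors regular if for some $Q>0$ and $C\geq 1$ the $Q$-dimensional Hausdorff measure satisfies $\mathcal{H}^Q(B(x;r))\simeq_C r^Q$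 for all $x\in X$ and $0<r\le\operatorname{diam}X$. A cut point of a connected space $X$ is a point $x$ with $X\setminus\{x\}$ disconnected. $B(x;r)$ is the open ball and $A(x;r,R)=\{z:r<d(x,z)<R\}$. $X$ is linearly locally connected if there is $C\ge1$ such that for any $x\in X$, $r>0$: (i) any $u,v\in B(x;r)$ lie in a continuum $E\subset B(x;Cr)$; (ii) any $u,v\in X\setminus B(x;r)$ lie in a continuum $E\subset X\setminus B(x;r/C)$. An $L$-quasi-convex curve joining $x,y$ is a rectifiable curve joining them of length at most $L\,d(x,y)$. $X$ is annularly quasi-convex if there is $L\ge1$ such that for every $z\in X$ and $r>0$ every pair of points in $A(z;r,2r)$ can be joined by an $L$-quasi-convex curve contained in $A(z;r/L,2Lr)$. An $\alpha$-snowflake is a metric space isometric to $(Y,\delta^\alpha)$ for some metric space $(Y,\delta)$. $(\mathbb{R},|\cdot|^\alpha)$ is $\mathbb{R}$ with distance $|x-y|^\alpha$. *)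

(* Defs.v *)
(* MathComp-Analysis; metric spaces are [metricType R] for [R : realType], with
   distance [mdist] and open balls [ball x r = [set y | mdist x y < r]]
   (lemma [ballEmdist]). *)
From HB Require Import structures.
From mathcomp Require Import all_boot all_order all_algebra.
From mathcomp Require Import all_classical all_reals all_analysis.

Set Implicit Arguments.
Unset Strict Implicit.
Unset Printing Implicit Defensive.

Import Order.TTheory GRing.Theory Num.Theory.
Import numFieldNormedType.Exports.

Local Open Scope classical_set_scope.
Local Open Scope ring_scope.

Definition simeq (R : realType) (L a b : R) : bool := L^-1 * b <= a <= L * b.

Definition homeomorphism (S T : topologicalType) (f : S -> T) : Prop :=
  exists g : T -> S, [/\ cancel f g, cancel g f, continuous f & continuous g].

Definition bilipschitz (R : realType) (X Y : metricType R) (L : R)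
    (f : X -> Y) : Prop :=
  forall x y, simeq L (mdist (f x) (f y)) (mdist x y).

Definition bilipschitz_homeomorphic (R : realType) (X Y : metricType R) : Prop :=
  exists L : R, 1 <= L /\
    exists f : X -> Y, homeomorphism f /\ bilipschitz L f.

Definition isometric (R : realType) (X Y : metricType R) : Prop :=
  exists f : X -> Y, bijective f /\ forall x y, mdist (f x) (f y) = mdist x y.

Definition unif_bilipschitz_homogeneous (R : realType) (X : metricType R)
    : Prop :=
  exists L : R, 1 <= L /\
    forall x y : X, exists f : X -> X,
      [/\ homeomorphism f, bilipschitz L f & f x = y].

(* [~` [set p]] is coerced to the subtype [{x : X | x \in ~` [set p]}], which
   carries the topology induced from [X]. *)
Definition quasi_invertible (R : realType) (X : metricType R) : Prop :=
  exists (p : X) (L : R), 1 <= L /\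
    exists sigma : ~` [set p] -> ~` [set p], homeomorphism sigma /\
      forall x y : ~` [set p],
        simeq L (mdist (set_val (sigma x)) (set_val (sigma y)))
                (mdist (set_val x) (set_val y) /
                 (mdist (set_val x) p * mdist (set_val y) p)).

(* The [0] in the union makes the empty set have diameter 0 rather than -oo. *)
Definition diam (R : realType) (X : metricType R) (A : set X) : \bar R :=
  ereal_sup ([set 0%E] `|`
             [set (mdist xy.1 xy.2)%:E | xy in [set xy | A xy.1 /\ A xy.2]]).

Definition unbounded_space (R : realType) (X : metricType R) : Prop :=
  diam [set: X] = +oo%E.

(* Curves are parametrized by [g] on [`[a, b]]; the values of [g] outside this
   interval are irrelevant. *)
Definition is_curve (R : realType) (X : metricType R) (a b : R) (g : R -> X)
    : Prop :=
  a <= b /\ {within `[a, b], continuous g}.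

Definition nondegenerate (R : realType) (X : metricType R) (a b : R)
    (g : R -> X) : Prop :=
  exists s t, [/\ s \in `[a, b], t \in `[a, b] & g s <> g t].

Definition joins (R : realType) (X : metricType R) (a b : R) (g : R -> X)
    (x y : X) : Prop :=
  [/\ is_curve a b g, g a = x & g b = y].

(* The metric-valued analogue of [variation] and [total_variation]. *)
Definition curve_length (R : realType) (X : metricType R) (a b : R)
    (g : R -> X) : \bar R :=
  ereal_sup
    [set (\sum_(0 <= i < size s)
            mdist (g (nth b (a :: s) i)) (g (nth b s i)))%:E
    | s in [set s : seq R | itv_partition a b s]].

Definition rectifiable (R : realType) (X : metricType R) (a b : R)
    (g : R -> X) : Prop :=
  (curve_length a b g < +oo)%E.

Definition has_nondegenerate_curve (R : realType) (X : metricType R) : Prop :=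
  exists (a b : R) (g : R -> X), is_curve a b g /\ nondegenerate a b g.

Definition has_nondegenerate_rectifiable_curve (R : realType)
    (X : metricType R) : Prop :=
  exists (a b : R) (g : R -> X),
    [/\ is_curve a b g, nondegenerate a b g & rectifiable a b g].

Definition path_connected (R : realType) (X : metricType R) (A : set X)
    : Prop :=
  forall x y, A x -> A y ->
    exists g : R -> X, joins 0 1 g x y /\ g @` `[0, 1] `<=` A.

Definition locally_path_connected (R : realType) (X : metricType R) : Prop :=
  forall (x : X) (U : set X), nbhs x U ->
    exists V : set X, [/\ open V, V x, V `<=` U & path_connected V].

(* The library's [closed_ball] is the closure of the open ball, hence not used
   here. *)
Definition proper_space (R : realType) (X : metricType R) : Prop :=
  forall (x : X) (r : R), compact [set y | mdist x y <= r].

Definition hausdorff_premeasure (R : realType) (X : metricType R)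
    (Q delta : R) (A : set X) : \bar R :=
  ereal_inf
    [set (\sum_(0 <= i <oo) (diam (F i) `^ Q))%E
    | F in [set F : nat -> set X |
            A `<=` \bigcup_i F i /\ forall i, (diam (F i) <= delta%:E)%E]].

(* The measure of dimension [Q > 0], without a dimensional normalizing
   constant. *)
Definition hausdorff_measure (R : realType) (X : metricType R)
    (Q : R) (A : set X) : \bar R :=
  ereal_sup [set hausdorff_premeasure Q delta A | delta in [set d : R | 0 < d]].

Definition ahlfors_regular (R : realType) (X : metricType R) : Prop :=
  exists Q C : R, [/\ 0 < Q, 1 <= C &
    forall (x : X) (r : R), 0 < r -> (r%:E <= diam [set: X])%E ->
      ((C^-1 * r `^ Q)%:E <= hausdorff_measure Q (ball x r) <=
       (C * r `^ Q)%:E)%E].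

Definition cut_point (R : realType) (X : metricType R) (x : X) : Prop :=
  ~ connected (~` [set x]).

Definition continuum (R : realType) (X : metricType R) (E : set X) : Prop :=
  [/\ E !=set0, compact E & connected E].

Definition linearly_locally_connected (R : realType) (X : metricType R)
    : Prop :=
  exists C : R, 1 <= C /\
    forall (x : X) (r : R), 0 < r ->
      (forall u v, ball x r u -> ball x r v ->
         exists E, [/\ continuum E, E u, E v & E `<=` ball x (C * r)]) /\
      (forall u v, (~` ball x r) u -> (~` ball x r) v ->
         exists E, [/\ continuum E, E u, E v & E `<=` ~` ball x (r / C)]).

Definition annulus (R : realType) (X : metricType R) (x : X) (r s : R)
    : set X :=
  [set z | r < mdist x z < s].

Definition quasiconvex_curve (R : realType) (X : metricType R) (L : R)
    (a b : R) (g : R -> X) (x y : X) : Prop :=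
  [/\ joins a b g x y, rectifiable a b g &
      (curve_length a b g <= (L * mdist x y)%:E)%E].

Definition annularly_quasiconvex (R : realType) (X : metricType R) : Prop :=
  exists L : R, 1 <= L /\
    forall (z : X) (r : R), 0 < r ->
      forall x y, annulus z r (2 * r) x -> annulus z r (2 * r) y ->
        exists (a b : R) (g : R -> X), quasiconvex_curve L a b g x y /\
          g @` `[a, b] `<=` annulus z (r / L) (2 * L * r).

Lemma powR_subadd (R : realType) (alpha a b : R) :
  0 < alpha <= 1 -> 0 <= a -> 0 <= b ->
  (a + b) `^ alpha <= a `^ alpha + b `^ alpha.
Proof.
move=> /andP[alpha0 alpha1] a0 b0.
have [->|s_neq0] := eqVneq (a + b) 0.
  by rewrite powR0 ?gt_eqF// addr_ge0// powR_ge0.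
have s0 : 0 < a + b by rewrite lt_neqAle eq_sym s_neq0 addr_ge0.
have le_powR c : 0 <= c <= a + b ->
    c / (a + b) * (a + b) `^ alpha <= c `^ alpha.
  move=> /andP[c0 cs].
  have [->|c_neq0] := eqVneq c 0; first by rewrite !mul0r powR_ge0.
  have t0 : 0 < c / (a + b) by rewrite divr_gt0// lt_neqAle eq_sym c_neq0.
  rewrite -[X in _ <= X `^ _](divfK s_neq0) powRM ?(ltW t0) ?(ltW s0)//.
  rewrite ler_wpM2r ?powR_ge0// ger1_powR// t0/=.
  by rewrite ler_pdivrMr// mul1r.
have := lerD (le_powR a _) (le_powR b _).
rewrite -mulrDl -mulrDl divff// mul1r; apply.
- by rewrite a0/= lerDl.
- by rewrite b0/= lerDr.
Qed.

(* The metric space [(Y, delta ^ alpha)], on the carrier of [Y]. *)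
Definition snowflake (R : realType) (alpha : R) (alpha01 : 0 < alpha <= 1)
  (Y : metricType R) : Type := Y.

Section snowflake_metric.
Context (R : realType) (alpha : R) (alpha01 : 0 < alpha <= 1)
  (Y : metricType R).

Let T := snowflake alpha01 Y.

Definition snowflake_dist (x y : T) : R := (mdist (x : Y) (y : Y)) `^ alpha.

Let alpha_neq0 : alpha != 0.
Proof. by case/andP: alpha01 => /gt_eqF->. Qed.

Let alpha_ge0 : 0 <= alpha.
Proof. by case/andP: alpha01 => /ltW. Qed.

Lemma snowflake_distxx x : snowflake_dist x x = 0.
Proof. by rewrite /snowflake_dist mdistxx powR0. Qed.

Lemma snowflake_dist_positivity x y : snowflake_dist x y = 0 -> x = y.
Proof. by move/powR_eq0_eq0/mdist_positivity. Qed.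

Lemma snowflake_dist_sym x y : snowflake_dist x y = snowflake_dist y x.
Proof. by rewrite /snowflake_dist metric_sym. Qed.

Lemma snowflake_dist_triangle y x z :
  snowflake_dist x z <= snowflake_dist x y + snowflake_dist y z.
Proof.
apply: le_trans (powR_subadd alpha01 (mdist_ge0 _ _) (mdist_ge0 _ _)).
apply: ge0_ler_powR => //; rewrite ?nnegrE ?addr_ge0 ?mdist_ge0//.
exact: metric_triangle.
Qed.

HB.instance Definition _ := Choice.copy T (Choice.sort Y).

HB.instance Definition _ := isMetric.Build R T snowflake_distxx
  snowflake_dist_positivity snowflake_dist_sym snowflake_dist_triangle.

End snowflake_metric.

Lemma mdist_snowflake (R : realType) (alpha : R) (alpha01 : 0 < alpha <= 1)
    (Y : metricType R) (x y : Y) :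
  mdist (x : snowflake alpha01 Y) (y : snowflake alpha01 Y) =
  mdist x y `^ alpha.
Proof. by []. Qed.

Lemma mdist_snowflake_line (R : realType) (alpha : R)
    (alpha01 : 0 < alpha <= 1) (x y : R) :
  mdist (x : snowflake alpha01 R^o) (y : snowflake alpha01 R^o) =
  `|x - y| `^ alpha.
Proof. by rewrite (mdist_snowflake alpha01 (x : R^o) (y : R^o)) distrC. Qed.

Definition is_snowflake (R : realType) (alpha : R) (alpha01 : 0 < alpha <= 1)
    (Z : metricType R) : Prop :=
  exists Y : metricType R, isometric Z (snowflake alpha01 Y).

(* Main.v *)
Require Import Defs.
From HB Require Import structures.
From mathcomp Require Import all_boot all_order all_algebra.
From mathcomp Require Import all_classical all_reals all_analysis.
From mathcomp Require Import ring lra.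

Set Implicit Arguments.
Unset Strict Implicit.
Unset Printing Implicit Defensive.

Import Order.TTheory GRing.Theory Num.Theory.
Import numFieldNormedType.Exports.
Import metricType_numDomainType.

Local Open Scope classical_set_scope.
Local Open Scope ring_scope.

(** Adjoin a point at infinity to [X]. The quasi-inversion becomes a map that
    exchanges its centre and infinity and multiplies distances, up to a constant,
    by [w x * w y] for a weight [w]. Such maps compose and invert like Moebius
    transformations, and one that fixes infinity is a quasi-similarity
    ([quasi_mobius_fix_None]). Composing three inversions with two translations
    one obtains quasi-similarities of ratio [a ^ 2], just as [x |-> - a - a^2 x]
    is composed of maps [x |-> 1 / x] and translations of the line; here [a] is
    the distance of two points, and the curve provides all small values of it
    ([small_dilation]). So [X] has uniform quasi-similarities of every ratio
    carrying any point to any other, and a uniform inversion at every point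
    ([invertible_space_structure]). Everything else follows from these: dilations
    turn statements about one compact set into statements at all places and all
    scales, the first one being that [X] is proper.

    Connectedness. A bounded clopen set could be shrunk until it cuts the curve,
    so there is none ([no_bounded_clopen]). Comparing a clopen subset of the
    complement of a point with a scaled copy of itself shows that it cannot be
    bounded either ([no_bounded_branch]), and an inversion would turn a clopen
    subset of [X] into such a set; hence [X] is connected ([space_connected]).
    Then any two points are joined by a fixed number of steps of half their
    distance, and iterating this produces a path of size comparable to the
    distance of its end points ([connected_bounded_turning]). If moreover no point
    cuts [X], compactness gives linear local connectivity ([turning_LLC]).

    Ahlfors regularity. The number of balls of radius [2 ^ -k] needed to cover the
    unit ball is multiplicative in [k] up to constants, hence comparable to
    [2 ^ (k Q)] for some [Q] ([growth_exponent]), and covering numbers control the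
    Hausdorff measure ([hausdorff_lower], [hausdorff_upper]).

    Cut points. If one point cuts [X], all points do. The inversion at [q] maps one
    of the sides of another point to a bounded set with frontier [p] and [q]; it
    consists of the points that separate [p] from [q], and forms with [p] and [q]
    the smallest connected set containing both ([arc_gap], [arc_min]). Of three
    points one separates the two others ([one_between]), so [X] is ordered like a
    line. The limit of the rescaled covering numbers of arcs is additive and
    comparable to the distance to the power [Q] ([arc_measure]); taken with a sign
    from a base point, it identifies [X] with the line up to the exponent [1 / Q].

    Rectifiable curves. A curve of length at most [l] is the same as arbitrarily
    fine chains of length at most [l] ([linked_curve], [rectifiable_linked]). An
    inversion at one end of a rectifiable curve turns it into a curve leading to
    infinity; with a second inversion one sees that the points that can be
    reached from a given one by rectifiable curves are dense ([rect_linked_dense]),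
    which by scaling and iteration makes [X] quasi-convex, and annularly
    quasi-convex if there are no cut points. If there are no rectifiable curves,
    compactness shows that fine chains are much longer than the distance of their
    ends ([fine_chains_long]); it follows that sums of [s]-th powers along chains
    are bounded below by the [s]-th power of that distance for some [s > 1]
    ([power_sum_bound]). The infimum of these sums is then a metric comparable to
    the [s]-th power of the given one, of which [X] is therefore a snowflake. *)

(** * Topology in terms of distances *)

Section MetricBasics.
Context {R : realType}.

Lemma nbhs_distP (X : metricType R) (x : X) (A : set X) :
  nbhs x A <-> exists2 e : R, 0 < e & forall y, mdist x y < e -> A y.
Proof.
rewrite -(filter_from_mdist_nbhs x).
by split=> [[e e0 eA]|[e e0 eA]]; exists e.
Qed.

Lemma open_distP (X : metricType R) (A : set X) :
  open A <-> forall x, A x -> exists2 e : R, 0 < e & forall y, mdist x y < e -> A y.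
Proof.
rewrite openE; split=> [oA x Ax|oA x Ax]; first exact/nbhs_distP/oA.
exact/nbhs_distP/oA.
Qed.

Lemma closure_distP (X : metricType R) (A : set X) (x : X) :
  closure A x <-> forall e : R, 0 < e -> exists2 y, A y & mdist x y < e.
Proof.
split=> [cA e e0|cA B /nbhs_distP[e e0 eB]].
  have [|y [Ay xy]] := cA [set y | mdist x y < e]; first by apply/nbhs_distP; exists e.
  by exists y.
by have [y Ay xy] := cA e e0; exists y; split => //; exact: eB.
Qed.

Lemma closed_distP (X : metricType R) (A : set X) :
  closed A <-> forall x, (forall e : R, 0 < e -> exists2 y, A y & mdist x y < e) -> A x.
Proof.
split=> [cA x xA|cA x /closure_distP]; last exact: cA.
exact/cA/closure_distP.
Qed.

Lemma continuous_distP (X Y : metricType R) (f : X -> Y) (x : X) :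
  {for x, continuous f} <-> forall e : R, 0 < e -> exists2 d : R, 0 < d &
    forall y, mdist x y < d -> mdist (f x) (f y) < e.
Proof.
split=> [cf e e0|cf].
  have /nbhs_distP[d d0 dP] : nbhs x (f @^-1` [set z | mdist (f x) z < e]).
    by apply: cf; apply/nbhs_distP; exists e.
  by exists d.
move=> A /nbhs_distP[e e0 eA]; have [d d0 dP] := cf e e0.
by apply/nbhs_distP; exists d => // y /dP /eA.
Qed.

Lemma closed_closed_ball (X : metricType R) (x : X) (r : R) :
  closed [set y | mdist x y <= r].
Proof.
apply/closed_distP => y yP /=; apply/ler_addgt0Pr => e /yP[z /= xz yz].
by rewrite (le_trans (metric_triangle x z y))// lerD// metric_sym ltW.
Qed.

Lemma open_dist_ball (X : metricType R) (x : X) (r : R) :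
  open [set y | mdist x y < r].
Proof.
apply/open_distP => y /= xy; exists (r - mdist x y); first by rewrite subr_gt0.
move=> z yz; rewrite (le_lt_trans (metric_triangle x y z))//.
by rewrite -ltrBrDl.
Qed.

Lemma closed_point (X : metricType R) (x : X) : closed [set x].
Proof. exact/accessible_closed_set1/hausdorff_accessible/metric_hausdorff. Qed.

Lemma closed_annulus (X : metricType R) (p : X) (a b : R) :
  closed [set z | a <= mdist p z <= b].
Proof.
have -> : [set z | a <= mdist p z <= b] =
    [set z | mdist p z <= b] `\` [set z | mdist p z < a].
  apply/seteqP; split => [z /andP[h1 h2]|z [h1 /negP h2]].
    by split => //; apply/negP; rewrite -leNgt.
  by rewrite /= h1 andbT leNgt.
rewrite setDE; apply: closedI; first exact: closed_closed_ball.
by apply: open_closedC; exact: open_dist_ball.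
Qed.

Lemma compact_annulus (X : metricType R) (p : X) (a b : R) : proper_space X ->
  compact [set z | a <= mdist p z <= b].
Proof.
move=> Xp; apply: (subclosed_compact _ (Xp p b)); first exact: closed_annulus.
by move=> z /andP[].
Qed.

Lemma closed_away (X : metricType R) (A : set X) (p : X) : closed A -> ~ A p ->
  exists2 e : R, 0 < e & forall y, A y -> e <= mdist y p.
Proof.
move=> /closed_distP cA Ap; apply: contrapT => nE; apply: Ap; apply: cA => e e0.
apply: contrapT => nA; apply: nE; exists e => // y Ay; rewrite leNgt.
by apply/negP => yp; apply: nA; exists y => //; rewrite metric_sym.
Qed.

Lemma mdist_abs_sub (X : metricType R) (x y z : X) :
  `|mdist x y - mdist x z| <= mdist y z.
Proof.
rewrite ler_norml; have := metric_triangle x y z; have := metric_triangle x z y.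
rewrite (metric_sym z y) => h1 h2; apply/andP; split; lra.
Qed.

Lemma compact_seq_cluster (X : metricType R) (A : set X) (u : nat -> X) :
  compact A -> (forall n, A (u n)) ->
  exists2 z, A z & forall (e : R) N, 0 < e -> exists2 n, (N <= n)%N & mdist (u n) z < e.
Proof.
move=> cA uA.
have [z [Az uz]] : A `&` cluster (u @ \oo) !=set0.
  by apply: cA; exists 0%N => // n _ /=; exact: uA.
exists z => // e N e0.
have [||w [[n /= Nn <-] zw]] := uz (u @` [set n | (N <= n)%N]) [set y | mdist z y < e].
- by exists N => // n /= Nn; exists n.
- by apply/nbhs_distP; exists e.
by exists n => //; rewrite metric_sym.
Qed.

(** Finitely many of the neighbourhoods cover [K], and monotonicity merges
    them into the one of largest index. This is how compactness yields uniform
    constants below. *)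
Lemma compact_nested (X : metricType R) (K : set X) (P : nat -> set X) :
  compact K -> (forall m n x, (m <= n)%N -> P m x -> P n x) ->
  (forall x, K x -> exists n, nbhs x (P n)) ->
  exists n, forall x, K x -> P n x.
Proof.
move=> cK Pm KP; apply: contrapT => /forallNP nP.
have /choice[u uP] : forall n, exists x, K x /\ ~ P n x.
  by move=> n; have /existsNP[x /not_implyP[]] := nP n; exists x.
have [z Kz zu] := compact_seq_cluster cK (fun n => (uP n).1).
have [m /nbhs_distP[e e0 eP]] := KP z Kz.
have [n mn un] := zu e m e0.
have [_] := uP n; apply; apply: (Pm m) => //; apply: eP.
by rewrite metric_sym.
Qed.

Lemma connected_clopen (X : metricType R) (A : set X) :
  connected [set: X] -> open A -> closed A -> A !=set0 -> forall x, A x.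
Proof.
move=> cX oA cA A0 x.
suff -> : A = setT by [].
by apply: cX => //; exists A; rewrite // setTI.
Qed.

Lemma not_connected (X : metricType R) :
  ~ connected [set: X] ->
  exists A : set X, [/\ open A, closed A, A !=set0 & (~` A) !=set0].
Proof.
move=> nc; apply: contrapT => nA; apply: nc => B B0 [C oC BC] [D cD BD].
apply: contrapT => BT; apply: nA; exists B; split => //.
- by rewrite BC setTI.
- by rewrite BD setTI.
apply: contrapT => nB; apply: BT; apply/seteqP; split => // x _.
by apply: contrapT => Bx; apply: nB; exists x.
Qed.

End MetricBasics.

Arguments closed_point {R X} x.
Arguments closed_annulus {R X} p a b.
Arguments compact_annulus {R X} p a b.

(** * Comparison up to a factor *)

Section Comparable.
Context {R : realType}.
Implicit Types a b c C L : R.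

Definition within_factor C a b := a <= C * b /\ b <= C * a.

Lemma within_factor_sym C a b : within_factor C a b -> within_factor C b a.
Proof. by case. Qed.

Lemma within_factor_trans C C' a b c : 0 <= C -> 0 <= C' ->
  within_factor C a b -> within_factor C' b c -> within_factor (C * C') a c.
Proof.
move=> C0 C'0 [ab ba] [bc cb]; split.
  by rewrite (le_trans ab)// -mulrA ler_wpM2l.
by rewrite (le_trans cb)// [C * C']mulrC -mulrA ler_wpM2l.
Qed.

Lemma within_factor_mul C c a b : 0 <= c ->
  within_factor C a b -> within_factor C (a * c) (b * c).
Proof. by move=> c0 [ab ba]; split; rewrite mulrA ler_wpM2r. Qed.

Lemma within_factor_weaken C C' a b : C <= C' -> 0 <= a -> 0 <= b ->
  within_factor C a b -> within_factor C' a b.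
Proof.
move=> CC' a0 b0 [ab ba]; split.
  by rewrite (le_trans ab)// ler_wpM2r.
by rewrite (le_trans ba)// ler_wpM2r.
Qed.

Lemma simeq_within_factor L a b : 1 <= L -> simeq L a b -> within_factor L a b.
Proof.
move=> L1 /andP[h1 h2]; split => //; have L0 : 0 < L by lra.
by move: h1; rewrite mulrC ler_pdivrMr// mulrC.
Qed.

Lemma within_factor_simeq L a b : 0 < L -> within_factor L a b -> simeq L a b.
Proof.
by move=> L0 [h1 h2]; rewrite /simeq h1 andbT mulrC ler_pdivrMr// mulrC.
Qed.

Lemma powR_div a b c : 0 <= a -> 0 < b -> (a / b) `^ c = a `^ c / b `^ c.
Proof.
move=> a0 b0; rewrite powRM ?invr_ge0 ?(ltW b0)//; congr (_ * _).
by rewrite -[b^-1]powR_inv1 ?(ltW b0)// -powRrM mulN1r powRN.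
Qed.

Lemma powR_root a c : 0 <= a -> 0 < c -> (a `^ c) `^ c^-1 = a.
Proof. by move=> a0 c0; rewrite -powRrM mulfV ?gt_eqF// powRr1. Qed.

End Comparable.

(** * Quasi-Moebius maps *)

Section QuasiMobius.
Context {R : realType} {X : metricType R}.
Implicit Types (w : option X -> R) (f g : option X -> option X) (C L : R).

(** [None] is the point at infinity. The value 1 makes the identity [|1/x -
    1/y| = |x - y| / (|x| |y|)] persist at the centre and at infinity, for a
    weight that is 1 at both; [odist] is not a metric. *)
Definition odist (x y : option X) : R :=
  match x, y with
  | Some a, Some b => mdist a b
  | None, None => 0
  | _, _ => 1
  end.

Lemma odist_ge0 x y : 0 <= odist x y.
Proof. by case: x y => [x|] [y|] //=; exact: mdist_ge0. Qed.

Definition quasi_mobius C w f :=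
  [/\ bijective f, forall x, 0 < w x &
      forall x y, within_factor C (odist (f x) (f y)) (odist x y * (w x * w y))].

Lemma quasi_mobius_comp C C' w w' f g : 0 <= C -> 0 <= C' ->
  quasi_mobius C w f -> quasi_mobius C' w' g ->
  quasi_mobius (C' * C) (fun x => w x * w' (f x)) (g \o f).
Proof.
move=> C0 C'0 [bf w0 fP] [bg w'0 gP]; split.
- exact: bij_comp.
- by move=> x; rewrite mulr_gt0.
- move=> x y; apply: (within_factor_trans C'0 C0 (gP (f x) (f y))).
  have := within_factor_mul _ (fP x y) => /(_ (w' (f x) * w' (f y))).
  rewrite mulr_ge0 ?ltW// => /(_ isT).
  by congr within_factor; ring.
Qed.

Lemma quasi_mobius_inv C w f g : cancel f g -> cancel g f ->
  quasi_mobius C w f -> quasi_mobius C (fun x => (w (g x))^-1) g.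
Proof.
move=> fK gK [bf w0 fP]; split.
- by exists f.
- by move=> x; rewrite invr_gt0.
- move=> x y; apply: within_factor_sym; have := fP (g x) (g y); rewrite !gK => h.
  have := within_factor_mul _ h => /(_ ((w (g x))^-1 * (w (g y))^-1)).
  rewrite mulr_ge0 ?invr_ge0 ?ltW// => /(_ isT).
  congr within_factor; field.
  by rewrite ?gt_eqF.
Qed.

(** Comparing the image of a point with that of infinity shows that the weight
    of every point is about the inverse of the weight at infinity, hence
    constant up to a factor. *)
Lemma quasi_mobius_fix_None C w f : 0 <= C -> quasi_mobius C w f -> f None = None ->
  exists h h' : X -> X, [/\ cancel h h', cancel h' h,
    (forall x, f (Some x) = Some (h x)) &
    forall u v, within_factor (C ^+ 3) (mdist (h u) (h v)) ((w None) ^- 2 * mdist u v)].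
Proof.
move=> C0 [[g fK gK] w0 fP] fN.
have gN : g None = None by rewrite -fN fK.
have fS x : exists y, f (Some x) = Some y.
  case E : (f (Some x)) => [y|]; first by exists y.
  by have := fK (Some x); rewrite E gN.
have gS x : exists y, g (Some x) = Some y.
  case E : (g (Some x)) => [y|]; first by exists y.
  by have := gK (Some x); rewrite E fN.
have /choice[h hP] := fS; have /choice[h' h'P] := gS.
exists h, h'; split => //.
- by move=> x; have := fK (Some x); rewrite hP h'P => -[].
- by move=> x; have := gK (Some x); rewrite h'P hP => -[].
move=> u v.
have := fP (Some u) (Some v); rewrite !hP /= => huv.
have := fP (Some u) None; rewrite hP fN /= !mul1r => hu.
have := fP (Some v) None; rewrite hP fN /= !mul1r => hv.
have wu := w0 (Some u); have wv := w0 (Some v); have wN := w0 None.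
set a := w (Some u) in wu hu huv; set b := w (Some v) in wv hv huv.
set c := w None in wN hu hv *.
have ab : within_factor (C ^+ 2) (a * b) (c ^- 2).
  have [h1 h2] := hu; have [h3 h4] := hv.
  have c20 : 0 < c ^+ 2 by rewrite exprn_gt0.
  split.
    rewrite ler_pdivlMr//.
    have -> : a * b * c ^+ 2 = (a * c) * (b * c) by ring.
    have -> : C ^+ 2 = (C * 1) * (C * 1) by ring.
    by apply: ler_pM => //; rewrite mulr_ge0// ltW.
  rewrite -[c ^- 2]mul1r ler_pdivrMr//.
  have -> : C ^+ 2 * (a * b) * c ^+ 2 = (C * (a * c)) * (C * (b * c)) by ring.
  by rewrite -[1]mulr1; apply: ler_pM.
have := within_factor_mul (mdist_ge0 u v) ab.
rewrite [a * b * _]mulrC => /(within_factor_trans C0 (sqr_ge0 C) huv).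
by rewrite -exprS.
Qed.

Lemma quasi_mobius_omap L (f : X -> X) : bijective f ->
  (forall u v, within_factor L (mdist (f u) (f v)) (mdist u v)) -> 1 <= L ->
  quasi_mobius L (fun=> 1) (omap f).
Proof.
move=> [g fK gK] fP L1; split => //.
- by exists (omap g); case=> //= x; rewrite ?fK ?gK.
- have l1 a : 0 <= a -> within_factor L a a.
    by move=> a0; split; rewrite ler_peMl.
  by case=> [x|] [y|] /=; rewrite !mulr1//; apply: l1.
Qed.

Definition inversion_ext (p : X) (s : X -> X) (x : option X) : option X :=
  if x is Some y then if y == p then None else Some (s y) else Some p.

Definition inversion_weight (p : X) (x : option X) : R :=
  if x is Some y then if y == p then 1 else (mdist y p)^-1 else 1.

Lemma inversion_weight_gt0 p x : 0 < inversion_weight p x.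
Proof.
case: x => [y|]//=; case: eqP => // /eqP yp.
by rewrite invr_gt0 mdist_gt0.
Qed.

Lemma quasi_mobius_inversion L p (s s' : X -> X) : 1 <= L ->
  (forall y, y <> p -> [/\ s y <> p, s' y <> p, s' (s y) = y & s (s' y) = y]) ->
  (forall x y, x <> p -> y <> p ->
    within_factor L (mdist (s x) (s y)) (mdist x y / (mdist x p * mdist y p))) ->
  (forall x, x <> p -> within_factor L (mdist (s x) p) (mdist x p)^-1) ->
  quasi_mobius L (inversion_weight p) (inversion_ext p s).
Proof.
move=> L1 sP s2 s1; split; last first.
- have l1 a : 0 <= a -> within_factor L a a.
    by move=> a0; split; rewrite ler_peMl.
  case=> [x|] [y|] //=; rewrite ?mulr1 ?mul1r; last by rewrite mdistxx; exact: l1.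
  - case: eqP => [->|xp]; case: eqP => [->|yp] /=; rewrite ?mdistxx ?mul1r ?mul0r ?mulr1.
    + exact: l1.
    + rewrite metric_sym mulfV; last by rewrite gt_eqF// mdist_gt0; apply/eqP.
      exact: l1.
    + rewrite mulfV; last by rewrite gt_eqF// mdist_gt0; apply/eqP.
      exact: l1.
    + by rewrite -invfM; exact: s2.
  - by case: eqP => [_|xp] /=; [exact: l1|exact: s1].
  - by case: eqP => [_|xp] /=; [exact: l1|rewrite metric_sym; exact: s1].
- exact: inversion_weight_gt0.
- have oK a b : (forall y, y <> p -> [/\ a y <> p, b y <> p, b (a y) = y & a (b y) = y]) ->
      cancel (inversion_ext p a) (inversion_ext p b).
    move=> abP [y|] /=; last by rewrite eqxx.
    case: (eqVneq y p) => [->//|/eqP yp] /=.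
    by have [ay _ bay _] := abP y yp; move/eqP/negbTE: ay => ->; rewrite bay.
  exists (inversion_ext p s'); apply: oK => // y yp.
  by have [] := sP y yp.
Qed.

End QuasiMobius.

(** * Quasi-similarities and quasi-inversions *)

Section Dilations.
Context {R : realType}.

Lemma lipschitz_continuous (X Y : metricType R) (K : R) (f : X -> Y) :
  (forall u v, mdist (f u) (f v) <= K * mdist u v) -> continuous f.
Proof.
move=> fP x; apply/continuous_distP => e e0.
have K1 : 0 < `|K| + 1 by rewrite ltr_wpDl.
exists (e / (`|K| + 1)); first by rewrite divr_gt0.
move=> y; rewrite ltr_pdivlMr// => xy.
rewrite (le_lt_trans (fP x y))// (le_lt_trans _ xy)// mulrC ler_wpM2l ?mdist_ge0//.
by rewrite (le_trans (ler_norm K))// lerDl.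
Qed.

Definition quasi_similarity (X : metricType R) (M lam : R) (h h' : X -> X) :=
  [/\ cancel h h', cancel h' h &
      forall u v, within_factor M (mdist (h u) (h v)) (lam * mdist u v)].

Lemma quasi_similarity_inv (X : metricType R) M lam (h h' : X -> X) :
  0 < lam -> quasi_similarity M lam h h' -> quasi_similarity M lam^-1 h' h.
Proof.
move=> lam0 [hK h'K hP]; split=> // u v; apply: within_factor_sym.
have := hP (h' u) (h' v); rewrite !h'K => huv.
have := within_factor_mul _ huv => /(_ lam^-1); rewrite invr_ge0 ltW// => /(_ isT).
by congr within_factor; [rewrite mulrC|field; rewrite gt_eqF].
Qed.

Lemma quasi_similarity_comp (X : metricType R) M lam M' lam' (h h' k k' : X -> X) :
  0 < lam' -> 0 <= M -> 0 <= M' ->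
  quasi_similarity M lam h h' -> quasi_similarity M' lam' k k' ->
  quasi_similarity (M' * M) (lam' * lam) (k \o h) (h' \o k').
Proof.
move=> lam0 M0 M'0 [hK h'K hP] [kK k'K kP]; split.
- exact: can_comp.
- exact: can_comp.
move=> u v /=; apply: (within_factor_trans M'0 M0 (kP _ _)).
have := within_factor_mul (ltW lam0) (hP u v).
by congr within_factor; ring.
Qed.

Lemma quasi_similarity_weaken (X : metricType R) M M' lam (h h' : X -> X) :
  0 < lam -> M <= M' -> quasi_similarity M lam h h' -> quasi_similarity M' lam h h'.
Proof.
move=> lam0 MM' [hK h'K hP]; split=> // u v.
by apply: within_factor_weaken (hP u v); rewrite ?mulr_ge0 ?mdist_ge0// ltW.
Qed.

Lemma quasi_similarity_continuous (X : metricType R) M lam (h h' : X -> X) :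
  quasi_similarity M lam h h' -> continuous h.
Proof.
move=> [_ _ hP]; apply: (@lipschitz_continuous _ _ (M * lam)) => u v.
by rewrite -mulrA; exact: (hP u v).1.
Qed.

Lemma compact_ball_pullback (X : metricType R) M lam (h h' : X -> X) (x : X) (r r' : R) :
  0 < lam -> 0 <= M -> quasi_similarity M lam h h' ->
  compact [set y | mdist (h x) y <= r] -> M * (lam * r') <= r ->
  compact [set y | mdist x y <= r'].
Proof.
move=> lam0 M0 hh cK Mr.
have ch' := quasi_similarity_continuous (quasi_similarity_inv lam0 hh).
have [hK h'K hP] := hh.
apply: (@subclosed_compact _ _ (h' @` [set y | mdist (h x) y <= r])).
- exact: closed_closed_ball.
- by apply: continuous_compact => //; exact: continuous_subspaceT.
- move=> y /= xy; exists (h y) => //=.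
  rewrite (le_trans (hP x y).1)// (le_trans _ Mr)// ler_wpM2l// ler_wpM2l//.
  exact: ltW.
Qed.

Context (X : metricType R).

Definition translations (L : R) := forall x y : X, exists h h' : X -> X,
  quasi_similarity L 1 h h' /\ h x = y.

Lemma homogeneous_translations : unif_bilipschitz_homogeneous X ->
  exists2 L : R, 1 <= L & translations L.
Proof.
move=> [L [L1 H]]; exists L => // x y; have [f [[g [fK gK _ _]] fP fx]] := H x y.
exists f, g; split => //; split => // u v; rewrite mul1r.
exact: simeq_within_factor.
Qed.

(** One compact neighbourhood is carried to all points by the translations. *)
Lemma uniform_compact_balls L : 1 <= L -> translations L ->
  locally_compact [set: X] -> X ->
  exists2 rho : R, 0 < rho & forall x : X, compact [set y | mdist x y <= rho].
Proof.
move=> L1 LT lc p; have [U nU [cU _]] := lc p I.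
have /nbhs_distP[e e0 eU] : nbhs p U.
  have nU' : nbhs p (fun x => [set: X] x -> U x) := nU.
  by apply: (@filterS _ (nbhs p) _ _ _ _ nU') => x; exact.
have L0 : 0 < L by lra.
exists (e / 2 / L); first by rewrite !divr_gt0.
move=> x; have [h [h' [hh hx]]] := LT x p.
apply: (compact_ball_pullback (lam := 1) (r := e / 2) _ _ hh) => //; first by lra.
- rewrite hx; apply: (subclosed_compact _ cU); first exact: closed_closed_ball.
  by move=> y /= py; apply: eU; lra.
- by rewrite mul1r mulrC divfK// gt_eqF.
Qed.

Lemma unbounded_far : unbounded_space X -> forall (p : X) (r : R), exists y, r < mdist p y.
Proof.
move=> Xu p r; apply: contrapT => /forallNP pr.
have : (diam [set: X] <= (2 * `|r|)%:E)%E.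
  apply: ub_ereal_sup => t [->|[[x y] _ <-]] /=.
    by rewrite lee_fin mulr_ge0.
  rewrite lee_fin (le_trans (metric_triangle x p y))//.
  have far z : mdist p z <= `|r|.
    by have /negP := pr z; rewrite -leNgt => /le_trans; apply; exact: ler_norm.
  by rewrite mulr_natl mulr2n lerD// metric_sym.
by rewrite Xu leye_eq.
Qed.

Lemma unbounded_inhabited : unbounded_space X -> inhabited X.
Proof.
move=> Xu; apply: contrapT => nX.
have : (diam [set: X] <= 0)%E.
  apply: ub_ereal_sup => t [->//|[[x y] _ _]].
  by case: nX; constructor.
by rewrite Xu leye_eq.
Qed.

Definition punctured_inversion (p : X) (L : R) (s s' : X -> X) :=
  [/\ 1 <= L,
      forall y, y <> p -> [/\ s y <> p, s' y <> p, s' (s y) = y & s (s' y) = y] &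
      forall x y, x <> p -> y <> p ->
        within_factor L (mdist (s x) (s y)) (mdist x y / (mdist x p * mdist y p))].

(** The inversion and its inverse are made total by giving the centre the
    value [p]. *)
Lemma quasi_invertible_inversion : quasi_invertible X ->
  exists p L s s', punctured_inversion p L s s'.
Proof.
move=> [p [L [L1 [sigma [[tau [sK tK _ _]] sP]]]]].
have inp y : y <> p -> y \in ~` [set p] by move=> yp; rewrite inE.
have ninp (z : ~` [set p]) : set_val z <> p by have := set_valP z.
pose ext (f : ~` [set p] -> ~` [set p]) (y : X) : X :=
  if pselect (y <> p) is left yp then set_val (f (SigSub (inp y yp))) else p.
have extE f y (yp : y \in ~` [set p]) : ext f y = set_val (f (SigSub yp)).
  rewrite /ext; case: pselect => [yp'|nyp]; last by exfalso; apply: nyp; exact: (set_mem yp).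
  by congr (set_val (f _)); exact: val_inj.
have extv f z : ext f (set_val z) = set_val (f z).
  rewrite (extE f (set_val z) (mem_set (set_valP z))); congr (set_val (f _)).
  exact: val_inj.
exists p, L, (ext sigma), (ext tau); split => //.
  move=> y yp.
  by rewrite !(extE _ _ (inp _ yp)) !extv sK tK; split => //; exact: ninp.
move=> x y xp yp; rewrite !(extE _ _ (inp _ xp)) (extE _ _ (inp _ yp)).
exact/(simeq_within_factor L1)/sP.
Qed.

End Dilations.

(** * Behaviour of the inversion at infinity *)

Section InversionAtInfinity.
Context {R : realType} {X : metricType R}.

(** The quotient [d(v, y) / d(y, p)] lies between 1/2 and 2 once [y] is far. *)
Lemma inversion_far (p : X) L s s' : punctured_inversion p L s s' ->
  forall v y, v <> p -> 2 * mdist v p <= mdist y p ->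
  within_factor (2 * L) (mdist (s v) (s y)) (mdist v p)^-1.
Proof.
move=> [L1 sP s2] v y vp vy.
have v0 : 0 < mdist v p by rewrite mdist_gt0; apply/eqP.
have y0 : 0 < mdist y p by lra.
have yp : y <> p by move=> yp; move: y0; rewrite yp mdistxx ltxx.
have [h1 h2] := s2 v y vp yp.
have t1 := metric_triangle v p y; have t2 := metric_triangle y v p.
rewrite (metric_sym p y) in t1; rewrite (metric_sym y v) in t2.
set a := mdist v p in v0 vy h1 h2 t1 t2 *; set b := mdist y p in y0 vy h1 h2 t1 t2.
set c := mdist v y in h1 h2 t1 t2; set m := mdist (s v) (s y) in h1 h2 *.
have e : c / (a * b) = (c / b) * a^-1 by field; rewrite !gt_eqF.
have ia : 0 < a^-1 by rewrite invr_gt0.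
have cb1 : c / b <= 2 by rewrite ler_pdivrMr//; lra.
have cb2 : 2^-1 <= c / b by rewrite ler_pdivlMr//; lra.
rewrite e in h1 h2; split.
  have -> : 2 * L * a^-1 = L * (2 * a^-1) by ring.
  by rewrite (le_trans h1)// ler_wpM2l ?ler_wpM2r//; lra.
rewrite -mulrA; have : 2^-1 * a^-1 <= L * m by rewrite (le_trans _ h2)// ler_wpM2r// ltW.
lra.
Qed.

(** By [inversion_far] it suffices that [s y] accumulates at [p] along a
    sequence of points [y] going to infinity. The images of such a sequence
    stay in a compact ball, up to finitely many. No point [s v] is a cluster
    point of them, because [d(s v, s y)] is about [1 / d(v, p)] for all far
    [y]; and every point but [p] is some [s v]. *)
Lemma inversion_norm (p : X) L s s' (rho : R) : punctured_inversion p L s s' ->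
  unbounded_space X -> 0 < rho ->
  (forall x : X, compact [set y | mdist x y <= rho]) ->
  forall x, x <> p -> within_factor (4 * L) (mdist (s x) p) (mdist x p)^-1.
Proof.
move=> sinv Xu rho0 crho x xp.
have [L1 sP s2] := sinv; have L0 : 0 < L by lra.
have [y yfar] := choice (fun n : nat => unbounded_far Xu p n.+1%:R).
have ypos n : 0 < mdist (y n) p by rewrite metric_sym (lt_trans _ (yfar n)).
have yp n : y n <> p by move=> e; have := ypos n; rewrite e mdistxx ltxx.
have [N NP] : exists N, forall n, (N <= n)%N -> mdist (s (y N)) (s (y n)) <= rho.
  pose N := Num.truncn (2 * L / rho); exists N => n Nn.
  have Nr : 2 * L / rho < N.+1%:R by rewrite truncnS_gt.
  have NN : 2 * L / rho < mdist (y N) p by rewrite metric_sym (lt_trans Nr).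
  have Nn' : 2 * L / rho < mdist (y n) p.
    by rewrite metric_sym (lt_trans Nr)// (le_lt_trans _ (yfar n))// ler_nat ltnS.
  rewrite (le_trans (s2 _ _ (yp N) (yp n)).1)//.
  have := metric_triangle (y N) p (y n); rewrite (metric_sym p).
  have := ypos N; have := ypos n; move: NN Nn'.
  move: (mdist (y N) p) (mdist (y n) p) (mdist (y N) (y n)) => a b c.
  rewrite !ltr_pdivrMr// => al bl b0 a0 cab.
  rewrite mulrA ler_pdivrMr ?mulr_gt0//.
  have h1 : L * c <= L * (a + b) by rewrite ler_pM2l.
  have h2 : 0 <= (a * rho - 2 * L) * b by rewrite mulr_ge0; lra.
  have h3 : 0 <= (b * rho - 2 * L) * a by rewrite mulr_ge0; lra.
  by nra.
have [z _ zP] : exists2 z, mdist (s (y N)) z <= rho &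
    forall (e : R) M, 0 < e -> exists2 n, (M <= n)%N & mdist (s (y (N + n)%N)) z < e.
  apply: (compact_seq_cluster (u := fun n => s (y (N + n)%N)) (crho (s (y N)))) => n /=.
  by apply: NP; exact: leq_addr.
have far v : v <> p -> forall e, 0 < e -> exists n, 2 * mdist v p <= mdist (y n) p /\
    mdist (s (y n)) z < e.
  move=> vp e e0; have [n nM ne] := zP e (Num.truncn (2 * mdist v p)) e0.
  exists (N + n)%N; split => //.
  rewrite [leRHS]metric_sym (le_trans _ (ltW (yfar _)))// ltW//.
  rewrite (lt_le_trans (truncnS_gt _))// ler_nat ltnS (leq_trans nM)//.
  exact: leq_addl.
have pos v : v <> p -> 0 < mdist v p by move=> vp; rewrite mdist_gt0; apply/eqP.
have zp : z = p.
  apply: contrapT => zp; have [_ s'z _ ss'] := sP z zp.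
  have v0 := pos _ s'z.
  have [|n [n1 n2]] := far _ s'z (2 * L * mdist (s' z) p)^-1.
    by rewrite invr_gt0 !mulr_gt0.
  have [_] := inversion_far sinv s'z n1; rewrite ss' => h.
  move: n2; rewrite metric_sym invfM ltNge ler_pdivrMl ?mulr_gt0// => /negP; apply.
  exact: h.
have x0 := pos _ xp.
have [|n [n1 n2]] := far _ xp (4 * L * mdist x p)^-1.
  by rewrite invr_gt0 !mulr_gt0.
rewrite zp in n2; have [h1 h2] := inversion_far sinv xp n1.
have t1 := metric_triangle (s x) (s (y n)) p.
have t2 := metric_triangle (s x) p (s (y n)); rewrite (metric_sym p) in t2.
have i0 : 0 < (mdist x p)^-1 by rewrite invr_gt0.
have il0 : L * L^-1 = 1 by rewrite mulfV// gt_eqF.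
have Li : L^-1 <= L by rewrite (@le_trans _ _ 1)// invf_le1.
move: n2; rewrite !invfM => n2.
set i := (mdist x p)^-1 in h1 h2 i0 n2 *.
set m := mdist (s (y n)) p in t1 t2 n2; set a := mdist (s x) p in t1 t2 *.
set b := mdist (s x) (s (y n)) in t1 t2 h1 h2.
have Lii : L^-1 * i <= L * i by rewrite ler_wpM2r// ltW.
split; first by nra.
have h3 : i - L * b * 2 <= 0 by lra.
have h4 : L * b <= L * (a + m) by rewrite ler_pM2l.
have h5 : L * m <= L * (4^-1 * L^-1 * i) by rewrite ler_pM2l// ltW.
have h6 : L * (4^-1 * L^-1 * i) = 4^-1 * i by rewrite mulrA mulrCA il0 mulr1.
lra.
Qed.

End InversionAtInfinity.

(** * Curves and attained distances *)

Section Curves.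
Context {R : realType}.

Lemma mdist_line (x y : R) : mdist (x : R^o) (y : R^o) = `|x - y|.
Proof. by rewrite distrC. Qed.

Lemma continuous_curveP (X : metricType R) (f : R -> X) (x : R) :
  {for x, continuous f} <-> forall e : R, 0 < e -> exists2 d : R, 0 < d &
    forall y, `|x - y| < d -> mdist (f x) (f y) < e.
Proof.
split=> [/(@continuous_distP _ R^o X f x) cf e /cf [d d0 dP]|cf].
  by exists d => // y xy; apply: dP; rewrite mdist_line.
apply/(@continuous_distP _ R^o X f x) => e /cf [d d0 dP].
by exists d => // y; rewrite mdist_line; exact: dP.
Qed.

Lemma continuous_realP (X : metricType R) (f : X -> R) (x : X) :
  {for x, continuous f} <-> forall e : R, 0 < e -> exists2 d : R, 0 < d &
    forall y, mdist x y < d -> `|f x - f y| < e.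
Proof.
split=> [/(@continuous_distP _ X R^o f x) cf e /cf [d d0 dP]|cf].
  by exists d => // y xy; rewrite -mdist_line; apply: dP.
apply/(@continuous_distP _ X R^o f x) => e /cf [d d0 dP].
by exists d => // y; rewrite mdist_line; exact: dP.
Qed.

Context (X : metricType R).

Lemma continuous_mdist (p : X) : continuous (mdist p : X -> R).
Proof.
move=> x; apply/continuous_realP => e e0; exists e => // y xy.
exact: (le_lt_trans (mdist_abs_sub p x y)).
Qed.

(** The parameter is retracted to the interval, which removes the restriction
    on its range once and for all. *)
Lemma curve_extend (a b : R) (g : R -> X) : is_curve a b g ->
  exists2 G : R -> X, continuous G & forall t, t \in `[a, b] -> G t = g t.
Proof.
move=> [ab cg]; pose clamp (t : R) := Num.max a (Num.min b t).
have cI t : clamp t \in `[a, b].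
  by rewrite /clamp in_itv /=; rewrite le_max lexx/= ge_max ab/= ge_min lexx.
have cE t : t \in `[a, b] -> clamp t = t.
  by rewrite in_itv/= => /andP[at_ tb]; rewrite /clamp min_r// max_r.
have cL s t : `|clamp s - clamp t| <= `|s - t|.
  wlog le_st : s t / s <= t.
    by move=> W; case: (leP s t) => [/W//|/ltW/W]; rewrite distrC (distrC s).
  have st0 : 0 <= t - s by rewrite subr_ge0.
  rewrite distrC (distrC s) (ger0_norm st0) ler_norml; apply/andP; split.
    rewrite (@le_trans _ _ 0) ?oppr_le0// subr_ge0 /clamp.
    rewrite ge_max; apply/andP; split; rewrite le_max ?lexx//.
    by apply/orP; right; rewrite le_min !ge_min lexx le_st orbT.
  rewrite lerBlDr {1}/clamp ge_max; apply/andP; split.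
    by rewrite ler_wpDl// /clamp le_max lexx.
  apply: (@le_trans _ _ (t - s + Num.min b s)); last by rewrite lerD2l /clamp le_max lexx orbT.
  by case: (leP b s) => _; rewrite ge_min ?subrK ?lexx ?orbT// lerDr st0.
exists (fun t => g (clamp t)); last by move=> t tI; rewrite cE.
move=> t0; apply/continuous_curveP => e e0.
have := (subspace_continuousP _ _).1 cg (clamp t0) (cI t0).
move=> /cvgrPdist_lt /(_ e e0); rewrite /= near_withinE => /(@nbhs_distP _ R^o)[d d0 dP].
exists d => // y t0y; apply: dP; last exact: cI.
by rewrite mdist_line (le_lt_trans (cL _ _)).
Qed.

Lemma curve_distance_attained (G : R -> X) (p : X) (a b v : R) : continuous G ->
  a <= b -> G a = p -> 0 <= v <= mdist p (G b) ->
  exists2 c, c \in `[a, b] & mdist p (G c) = v.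
Proof.
move=> cG ab Ga /andP[v0 vb].
apply: (@IVT R (fun t => mdist p (G t)) a b v ab).
  apply: continuous_subspaceT => t; apply: continuous_comp; first exact: cG.
  exact: continuous_mdist.
by rewrite Ga mdistxx ge_min le_max v0 vb orbT.
Qed.

Lemma nondegenerate_curve_arc : has_nondegenerate_curve X ->
  exists (G : R -> X) (a b : R), [/\ continuous G, a <= b & G a <> G b].
Proof.
move=> [a [b [g [cg [s [t [sI tI st]]]]]]].
have [G cG GE] := curve_extend cg.
case: (leP s t) => [le_st|/ltW le_ts].
  by exists G, s, t; split => //; rewrite !GE.
by exists G, t, s; split => //; rewrite !GE// => e; apply: st.
Qed.

(** The distance to the initial point takes all intermediate values along the
    curve, and translations move the initial point anywhere. *)
Lemma small_distances_attained L : 1 <= L -> translations X L ->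
  has_nondegenerate_curve X ->
  exists2 eps : R, 0 < eps & forall (p : X) (v : R), 0 <= v <= eps ->
    exists q, mdist p q = v.
Proof.
move=> L1 LT /nondegenerate_curve_arc[G [a [b [cG ab Gab]]]].
have L0 : 0 < L by lra.
have Gab0 : 0 < mdist (G a) (G b) by rewrite mdist_gt0; apply/eqP.
exists (mdist (G a) (G b) / L); first by rewrite divr_gt0.
move=> p v /andP[v0 vL]; have [h [h' [hh hGa]]] := LT (G a) p.
have ch := quasi_similarity_continuous hh.
have [_ _ hP] := hh.
have [||c _ <-] := @curve_distance_attained (h \o G) p a b v _ ab hGa.
- by move=> t; apply: continuous_comp; [exact: cG|exact: ch].
- rewrite v0 (le_trans vL)//= ler_pdivrMr// mulrC -hGa.
  by have := (hP (G a) (G b)).2; rewrite mul1r.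
- by exists (h (G c)).
Qed.

End Curves.

(** * Dilations and inversions at every point *)

Section Homogeneity.
Context {R : realType}.

Definition dilations (X : metricType R) (M : R) := forall (x y : X) (lam : R), 0 < lam ->
  exists h h' : X -> X, quasi_similarity M lam h h' /\ h x = y.

Definition inversions (X : metricType R) (C : R) := forall p : X, exists w f,
  [/\ quasi_mobius C w f, f (Some p) = None & f None = Some p].

Context (X : metricType R).

Lemma translation_omap L (h h' : X -> X) : 1 <= L -> quasi_similarity L 1 h h' ->
  quasi_mobius L (fun=> 1) (omap h).
Proof.
move=> L1 [hK h'K hP]; apply: quasi_mobius_omap => //; first by exists h'.
by move=> u v; have := hP u v; rewrite mul1r.
Qed.

(** On the line, with [s x = 1 / x], the composition of [s], [x |-> x + a],
    [s], [x |-> x - 1 / a] and [s] is [x |-> - a - a^2 x]. In general the two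
    translations are chosen so that the composition fixes infinity: [f] takes
    [p] to a point [q] at distance [a], and [g] takes [s q] to [p]. *)
Lemma small_dilation (p : X) L (s : X -> X) (eps : R) : 1 <= L -> translations X L ->
  quasi_mobius (4 * L) (inversion_weight p) (inversion_ext p s) ->
  (forall y, y <> p -> s y <> p) ->
  (forall (p : X) (v : R), 0 <= v <= eps -> exists q, mdist p q = v) ->
  exists2 M : R, 1 <= M & forall a, 0 < a <= eps ->
    exists h h' : X -> X, quasi_similarity M (a ^+ 2) h h'.
Proof.
move=> L1 LT sQ sp attained; have L0 : 0 < L by lra.
have C0 : 0 <= 4 * L by lra.
pose C := 4 * L * (L * (4 * L * (L * (4 * L)))).
have C1 : 1 <= C.
  have E : 1 <= 4 * L by lra.
  by rewrite /C; do !apply: mulr_ege1 => //.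
exists (C ^+ 3); first exact: exprn_ege1.
move=> a /andP[a0 aeps]; have [|q pq] := attained p a; first by rewrite (ltW a0).
have qp : q <> p by move=> e; move: a0; rewrite -pq e mdistxx ltxx.
have [f [f' [ff fp]]] := LT p q.
have [g [g' [gg gsq]]] := LT (s q) p.
have fQ := translation_omap L1 ff; have gQ := translation_omap L1 gg.
have L0' := ltW L0.
have Q1 := quasi_mobius_comp C0 L0' sQ fQ.
have Q2 := quasi_mobius_comp (mulr_ge0 L0' C0) C0 Q1 sQ.
have Q3 := quasi_mobius_comp (mulr_ge0 C0 (mulr_ge0 L0' C0)) L0' Q2 gQ.
have Q4 := quasi_mobius_comp (mulr_ge0 L0' (mulr_ge0 C0 (mulr_ge0 L0' C0))) C0 Q3 sQ.
have [|h [h' [hK h'K _ hP]]] := quasi_mobius_fix_None (ltW (lt_le_trans ltr01 C1)) Q4.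
  rewrite /= fp; move/eqP/negbTE : (qp) => -> /=.
  by rewrite gsq eqxx.
exists h, h'; split=> // u v.
have := hP u v; rewrite -/C /= fp; move/eqP/negbTE : (qp) => -> /=.
rewrite gsq eqxx !mulr1 !mul1r (metric_sym q p) pq.
by rewrite exprVn invrK.
Qed.

(** Small ratios are squares [a ^+ 2] with [a <= eps], and large ones are
    inverses of small ones. The ratios in between are bounded above and below,
    and translations serve for them at the price of the constant. *)
Lemma all_dilations L (eps M0 : R) : 1 <= L -> translations X L -> 0 < eps -> 1 <= M0 ->
  (forall a, 0 < a <= eps -> exists h h' : X -> X, quasi_similarity M0 (a ^+ 2) h h') ->
  exists2 M : R, 1 <= M & dilations X M.
Proof.
move=> L1 LT eps0 M01 small; have L0 : 0 <= L by lra.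
have M00 : 0 <= M0 by lra.
have e20 : 0 < eps ^- 2 by rewrite invr_gt0 exprn_gt0.
pose M := L * M0 + L * eps ^- 2.
have M1 : 1 <= M.
  by rewrite /M; apply: ler_wpDr; [rewrite mulr_ge0// ltW|exact: mulr_ege1].
exists M => // x y lam lam0.
have via (h h' : X -> X) : quasi_similarity M0 lam h h' ->
    exists k k' : X -> X, quasi_similarity M lam k k' /\ k x = y.
  move=> hh; have [f [f' [ff fy]]] := LT (h x) y.
  exists (f \o h), (h' \o f'); split => //.
  have := quasi_similarity_comp ltr01 M00 L0 hh ff; rewrite mul1r.
  by apply: quasi_similarity_weaken => //; rewrite lerDl mulr_ge0// ltW.
have root (c : R) : 0 < c -> c <= eps ^+ 2 -> exists2 a, 0 < a <= eps & a ^+ 2 = c.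
  move=> c0 ceps; exists (Num.sqrt c); last by rewrite sqr_sqrtr// ltW.
  by rewrite sqrtr_gt0 c0/=; have := ler_wsqrtr ceps; rewrite sqrtr_sqr gtr0_norm.
case: (leP lam (eps ^+ 2)) => [lam_small|lam_big].
  have [a aeps a2] := root _ lam0 lam_small.
  have [h [h' hh]] := small a aeps; rewrite a2 in hh; exact: via hh.
case: (leP lam^-1 (eps ^+ 2)) => [lam_big'|lam_small].
  have [|a aeps a2] := root _ _ lam_big'; first by rewrite invr_gt0.
  have [h [h' hh]] := small a aeps.
  apply: (via h' h); rewrite -(invrK lam) -a2; apply: quasi_similarity_inv => //.
  by case/andP : aeps => a0 _; rewrite exprn_gt0.
have [h [h' [[hK h'K hP] hy]]] := LT x y.
exists h, h'; split=> //; split=> // u v.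
have := hP u v; rewrite mul1r => -[h1 h2].
have d0 := mdist_ge0 u v; have dh0 := mdist_ge0 (h u) (h v).
have LM : L * eps ^- 2 <= M by rewrite lerDr mulr_ge0.
have e2lam : 1 <= eps ^- 2 * lam by rewrite ler_pdivlMl ?exprn_gt0// mulr1 ltW.
have lame2 : lam <= eps ^- 2.
  rewrite -[lam]invrK lef_pV2 ?posrE ?invr_gt0 ?exprn_gt0//; exact: ltW.
split.
  rewrite (le_trans h1)// (@le_trans _ _ (L * eps ^- 2 * (lam * mdist u v)))//; last first.
    by rewrite ler_wpM2r// mulr_ge0// ltW.
  rewrite -mulrA ler_wpM2l// mulrA ler_peMl//.
rewrite (@le_trans _ _ (L * eps ^- 2 * mdist (h u) (h v)))//; last by rewrite ler_wpM2r.
rewrite (@le_trans _ _ (eps ^- 2 * mdist u v))//; first by rewrite ler_wpM2r.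
by rewrite [L * _]mulrC -mulrA ler_wpM2l// ltW.
Qed.

(** The inversion is conjugated by a translation. *)
Lemma all_inversions (p : X) L C (s : X -> X) : 1 <= L -> 0 <= C -> translations X L ->
  quasi_mobius C (inversion_weight p) (inversion_ext p s) -> inversions X (L * (C * L)).
Proof.
move=> L1 C0 LT sQ q; have L0 : 0 < L by lra.
have [h [h' [hh hq]]] := LT q p.
have hQ := translation_omap L1 hh.
have hQ' : quasi_mobius L (fun=> 1) (omap h').
  apply: (translation_omap (h' := h) L1); rewrite -invr1.
  exact: quasi_similarity_inv.
have Q1 := quasi_mobius_comp (ltW L0) C0 hQ sQ.
have Q2 := quasi_mobius_comp (mulr_ge0 C0 (ltW L0)) (ltW L0) Q1 hQ'.
exists (fun x => 1 * inversion_weight p (omap h x) * 1), (omap h' \o (inversion_ext p s \o omap h)).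
split => //=; first by rewrite hq eqxx.
by case: hh => hK _ _; rewrite -hq hK.
Qed.

Lemma dilations_proper (M rho : R) : 1 <= M -> dilations X M -> 0 < rho ->
  (forall x : X, compact [set y | mdist x y <= rho]) -> proper_space X.
Proof.
move=> M1 dil rho0 crho x r.
have M0 : 0 < M by lra.
have r1 : 0 < `|r| + 1 by rewrite ltr_wpDl.
have [|h [h' [hh hx]]] := dil x x (rho / (M * (`|r| + 1))).
  by rewrite divr_gt0// mulr_gt0.
apply: (compact_ball_pullback (r := rho) _ (ltW M0) hh).
- by rewrite divr_gt0// mulr_gt0.
- exact: crho.
have -> : M * (rho / (M * (`|r| + 1)) * r) = rho * (r / (`|r| + 1)).
  by field; rewrite !gt_eqF.
rewrite ler_piMr//; first exact: ltW.
by rewrite ler_pdivrMr// mul1r (le_trans (ler_norm r))// lerDl.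
Qed.

Lemma invertible_space_structure :
  unbounded_space X -> locally_compact [set: X] ->
  unif_bilipschitz_homogeneous X -> quasi_invertible X ->
  has_nondegenerate_curve X ->
  exists2 M : R, 1 <= M & [/\ dilations X M, inversions X M & proper_space X].
Proof.
move=> Xu Xlc /homogeneous_translations[L0 L01 LT0].
move=> /quasi_invertible_inversion[p [L' [s [s' [L'1 sP s2]]]]] Xc.
pose L := L0 + L'; have L1 : 1 <= L by rewrite /L; lra.
have LT : translations X L.
  move=> x y; have [h [h' [hh hx]]] := LT0 x y; exists h, h'; split => //.
  by apply: quasi_similarity_weaken hh => //; rewrite /L; lra.
have pinv : punctured_inversion p L s s'.
  split => // x y xp yp; apply: within_factor_weaken (s2 x y xp yp).
  - by rewrite /L; lra.
  - exact: mdist_ge0.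
  - by rewrite divr_ge0 ?mulr_ge0 ?mdist_ge0.
have [_ _ s2'] := pinv.
have [rho rho0 crho] := uniform_compact_balls L1 LT Xlc p.
have s1 := inversion_norm pinv Xu rho0 crho.
have C1 : 1 <= 4 * L by lra.
have sQ : quasi_mobius (4 * L) (inversion_weight p) (inversion_ext p s).
  apply: (quasi_mobius_inversion (s' := s')) => // x y xp yp.
  apply: within_factor_weaken (s2' x y xp yp) => //.
  - lra.
  - exact: mdist_ge0.
  - by rewrite divr_ge0 ?mulr_ge0 ?mdist_ge0.
have [eps eps0 attained] := small_distances_attained L1 LT Xc.
have [|M0 M01 small] := small_dilation L1 LT sQ _ attained.
  by move=> y yp; have [] := sP y yp.
have [M2 M21 dil] := all_dilations L1 LT eps0 M01 small.
have inv := all_inversions L1 (le_trans ler01 C1) LT sQ.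
have C2 : 1 <= L * (4 * L * L) by do !apply: mulr_ege1 => //.
exists (M2 + L * (4 * L * L)); first by lra.
split.
- move=> x y lam lam0; have [h [h' [hh hx]]] := dil x y lam lam0; exists h, h'; split => //.
  by apply: quasi_similarity_weaken hh => //; lra.
- move=> q; have [w [f [[bf w0 fQ] f1 f2]]] := inv q; exists w, f; split => //.
  split => // x y; apply: within_factor_weaken (fQ x y); first lra.
    exact: odist_ge0.
  by rewrite !mulr_ge0 ?odist_ge0// ltW.
- exact: dilations_proper dil rho0 crho.
Qed.

End Homogeneity.

(** * Quasi-Moebius maps away from the pole *)

Section PoleEstimates.
Context {R : realType} {X : metricType R}.

(** The pole is sent to infinity, at distance 1 of all other images; comparing
    a point with the pole therefore bounds its weight by the inverse of its
    distance to the pole. *)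
Lemma quasi_mobius_lipschitz C w (f : option X -> option X) pole (c : R) :
  0 <= C -> quasi_mobius C w f -> f pole = None -> 0 < c ->
  exists2 K : R, 0 <= K & forall x y, c <= odist x pole -> c <= odist y pole ->
    odist (f x) (f y) <= K * odist x y.
Proof.
move=> C0 [[g fK gK] w0 fP] fp c0; have wp := w0 pole.
pose B := C / (c * w pole).
have B0 : 0 <= B by rewrite divr_ge0// mulr_ge0// ltW.
have wB x : c <= odist x pole -> w x <= B.
  move=> cx; rewrite /B ler_pdivlMr ?mulr_gt0//.
  have o1 : odist (f x) (f pole) = 1.
    rewrite fp; case E : (f x) => [y|]//=.
    have xp : x = pole by apply: (can_inj fK); rewrite E fp.
    by move: cx; rewrite xp; case: (pole) => [z|]/=; rewrite ?mdistxx => cx; exfalso; lra.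
  have [_] := fP x pole; rewrite o1 mulr1; apply: le_trans.
  rewrite mulrCA ler_wpM2r// mulr_ge0// ltW//.
exists (C * (B * B)); first by apply: mulr_ge0 => //; exact: mulr_ge0.
move=> x y cx cy; have [h _] := fP x y; rewrite (le_trans h)// -mulrA ler_wpM2l//.
rewrite mulrC ler_wpM2r ?odist_ge0//.
by apply: ler_pM; rewrite ?wB// ltW.
Qed.

Lemma quasi_mobius_continuous C w (f : option X -> option X) (x y : X) :
  0 <= C -> quasi_mobius C w f -> f (Some x) = Some y ->
  forall e : R, 0 < e -> exists2 d : R, 0 < d & forall x', mdist x x' < d ->
    exists2 y', f (Some x') = Some y' & mdist y y' < e.
Proof.
move=> C0 fQ fxy e e0; have [[g fK gK] _ _] := fQ.
pose pole := g None; have fp : f pole = None by rewrite gK.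
have xp : 0 < odist (Some x) pole.
  case E : pole => [z|]//=; rewrite mdist_gt0; apply: contra_eq_neq fxy => ->.
  by rewrite -E fp.
have [|K K0 KP] := quasi_mobius_lipschitz (c := odist (Some x) pole / 2) C0 fQ fp.
  by rewrite divr_gt0.
have K1 : 0 < K + 1 by rewrite ltr_wpDl.
pose m := Num.min (odist (Some x) pole / 2) (Num.min e 1 / (K + 1)).
exists m.
  by rewrite /m lt_min !divr_gt0// lt_min e0 ltr01.
move=> x'; rewrite lt_min => /andP[x'1]; rewrite ltr_pdivlMr// => x'2.
have h : odist (f (Some x)) (f (Some x')) < Num.min e 1.
  apply: le_lt_trans x'2; apply: (@le_trans _ _ (K * mdist x x')); last first.
    by rewrite mulrC ler_wpM2l ?mdist_ge0// lerDl.
  apply: (KP (Some x) (Some x')); first lra.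
  case E : pole x'1 => [z|] /=; last lra.
  by have := metric_triangle x x' z; lra.
move: h; rewrite fxy lt_min; case: (f (Some x')) => [y'|] /= /andP[h1 h2].
  by exists y'.
by rewrite ltxx in h2.
Qed.

Definition fin_image (f : option X -> option X) (A : set X) : set X :=
  [set y | exists2 x, A x & f (Some x) = Some y].

Lemma open_fin_image C w f (A : set X) : 0 <= C -> quasi_mobius C w f ->
  open A -> open (fin_image f A).
Proof.
move=> C0 fQ /open_distP oA; have [[g fK gK] _ _] := fQ.
have gQ := quasi_mobius_inv fK gK fQ.
apply/open_distP => y [x Ax fxy]; have [e e0 eA] := oA x Ax.
have gyx : g (Some y) = Some x by rewrite -fxy fK.
have [d d0 dP] := quasi_mobius_continuous C0 gQ gyx e0.
exists d => // y' /dP[x' gy' xx']; exists x'; first exact: eA.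
by rewrite -gy' gK.
Qed.

(** Images can only accumulate at an image point or at the image of infinity. *)
Lemma closure_fin_image C w f (A : set X) y : 0 <= C -> quasi_mobius C w f ->
  closed A -> closure (fin_image f A) y -> fin_image f A y \/ f None = Some y.
Proof.
move=> C0 fQ cA /closure_distP yA; have [[g fK gK] _ _] := fQ.
have gQ := quasi_mobius_inv fK gK fQ.
case gyx : (g (Some y)) => [x|]; last by right; rewrite -gyx gK.
left; exists x; last by rewrite -gyx gK.
move/closed_distP : cA; apply=> e e0.
have [d d0 dP] := quasi_mobius_continuous C0 gQ gyx e0.
have [y' [x' Ax' fx'] /dP[x'' gy']] := yA d d0.
move: gy'; rewrite -fx' fK => -[<-] ?.
by exists x'.
Qed.

Definition bounded_subset (A : set X) := exists (x : X) (r : R), forall y, A y -> mdist x y <= r.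

Lemma bounded_fin_image C w f (A : set X) p : 0 <= C -> quasi_mobius C w f ->
  f (Some p) = None -> closed A -> ~ A p -> bounded_subset (fin_image f A).
Proof.
move=> C0 fQ fp cA Ap.
have [e e0 eP] := closed_away cA Ap.
have [|K K0 KP] := quasi_mobius_lipschitz (c := Num.min e 1) C0 fQ fp.
  by rewrite lt_min e0 ltr01.
have [q fN] : exists q, f None = Some q.
  case E : (f None) => [q|]; first by exists q.
  by have [[g fK gK] _ _] := fQ; have : None = Some p by apply: (can_inj fK); rewrite E fp.
exists q, K => y [x Ax fxy].
have := KP None (Some x); rewrite fN fxy /= mulr1; apply.
  by rewrite ge_min lexx orbT.
by rewrite ge_min eP.
Qed.

End PoleEstimates.

(** * Connectedness *)

Section Branches.
Context {R : realType} {X : metricType R} {M : R}.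
Context (M1 : 1 <= M) (dil : dilations X M) (inv : inversions X M).
Context (Xc : has_nondegenerate_curve X).

Let M0 : 0 < M. Proof. by move: M1; lra. Qed.

Lemma cancel_image (h h' : X -> X) (A : set X) : cancel h h' -> cancel h' h ->
  h @` A = h' @^-1` A.
Proof.
move=> hK h'K; apply/seteqP; split => [_ [x Ax <-]|y Ay]; rewrite /= ?hK//.
by exists (h' y).
Qed.

Lemma similarity_image_open lam (h h' : X -> X) (A : set X) : 0 < lam ->
  quasi_similarity M lam h h' -> open A -> open (h @` A).
Proof.
move=> lam0 hh oA; have [hK h'K _] := hh; rewrite (cancel_image A hK h'K).
apply: open_comp oA => x _.
exact: (quasi_similarity_continuous (quasi_similarity_inv lam0 hh)).
Qed.

Lemma similarity_image_closed lam (h h' : X -> X) (A : set X) : 0 < lam ->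
  quasi_similarity M lam h h' -> closed A -> closed (h @` A).
Proof.
move=> lam0 hh cA; have [hK h'K _] := hh; rewrite (cancel_image A hK h'K).
apply: closed_comp cA => x _.
exact: (quasi_similarity_continuous (quasi_similarity_inv lam0 hh)).
Qed.

(** Scaled down and placed at the initial point of the curve, such a set would
    contain this point but not the final one. *)
Lemma no_bounded_clopen (B : set X) : open B -> closed B -> bounded_subset B ->
  B = set0.
Proof.
move=> oB cB [x0 [r Br]]; apply/seteqP; split => // b Bb.
have [G [s [t [cG st Gst]]]] := nondegenerate_curve_arc Xc.
pose D := mdist (G s) (G t); have D0 : 0 < D by rewrite mdist_gt0; apply/eqP.
have r0 : 0 <= r by rewrite (le_trans (mdist_ge0 x0 b))// Br.
pose lam := D / (2 * M * (2 * r + 1)).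
have r1 : 0 < 2 * r + 1 by lra.
have lam0 : 0 < lam by rewrite divr_gt0// !mulr_gt0.
have [h [h' [hh hb]]] := dil b (G s) lam0.
have [hK h'K hP] := hh.
have Bd y : B y -> mdist b y <= 2 * r.
  move=> By; rewrite (le_trans (metric_triangle b x0 y))// metric_sym.
  by have := Br b Bb; have := Br y By; lra.
have hB : (h @` B) (G t).
  have cI : connected (G @` `[s, t]).
    by apply: connected_continuous_connected; [exact: segment_connected|exact: continuous_subspaceT].
  have sI : s \in `[s, t] by rewrite in_itv/= lexx st.
  have tI : t \in `[s, t] by rewrite in_itv/= lexx st.
  have E : (G @` `[s, t]) `&` (h @` B) = G @` `[s, t].
    apply: cI.
    - by exists (G s); split; [exists s|exists b].
    - by exists (h @` B) => //; exact: similarity_image_open hh oB.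
    - by exists (h @` B) => //; exact: similarity_image_closed hh cB.
  have : (G @` `[s, t]) (G t) by exists t.
  by rewrite -E => -[].
have [y By hy] := hB.
have := (hP b y).1; rewrite hb hy -/D => hD.
have : M * (lam * mdist b y) <= D / 2.
  have -> : D / 2 = M * (lam * (2 * r + 1)) by rewrite /lam; field; rewrite !gt_eqF.
  by rewrite ler_wpM2l ?(ltW M0)// ler_wpM2l ?(ltW lam0)//; have := Bd y By; lra.
by move: hD D0; lra.
Qed.

(** [B] is clopen in the complement of [p]. *)
Definition branch (p : X) (B : set X) := [/\ open B, ~ B p & closed (B `|` [set p])].

Lemma similarity_image_branch lam (h h' : X -> X) p (B : set X) : 0 < lam ->
  quasi_similarity M lam h h' -> branch p B -> branch (h p) (h @` B).
Proof.
move=> lam0 hh [oB Bp cB]; have [hK h'K _] := hh; split.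
- exact: similarity_image_open hh oB.
- by move=> [x Bx] /(can_inj hK) xp; apply: Bp; rewrite -xp.
- by rewrite -image_set1 -image_setU; exact: similarity_image_closed hh cB.
Qed.

(** Let [B'] be a copy of [B] based at a point [q] of [B], and so large that
    it is not contained in [B]. If [p] lies in [B'], then [B `|` B'] is a
    nonempty bounded clopen set; otherwise [B' `\` B] is one. *)
Lemma no_bounded_branch (p : X) (B : set X) : branch p B -> bounded_subset B -> B = set0.
Proof.
move=> [oB Bp cB] [x0 [r Br]]; apply/seteqP; split => // q Bq /=.
have pq : p <> q by move=> pq; apply: Bp; rewrite pq.
have pq0 : 0 < mdist p q by rewrite mdist_gt0; apply/eqP.
have r0 : 0 <= r by rewrite (le_trans (mdist_ge0 x0 q))// Br.
pose rho := mdist p q + 2 * r + 1; have rho0 : 0 < rho by rewrite /rho; lra.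
pose lam := M * rho / mdist p q.
have lam0 : 0 < lam by rewrite divr_gt0// mulr_gt0.
have [h [h' [hh hp]]] := dil p q lam0; have [hK h'K hP] := hh.
have [oB' B'q cB'] : branch q (h @` B).
  by rewrite -hp; exact: (similarity_image_branch lam0 hh).
set B' := h @` B in oB' B'q cB'.
have bB' : bounded_subset B'.
  exists (h x0), (M * (lam * r)) => _ [y By <-].
  by rewrite (le_trans (hP x0 y).1)// ler_wpM2l ?(ltW M0)// ler_wpM2l ?(ltW lam0)// Br.
have Bd y : B y -> mdist q y <= 2 * r.
  move=> By; rewrite (le_trans (metric_triangle q x0 y))// metric_sym.
  by have := Br q Bq; have := Br y By; lra.
pose b := h q.
have b_far : rho <= mdist q b.
  have := (hP p q).2; rewrite hp -/b /lam divfK ?gt_eqF// => h1.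
  by move: h1; rewrite ler_pM2l.
have B'b : B' b by exists q.
have nBb : ~ B b by move=> /Bd; move: b_far; rewrite /rho; lra.
have bp : b <> p.
  by move=> bp; move: b_far; rewrite bp metric_sym /rho; lra.
have [B'p|nB'p] := pselect (B' p).
- suff E : B `|` B' = set0 by have : (B `|` B') q by [left]; rewrite E.
  apply: no_bounded_clopen; first exact: openU.
  + have -> : B `|` B' = (B `|` [set p]) `|` (B' `|` [set q]).
      apply/seteqP; split => [y [By|B'y]|y [[By|->]|[B'y|->]]].
      * by left; left.
      * by right; left.
      * by left.
      * by right.
      * by right.
      * by left.
    exact: closedU.
  + have [x1 [r1 Br1]] := bB'.
    exists x0, (`|r| + mdist x0 x1 + `|r1|) => y [By|B'y].
      have := Br y By; have := ler_norm r; have := mdist_ge0 x0 x1; have := normr_ge0 r1.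
      by lra.
    have := Br1 y B'y; have := ler_norm r1; have := metric_triangle x0 x1 y.
    by have := normr_ge0 r; lra.
- suff E : B' `\` (B `|` [set p]) = set0.
    have : (B' `\` (B `|` [set p])) b by split => // -[|].
    by rewrite E.
  apply: no_bounded_clopen.
  + by rewrite setDE; apply: openI => //; exact: closed_openC.
  + have -> : B' `\` (B `|` [set p]) = (B' `|` [set q]) `\` B.
      apply/seteqP; split => [y [B'y nBy]|y [[B'y|->]]].
      * by split; [left|move=> By; apply: nBy; left].
      * by move=> nBy; split => // -[//|/= yp]; apply: nB'p; rewrite -yp.
      * by move=> /(_ Bq).
    by rewrite setDE; apply: closedI => //; exact: open_closedC.
  + have [x1 [r1 Br1]] := bB'.
    by exists x1, r1 => y [/Br1].
Qed.

(** The inversion at a point outside a clopen set [V] makes [V] a bounded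
    branch at the image of infinity, which is the same point. *)
Lemma space_connected : connected [set: X].
Proof.
apply: contrapT => /not_connected[V [oV cV [v Vv] [p Vp]]].
have [w [f [fQ fp fN]]] := inv p.
have MM := ltW M0.
have [[g fK gK] _ _] := fQ.
have br : branch p (fin_image f V).
  split; first exact: open_fin_image fQ oV.
  - by move=> [x _]; rewrite -fN => /(can_inj fK).
  - apply/closure_id/seteqP; split; first exact: subset_closure.
    move=> y; rewrite closureU => -[/(closure_fin_image MM fQ cV)[|]|].
    + by left.
    + by rewrite fN => -[->]; right.
    + by move=> cy; right; move: cy; rewrite -((closure_id _).1 (closed_point p)).
have := no_bounded_branch br (bounded_fin_image MM fQ fp cV Vp).
case E : (f (Some v)) => [y|].
  by move=> F; have : fin_image f V y by [exists v]; rewrite F.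
have : Some v = Some p by rewrite -(fK (Some v)) E -fp fK.
by move=> -[vp]; rewrite vp in Vv.
Qed.

End Branches.

(** * Bounded turning *)

Section HolderPaths.
Context {R : realType} {X : metricType R}.

Lemma small_dyadic (a e : R) : 0 <= a -> 0 < e -> exists k, a / 2 ^+ k < e.
Proof.
move=> a0 e0; exists (Num.truncn (a / e)).+1.
rewrite ltr_pdivrMr ?exprn_gt0// mulrC -ltr_pdivrMr//.
rewrite (lt_le_trans (truncnS_gt _))// -natrX ler_nat.
exact/ltnW/ltn_expl.
Qed.

Lemma le0_eq (x y : X) : mdist x y <= 0 -> x = y.
Proof. by move=> h; apply/mdist_positivity/le_anti; rewrite h mdist_ge0. Qed.

Lemma dyadic_limit (x y : X) (a : R) : 0 <= a ->
  (forall k, mdist x y <= a / 2 ^+ k) -> x = y.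
Proof.
move=> a0 h; apply: le0_eq; apply/ler_addgt0Pl => e e0; rewrite addr0.
by have [k kP] := small_dyadic a0 e0; exact: le_trans (h k) (ltW kP).
Qed.

Definition subdivision (N : nat) (x y : X) (z : nat -> X) :=
  [/\ z 0%N = x, forall i, (N <= i)%N -> z i = y &
      forall i, mdist (z i) (z i.+1) <= mdist x y / 2].

Section Refine.
Context (N : nat) (N0 : (0 < N)%N) (split : X -> X -> nat -> X).
Context (splitP : forall x y, subdivision N x y (split x y)).
Context (Xproper : proper_space X).
Context (x y : X).
Let D := mdist x y.
Let D0 : 0 <= D. Proof. exact: mdist_ge0. Qed.

(** Every step of a chain is replaced by the subdivision between its ends. The
    point of index [i] at level [k] belongs to the parameter [i / N ^ k]. *)
Fixpoint refine k : nat -> X :=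
  if k is j.+1 then
    fun i => split (refine j (i %/ N)) (refine j (i %/ N).+1) (i %% N)
  else fun i => if i is 0%N then x else y.

Lemma split_dist u v i : mdist u (split u v i) <= i%:R * (mdist u v / 2).
Proof.
have [s0 _ s2] := splitP u v.
elim: i => [|i IH]; first by rewrite s0 mdistxx mul0r.
rewrite (le_trans (metric_triangle u (split u v i) _))// -natr1 mulrDl mul1r.
exact: lerD.
Qed.

Lemma refine_step k i : mdist (refine k i) (refine k i.+1) <= D / 2 ^+ k.
Proof.
elim: k i => [|k IH] i.
  by rewrite expr0 divr1; case: i => //= i; rewrite mdistxx.
set q := (i %/ N)%N; set r := (i %% N)%N.
have iE : i = (q * N + r)%N by exact: divn_eq.
have rN : (r < N)%N by rewrite ltn_mod.
have [_ s1 s2] := splitP (refine k q) (refine k q.+1).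
have bnd j : mdist (split (refine k q) (refine k q.+1) j)
                   (split (refine k q) (refine k q.+1) j.+1) <= D / 2 ^+ k.+1.
  rewrite (le_trans (s2 j))// exprSr invfM [_^-1 * _]mulrC mulrA mulrAC ler_wpM2r ?invr_ge0//.
case: (ltngtP r.+1 N) => rN'.
- rewrite /= -/q -/r.
  have -> : (i.+1 %/ N)%N = q by rewrite iE -addnS divnMDl// divn_small// addn0.
  have -> : (i.+1 %% N)%N = r.+1 by rewrite iE -addnS modnMDl modn_small.
  exact: bnd.
- by move: rN'; rewrite ltnS leqNgt rN.
- have iS : i.+1 = (q.+1 * N)%N by rewrite iE -addnS rN' mulSn addnC.
  have := bnd r; rewrite rN' (s1 N)// => h.
  rewrite /= -/q -/r.
  have -> : (i.+1 %/ N)%N = q.+1 by rewrite iS mulnK.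
  have -> : (i.+1 %% N)%N = 0%N by rewrite iS modnMl.
  by have [-> _ _] := splitP (refine k q.+1) (refine k q.+2).
Qed.

Lemma refine_parent k i :
  mdist (refine k (i %/ N)) (refine k.+1 i) <= N%:R * D / 2 ^+ k.+1.
Proof.
rewrite /= (le_trans (split_dist _ _ _))//.
rewrite -mulrA exprSr invfM [2 ^- k * _]mulrC [D * _]mulrCA [2^-1 * _]mulrC.
apply: ler_pM => //; first by rewrite mulr_ge0 ?mdist_ge0.
  by rewrite ler_nat ltnW// ltn_mod.
by rewrite ler_wpM2r//; exact: refine_step.
Qed.

Lemma refine_start k : refine k 0 = x.
Proof.
elim: k => [//|k IH]; rewrite /= div0n mod0n IH.
by have [-> _ _] := splitP x (refine k 1).
Qed.

Lemma refine_end k i : (N ^ k <= i)%N -> refine k i = y.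
Proof.
elim: k i => [|k IH] i; first by case: i.
move=> Ni; have Ni' : (N ^ k <= i %/ N)%N by rewrite leq_divRL// -expnSr.
rewrite /= !IH//; last by rewrite ltnW.
apply/esym/le0_eq; rewrite (le_trans (split_dist _ _ _))// mdistxx.
by rewrite mul0r mulr0.
Qed.

Let idx k (t : R) := Num.truncn ((N ^ k)%:R * t).
Let f k t := refine k (idx k t).

Let Nk0 k : 0 < (N ^ k)%:R :> R.
Proof. by rewrite ltr0n expn_gt0 N0. Qed.

Let idx_le0 k t : t <= 0 -> idx k t = 0%N.
Proof.
move=> t0; apply/truncn0Pn; rewrite -ltNge (le_lt_trans _ ltr01)//.
by rewrite pmulr_rle0.
Qed.

Let idxS k t : (idx k.+1 t %/ N)%N = idx k t.
Proof.
case: (leP t 0) => t0; first by rewrite !idx_le0// div0n.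
have Nt j : 0 <= (N ^ j)%:R * t :> R by rewrite mulr_ge0// ltW.
have NN : (N ^ k.+1)%:R * t = (N ^ k)%:R * t * N%:R by rewrite expnSr natrM mulrAC.
have N0' : 0 < N%:R :> R by rewrite ltr0n.
have /andP[h1 h2] := truncn_itv (Nt k); rewrite -/(idx k t) in h1 h2.
apply/eqP; rewrite eqn_leq; apply/andP; split.
  by rewrite -ltnS ltn_divLR// truncn_lt_nat// natrM NN ltr_pM2r.
by rewrite leq_divRL// truncn_ge_nat// natrM NN ler_pM2r.
Qed.

Let f_succ k t : mdist (f k t) (f k.+1 t) <= N%:R * D / 2 ^+ k.+1.
Proof. by rewrite /f -(idxS k t); exact: refine_parent. Qed.

Let ND0 : 0 <= N%:R * D. Proof. exact: mulr_ge0. Qed.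

Let f_tail k j t : mdist (f k t) (f (k + j) t) <= N%:R * D * (2 ^- k - 2 ^- (k + j)).
Proof.
elim: j => [|j IH]; first by rewrite addn0 mdistxx subrr mulr0.
rewrite addnS (le_trans (metric_triangle _ (f (k + j) t) _))//.
rewrite (le_trans (lerD IH (f_succ (k + j) t)))// -mulrDr ler_wpM2l//.
by rewrite exprSr invfM; lra.
Qed.

Let f_cauchy k j t : (k <= j)%N -> mdist (f k t) (f j t) <= N%:R * D / 2 ^+ k.
Proof.
move=> /subnKC <-; rewrite (le_trans (f_tail _ _ _))// ler_wpM2l//.
by rewrite lerBlDr lerDl invr_ge0 exprn_ge0.
Qed.

Let f_near k s t : `|s - t| < (N ^ k)%:R^-1 -> mdist (f k s) (f k t) <= D / 2 ^+ k.
Proof.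
wlog st : s t / s <= t.
  move=> W; case: (leP s t) => [/W//|/ltW/W]; rewrite distrC => h /h.
  by rewrite metric_sym.
rewrite distrC ger0_norm ?subr_ge0// -[_^-1]mulr1 ltr_pdivlMl// => h.
have is_le : (idx k s <= idx k t)%N by apply: le_truncn; rewrite ler_wpM2l.
have it_le : (idx k t <= (idx k s).+1)%N.
  rewrite /idx truncn_le_nat -natr1.
  have := truncnS_gt ((N ^ k)%:R * s); rewrite mulrBr in h; lra.
rewrite /f; move: is_le it_le; rewrite leq_eqVlt => /orP[/eqP <- _|].
  by rewrite mdistxx divr_ge0 ?exprn_ge0.
move=> h1 h2; have -> : idx k t = (idx k s).+1 by apply/eqP; rewrite eqn_leq h2 h1.
exact: refine_step.
Qed.

(** At a given parameter the levels [k] and [k.+1] differ by at most [N * D /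
    2 ^ k.+1], so that the levels converge uniformly, while neighbouring
    points of level [k] are [D / 2 ^ k] close. *)
Lemma refined_path : exists g : R -> X, [/\ continuous g,
  forall t, t <= 0 -> g t = x, forall t, 1 <= t -> g t = y &
  forall t, mdist x (g t) <= N.+1%:R * D].
Proof.
have /choice[g gP] : forall t, exists z, forall k, mdist (f k t) z <= N%:R * D / 2 ^+ k.
  move=> t.
  have cK : compact [set z | mdist (f 0%N t) z <= N%:R * D] by exact: Xproper.
  have [|z _ zP] := compact_seq_cluster (u := fun k => f k t) cK.
    by move=> k /=; have := f_cauchy t (leq0n k); rewrite expr0 divr1.
  exists z => k; apply/ler_addgt0Pr => e /(zP e k)[n kn nz].
  rewrite (le_trans (metric_triangle _ (f n t) _))// lerD//; last exact: ltW.
  exact: f_cauchy.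
exists g; split.
- move=> t0; apply/continuous_curveP => e e0.
  have [|k kP] := small_dyadic (a := (N%:R * D + (D + N%:R * D))) _ e0.
    by rewrite !addr_ge0.
  exists (N ^ k)%:R^-1; first by rewrite invr_gt0.
  move=> t t0t; apply: le_lt_trans kP; rewrite !mulrDl.
  rewrite (le_trans (metric_triangle _ (f k t0) _))// lerD//.
    by rewrite metric_sym.
  by rewrite (le_trans (metric_triangle _ (f k t) _))// lerD// f_near.
- move=> t t0; apply/esym/(dyadic_limit ND0) => k.
  by have := gP t k; rewrite /f idx_le0// refine_start.
- move=> t t1; apply/esym/(dyadic_limit ND0) => k.
  have := gP t k; rewrite /f refine_end// /idx truncn_ge_nat.
    by rewrite ler_peMr// ltW.
  by rewrite mulr_ge0//; lra.
- move=> t; rewrite (le_trans (metric_triangle _ (f 0%N t) _))// -natr1 mulrDl mul1r addrC.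
  apply: lerD; first by have := gP t 0%N; rewrite expr0 divr1.
  by rewrite /f; case: (idx 0 t) => [|n]; rewrite /refine ?mdistxx// lexx.
Qed.

End Refine.

Definition reach (eps : R) (n : nat) (x y : X) := exists z : nat -> X,
  [/\ z 0%N = x, forall i, (n <= i)%N -> z i = y &
      forall i, mdist (z i) (z i.+1) <= eps].

Lemma reach_refl eps n x : 0 <= eps -> reach eps n x x.
Proof. by move=> e0; exists (fun=> x); split => // i; rewrite mdistxx. Qed.

Lemma reach_weaken eps m n x y : (m <= n)%N -> reach eps m x y -> reach eps n x y.
Proof.
move=> mn [z [z0 zm zs]]; exists z; split => // i ni; apply: zm.
exact: leq_trans ni.
Qed.

Lemma reach_step eps n x y y' : 0 <= eps -> reach eps n x y -> mdist y y' <= eps ->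
  reach eps n.+1 x y'.
Proof.
move=> e0 [z [z0 zn zs]] yy'; exists (fun i => if (i <= n)%N then z i else y').
split => //.
- by move=> i ni; rewrite leqNgt ni.
- move=> i; case: (ltngtP i n) => [//|ni|->].
    by rewrite mdistxx.
  by rewrite zn.
Qed.

(** The set of reachable points is clopen. *)
Lemma connected_reach eps x y : connected [set: X] -> 0 < eps ->
  exists n, reach eps n x y.
Proof.
move=> cX e0; have E := @connected_clopen _ _ [set y | exists n, reach eps n x y] cX.
have e0' := ltW e0.
apply: E.
- apply/open_distP => u [n un]; exists eps => // v uv; exists n.+1.
  by apply: reach_step un _ => //; exact: ltW.
- apply/closed_distP => u uP; have [v [n vn] uv] := uP eps e0; exists n.+1.
  by apply: reach_step vn _ => //; rewrite metric_sym ltW.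
- by exists x, 0%N; exact: reach_refl.
Qed.

(** By compactness, the points of the unit ball about [p] are reached from [p]
    by a bounded number of steps of size [eps]. A dilation that maps [x] to
    [p] and [y] into the unit ball pulls such a chain back, and [eps] is so
    small that its steps become shorter than half the distance. *)
Lemma uniform_subdivision (M : R) : 1 <= M -> dilations X M -> proper_space X ->
  connected [set: X] -> inhabited X ->
  exists2 N, (0 < N)%N & forall x y, exists z, subdivision N x y z.
Proof.
move=> M1 dil Xp cX [p]; have M0 : 0 < M by lra.
pose eps : R := (2 * M ^+ 2)^-1; have e0 : 0 < eps by rewrite invr_gt0 mulr_gt0// exprn_gt0.
have [||n nP] := @compact_nested _ _ _ (fun n => [set y | reach eps n p y]) (Xp p 1).
- by move=> m n y mn; exact: reach_weaken.
- move=> y _; have [n yn] := connected_reach p y cX e0; exists n.+1.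
  apply/nbhs_distP; exists eps => // v yv.
  by apply: reach_step yn _; exact: ltW.
exists n.+1 => // x y; have [->|xy] := eqVneq x y.
  by exists (fun=> y); split => // i; rewrite mdistxx.
have D0 : 0 < mdist x y by rewrite mdist_gt0.
have lam0 : 0 < (M * mdist x y)^-1 by rewrite invr_gt0 mulr_gt0.
have [h [h' [hh hx]]] := dil x p _ lam0; have [hK h'K hP] := hh.
have [|z [z0 zn zs]] := nP (h y).
  rewrite /= -hx (le_trans (hP x y).1)//.
  have -> : M * ((M * mdist x y)^-1 * mdist x y) = 1 by field; rewrite !gt_eqF.
  exact: lexx.
exists (h' \o z); split => /=.
- by rewrite z0 -hx hK.
- by move=> i ni; rewrite zn ?hK// ltnW.
- move=> i; have := (hP (h' (z i)) (h' (z i.+1))).2; rewrite !h'K.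
  rewrite mulrC -ler_pdivlMr// invrK => /le_trans; apply.
  have -> : mdist x y / 2 = M * eps * (M * mdist x y).
    by rewrite /eps; field; rewrite gt_eqF.
  apply: ler_wpM2r; first by rewrite mulr_ge0// ltW.
  by rewrite ler_pM2l.
Qed.

Definition bounded_turning (K : R) := forall x y : X, exists g : R -> X,
  [/\ continuous g, forall t, t <= 0 -> g t = x, forall t, 1 <= t -> g t = y &
      forall t, mdist x (g t) <= K * mdist x y].

Lemma connected_bounded_turning (M : R) : 1 <= M -> dilations X M -> proper_space X ->
  connected [set: X] -> inhabited X -> exists2 K : R, 1 <= K & bounded_turning K.
Proof.
move=> M1 dil Xp cX iX; have [N N0 sub] := uniform_subdivision M1 dil Xp cX iX.
exists N.+1%:R; first by rewrite ler1n.
have /choice[split splitP] : forall xy, exists z, subdivision N xy.1 xy.2 z.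
  by move=> [x y]; exact: sub.
move=> x y.
exact: (@refined_path N N0 (fun x y => split (x, y)) (fun x y => splitP (x, y))).
Qed.

End HolderPaths.

Arguments bounded_turning {R} X K.

(** * Paths and continua *)

Section PathAlgebra.
Context {R : realType} {X : metricType R}.

Lemma continuous_paste (A B : R -> X) (c : R) : continuous A -> continuous B ->
  A c = B c -> continuous (fun t => if t <= c then A t else B t).
Proof.
move=> cA cB ABc t0; apply/continuous_curveP => e e0.
have [dA dA0 dAP] := (continuous_curveP _ _).1 (cA t0) e e0.
have [dB dB0 dBP] := (continuous_curveP _ _).1 (cB t0) e e0.
case: (ltgtP t0 c) => t0c.
- exists (Num.min dA (c - t0)); first by rewrite lt_min dA0 subr_gt0.
  move=> t; rewrite lt_min => /andP[/dAP h]; rewrite distrC => /ltr_normlW h2.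
  by case: (leP t c) => // ct; lra.
- exists (Num.min dB (t0 - c)); first by rewrite lt_min dB0 subr_gt0.
  move=> t; rewrite lt_min => /andP[/dBP h] /ltr_normlW h2.
  by case: (leP t c) => // ct; lra.
- exists (Num.min dA dB); first by rewrite lt_min dA0.
  move=> t; rewrite lt_min => /andP[/dAP hA /dBP hB].
  by case: (leP t c) => // _; rewrite t0c ABc -t0c.
Qed.

Lemma continuous_affine (g : R -> X) (a b : R) : continuous g ->
  continuous (fun t => g (a * t + b)).
Proof.
move=> cg t; apply: (@continuous_comp _ _ _ (fun t => a * t + b) g); last exact: cg.
by apply: continuousD; [apply: continuousM; [exact: cst_continuous|exact: id]|exact: cst_continuous].
Qed.

(** Paths are constant outside the unit interval, which makes them continuous
    on the whole line. *)
Definition path_in (U : set X) (x y : X) := exists g : R -> X,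
  [/\ continuous g, forall t, t <= 0 -> g t = x, forall t, 1 <= t -> g t = y &
      forall t, U (g t)].

Lemma path_in_sym U x y : path_in U x y -> path_in U y x.
Proof.
move=> [g [cg g0 g1 gU]]; exists (fun t => g (-1 * t + 1)); split.
- exact: continuous_affine.
- by move=> t t0; apply: g1; lra.
- by move=> t t1; apply: g0; lra.
- by [].
Qed.

Lemma path_in_trans U x y z : path_in U x y -> path_in U y z -> path_in U x z.
Proof.
move=> [g [cg g0 g1 gU]] [k [ck k0 k1 kU]].
exists (fun t => if t <= 2^-1 then g (2 * t + 0) else k (2 * t + -1)); split.
- by apply: continuous_paste; [exact: continuous_affine|exact: continuous_affine|
    rewrite g1 ?k0//; lra].
- by move=> t t0; case: leP => h; [apply: g0; lra|exfalso; lra].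
- by move=> t t1; case: leP => h; [exfalso; lra|apply: k1; lra].
- by move=> t; case: ifP.
Qed.

Lemma path_in_truncate U x y (g : R -> X) t0 : continuous g ->
  (forall t, t <= 0 -> g t = x) -> (forall t, 1 <= t -> g t = y) ->
  (forall t, U (g t)) -> path_in U x (g t0).
Proof.
move=> cg g0 g1 gU; pose t1 := Num.min t0 1.
have -> : g t0 = g t1 by rewrite /t1; case: (leP t0 1) => // h; rewrite !g1// ltW.
exists (fun t => if t <= t1 then g t else g t1); split => //.
- apply: continuous_paste => //; exact: cst_continuous.
- move=> t t_le0; case: leP => [_|t1t]; first exact: g0.
  by apply: g0; exact: le_trans (ltW t1t) t_le0.
- move=> t t_ge1; case: leP => // tt1; congr g; apply/le_anti; rewrite tt1/=.
  by rewrite (le_trans _ t_ge1)// /t1 ge_min lexx orbT.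
- by move=> t; case: ifP.
Qed.

Lemma path_in_joins U x y : path_in U x y ->
  exists g : R -> X, joins 0 1 g x y /\ g @` `[0, 1] `<=` U.
Proof.
move=> [g [cg g0 g1 gU]]; exists g; split; last by move=> _ [t _ <-].
by split; [split; [exact: ler01|exact: continuous_subspaceT]|exact: g0|exact: g1].
Qed.

Lemma continuum_curve (g : R -> X) (a b : R) : continuous g -> a <= b ->
  continuum (g @` `[a, b]).
Proof.
move=> cg ab; split.
- by exists (g a), a => //; rewrite /= in_itv/= lexx ab.
- by apply: continuous_compact; [exact: continuous_subspaceT|exact: segment_compact].
- by apply: connected_continuous_connected; [exact: segment_connected|exact: continuous_subspaceT].
Qed.

Lemma continuumU (E F : set X) x : continuum E -> continuum F -> E x -> F x ->
  continuum (E `|` F).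
Proof.
move=> [_ cE kE] [_ cF kF] Ex Fx; split.
- by exists x; left.
- exact: compactU.
- by apply: connectedU => //; exists x.
Qed.

Lemma first_hit (G : R -> X) (S : set X) (a b : R) : continuous G -> closed S ->
  a <= b -> S (G b) -> exists c, [/\ a <= c <= b, S (G c) & forall t, a <= t < c -> ~ S (G t)].
Proof.
move=> cG cS ab Sb; pose T := [set t | a <= t <= b /\ S (G t)].
have T0 : T !=set0 by exists b; split => //; rewrite ab lexx.
have lT : has_lbound T by exists a => t [/andP[]].
have iT : has_inf T by split.
pose c := inf T.
have ac : a <= c by apply: lb_le_inf => // t [/andP[]].
have cb : c <= b by apply: ge_inf => //; split => //; rewrite ab lexx.
exists c; rewrite ac cb; split => //.
- move/closed_distP : cS; apply => e e0.
  have [d d0 dP] := (continuous_curveP _ _).1 (cG c) e e0.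
  have [t [tI St] tc] := inf_adherent d0 iT.
  exists (G t) => //; apply: dP.
  have ct : c <= t by apply: ge_inf.
  by rewrite distrC ger0_norm ?subr_ge0// ltrBlDl.
- move=> t /andP[at_ tc] St.
  have : c <= t.
    by apply: ge_inf => //; split => //; rewrite at_/= (le_trans (ltW tc)).
  by rewrite leNgt tc.
Qed.

(** The points related to a given one form a clopen subset of [A], since [J]
    holds locally; so this subset is all of [A], and compactness of [K] bounds
    the index. Below, the index bounds the length of a chain or the inverse of
    its distance to a removed point. *)
Lemma chain_uniform (A K : set X) (J : nat -> X -> X -> Prop) :
  connected A -> compact K -> K `<=` A ->
  (forall m n x y, (m <= n)%N -> J m x y -> J n x y) ->
  (forall n x y, J n x y -> J n y x) ->
  (forall m n x y z, J m x y -> J n y z -> J (m + n)%N x z) ->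
  (forall x, A x -> exists n, nbhs x [set y | J n x y]) ->
  exists n, forall x y, K x -> K y -> J n x y.
Proof.
move=> cA cK KA Jm Js Jt Jl.
have [[x0 Kx0]|nK] := pselect (K !=set0); last first.
  by exists 0%N => x y Kx; exfalso; apply: nK; exists x.
have Ax0 := KA _ Kx0.
pose B := [set y | A y /\ exists n, J n x0 y].
have BA : B = A.
  apply: cA.
  - exists x0; split => //; have [n /nbhs_singleton ?] := Jl _ Ax0; by exists n.
  - exists (interior [set y | exists n, J n x0 y]); first exact: open_interior.
    apply/seteqP; split => [y [Ay [n Jn]]|y [Ay /interior_subset]] //.
    split => //; have [m Jy] := Jl y Ay.
    by apply: (filterS _ Jy) => z yz; exists (n + m)%N; exact: Jt yz.
  - exists (closure B); first exact: closed_closure.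
    apply/seteqP; split => [y By|y [Ay cBy]].
      by split; [case: By|exact: subset_closure].
    split => //; have [m Jy] := Jl y Ay; have [z [[Az [n Jn]] Jz]] := cBy _ Jy.
    by exists (n + m)%N; apply: Jt Jn (Js _ _ _ Jz).
have [||n nP] := @compact_nested _ _ _ (fun n => [set y | J n x0 y]) cK.
- by move=> m n y mn; exact: Jm.
- move=> y Ky; have : B y by rewrite BA; exact: KA.
  move=> [Ay [n Jn]]; have [m Jy] := Jl y Ay; exists (n + m)%N.
  by apply: (filterS _ Jy) => z yz; exact: Jt yz.
exists (n + n)%N => x y Kx Ky.
by apply: Jt (nP y Ky); apply: Js; exact: nP.
Qed.

End PathAlgebra.

(** * Local connectivity *)

Section LocalConnectivity.
Context {R : realType} {X : metricType R} {K : R}.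
Context (K1 : 1 <= K).
Context (turning : bounded_turning X K).

Let K0 : 0 < K. Proof. by move: K1; lra. Qed.

Lemma turning_path_connected : path_connected [set: X].
Proof.
move=> x y _ _; apply: path_in_joins.
by have [g [cg g0 g1 _]] := turning x y; exists g.
Qed.

(** The neighbourhood is the path component of [x] in the interior of [U]. *)
Lemma turning_locally_path_connected : locally_path_connected X.
Proof.
move=> x U nU; have Ux := nbhs_singleton nU.
have Ix : interior U x := nU.
exists [set y | path_in (interior U) x y]; split.
- apply/open_distP => y xy.
  have Uy : interior U y by have [g [_ _ g1 gU]] := xy; rewrite -(g1 1 (lexx _)).
  have [e e0 eU] := (open_distP _).1 (open_interior U) y Uy.
  exists (e / K); first by rewrite divr_gt0.
  move=> z; rewrite ltr_pdivlMr// => yz; apply: (path_in_trans xy).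
  have [g [cg g0 g1 gK]] := turning y z; exists g; split => // t; apply: eU.
  by rewrite (le_lt_trans (gK t))// mulrC.
- by exists (fun=> x); split => //; exact: cst_continuous.
- by move=> y [g [_ _ g1 gU]]; apply: interior_subset; rewrite -(g1 1 (lexx _)).
- have up y : path_in (interior U) x y -> path_in [set y | path_in (interior U) x y] x y.
    move=> [g [cg g0 g1 gU]]; exists g; split => // t /=.
    exact: path_in_truncate g1 gU.
  move=> y z /up xy /up xz; apply: path_in_joins.
  exact: path_in_trans (path_in_sym xy) xz.
Qed.

Lemma turning_continuum (x y : X) : exists E, [/\ continuum E, E x, E y &
  forall z, E z -> mdist x z <= K * mdist x y].
Proof.
have [g [cg g0 g1 gK]] := turning x y; exists (g @` `[0, 1]); split.
- exact: continuum_curve.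
- by exists 0; [rewrite /= in_itv/= lexx ler01|exact: g0].
- by exists 1; [rewrite /= in_itv/= lexx ler01|exact: g1].
- by move=> _ [t _ <-].
Qed.

Lemma turning_balls (x : X) (r : R) u v : ball x r u -> ball x r v ->
  exists E, [/\ continuum E, E u, E v & E `<=` ball x ((2 * K + 1) * r)].
Proof.
rewrite !ballEmdist /= => xu xv; have [E [cE Eu Ev EK]] := turning_continuum u v.
exists E; split => // z /EK uz /=; have := metric_triangle x u z.
have uv : K * mdist u v <= K * (2 * r).
  rewrite ler_pM2l//; have := metric_triangle u x v; rewrite (metric_sym u x); lra.
have -> : (2 * K + 1) * r = K * (2 * r) + r by ring.
lra.
Qed.

Lemma first_radius (G : R -> X) (x : X) (r : R) : continuous G ->
  r <= mdist x (G 0) -> G 1 = x -> 0 < r ->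
  exists c, [/\ 0 <= c, mdist x (G c) = r & forall t, 0 <= t <= c -> r <= mdist x (G t)].
Proof.
move=> cG r0 G1 rpos.
have [|c [/andP[c0 c1] cS cN]] := first_hit cG (@closed_closed_ball _ _ x r) ler01.
  by rewrite /= G1 mdistxx ltW.
have ge t : 0 <= t < c -> r <= mdist x (G t).
  by move=> /cN /= /negP; rewrite -ltNge => /ltW.
have xc : mdist x (G c) = r.
  apply/le_anti; rewrite cS/= leNgt; apply/negP => lt_r.
  have cpos : 0 < c.
    by rewrite lt_neqAle c0 andbT; apply: contraL lt_r => /eqP <-; rewrite -leNgt.
  have [|d d0 dP] := (continuous_curveP _ _).1 (cG c) (r - mdist x (G c)).
    by rewrite subr_gt0.
  pose t := Num.max 0 (c - d / 2).
  have tc : 0 <= t < c by rewrite le_max lexx/= gt_max cpos/=; lra.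
  have := ge t tc; have := metric_triangle x (G c) (G t).
  have : mdist (G c) (G t) < r - mdist x (G c).
    apply: dP; have /andP[_ tc'] := tc; rewrite gtr0_norm ?subr_gt0//.
    have : c - d / 2 <= t by rewrite le_max lexx orbT.
    lra.
  lra.
exists c; split => // t /andP[t0]; rewrite le_eqVlt => /orP[/eqP ->|tc].
  by rewrite xc.
by apply: ge; rewrite t0.
Qed.

(** The complement of [p] is connected. By [chain_uniform], points near the
    unit sphere about [p] are joined by continua that stay at a definite
    distance from [p], and dilations spread this to all spheres. A point
    outside a ball is first joined to its boundary sphere by a path towards
    the centre, stopped when it hits the sphere. *)
Lemma turning_LLC (M : R) : 1 <= M -> dilations X M -> proper_space X -> inhabited X ->
  ~ (exists x : X, cut_point x) -> linearly_locally_connected X.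
Proof.
move=> M1 dil Xp [p] ncut; have M0 : 0 < M by lra.
have cA : connected (~` [set p]) by apply: contrapT => nc; apply: ncut; exists p.
pose J n (u v : X) := exists E, [/\ continuum E, E u, E v &
  E `<=` [set z | n.+1%:R^-1 <= mdist p z]].
pose S := [set z : X | M^-1 <= mdist p z <= M].
have cS : compact S := compact_annulus p M^-1 M Xp.
have [|||||n nP] := @chain_uniform _ _ (~` [set p]) S J cA cS.
- move=> z /andP[h1 _] /= zp; move: h1; rewrite zp mdistxx leNgt invr_gt0.
  by rewrite M0.
- move=> m n u v mn [E [cE Eu Ev EP]]; exists E; split => // z /EP /=.
  by apply: le_trans; rewrite lef_pV2 ?posrE// ler_nat.
- by move=> n u v [E [cE Eu Ev EP]]; exists E.
- move=> m n u v w [E [cE Eu Ev EP]] [F [cF Fv Fw FP]]; exists (E `|` F).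
  split; [exact: continuumU cE cF Ev Fv|by left|by right|].
  move=> z [/EP|/FP] /=; apply: le_trans; rewrite lef_pV2 ?posrE// ler_nat ltnS.
    exact: leq_addr.
  exact: leq_addl.
- move=> u up; have pu0 : 0 < mdist p u.
    by rewrite mdist_gt0; apply/eqP => pu; apply: up.
  exists (Num.truncn (mdist p u / 2)^-1); apply/nbhs_distP.
  exists (mdist p u / (2 * K)); first by rewrite divr_gt0// mulr_gt0.
  move=> v; rewrite ltr_pdivlMr ?mulr_gt0// => uv.
  have [E [cE Eu Ev EK]] := turning_continuum u v.
  exists E; split => // z /EK uz /=; apply: (@le_trans _ _ (mdist p u / 2)).
    rewrite -[leRHS]invrK lef_pV2 ?posrE ?invr_gt0 ?divr_gt0//.
    exact: ltW (truncnS_gt _).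
  have := metric_triangle p z u; rewrite (metric_sym z u); lra.
pose C := 2 * K + 1 + M * n.+1%:R.
have Mn : 1 <= M * n.+1%:R by apply: mulr_ege1 => //; rewrite ler1n.
have C1 : 1 <= C by rewrite /C; move: K1; lra.
exists C; split => // x r r0; split.
  move=> u v xu xv; have [E [cE Eu Ev EP]] := turning_balls xu xv.
  exists E; split => //; apply: (subset_trans EP); apply: le_ball.
  by rewrite ler_pM2r// /C; lra.
have [h [h' [hh hx]]] := dil x p r^-1 (ltac:(by rewrite invr_gt0)).
have [hK h'K hP] := hh.
have sphere u v : mdist x u = r -> mdist x v = r ->
    exists E, [/\ continuum E, E u, E v & E `<=` [set z | r / C <= mdist x z]].
  move=> xu xv.
  have inS z : mdist x z = r -> S (h z).
    move=> xz; have := hP x z; rewrite hx xz mulVf ?gt_eqF// => -[h1 h2].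
    rewrite /S /=; apply/andP; split; last by rewrite mulr1 in h1.
    by rewrite -[M^-1]mulr1 ler_pdivrMl.
  have [E [[[e Ee] cE kE] Eu Ev EP]] := nP _ _ (inS u xu) (inS v xv).
  have ch' := quasi_similarity_continuous (quasi_similarity_inv (ltac:(by rewrite invr_gt0) : 0 < r^-1) hh).
  exists (h' @` E); split.
  - split; first by exists (h' e), e.
    + by apply: continuous_compact => //; exact: continuous_subspaceT.
    + by apply: connected_continuous_connected => //; exact: continuous_subspaceT.
  - by exists (h u).
  - by exists (h v).
  - move=> _ [z Ez <-] /=; have /= := EP z Ez; have := (hP x (h' z)).1; rewrite h'K hx.
    move=> h1 h2; have h3 := le_trans h2 h1.
    have : r / (M * n.+1%:R) <= mdist x (h' z).
      rewrite ler_pdivrMr ?mulr_gt0//.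
      have n0 : 0 < n.+1%:R :> R by rewrite ltr0n.
      move: n0 h3; move: (n.+1%:R) => m n0 h3.
      have := ler_wpM2r (ltW (mulr_gt0 r0 n0)) h3.
      have -> : m^-1 * (r * m) = r by field; rewrite gt_eqF.
      by congr (_ <= _); field; rewrite gt_eqF.
    apply: le_trans; rewrite ler_pM2l// lef_pV2 ?posrE ?(lt_le_trans ltr01)//.
    by rewrite /C; move: K1; lra.
have radial u : (~` ball x r) u -> exists v E, [/\ mdist x v = r, continuum E, E u, E v &
    E `<=` [set z | r / C <= mdist x z]].
  rewrite ballEmdist /= => /negP; rewrite -leNgt => xu.
  have [g [cg g0 g1 _]] := turning u x.
  have [|||c [c0 xc cP]] := @first_radius g x r cg => //.
    by rewrite g0.
    by rewrite g1.
  exists (g c), (g @` `[0, c]); split => //.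
  - exact: continuum_curve.
  - by exists 0; [rewrite /= in_itv/= lexx c0|exact: g0].
  - by exists c => //; rewrite /= in_itv/= lexx c0.
  - move=> _ [t + <-]; rewrite /= in_itv/= => /cP; apply: le_trans.
    by rewrite ler_pdivrMr ?(lt_le_trans ltr01)// ler_peMr// ltW.
move=> u v /radial[u' [E [xu' cE Eu Eu' EP]]] /radial[v' [F [xv' cF Fv Fv' FP]]].
have [G [cG Gu' Gv' GP]] := sphere _ _ xu' xv'.
have cEG := continuumU cE cG Eu' Gu'.
exists ((E `|` G) `|` F); split.
- by apply: (continuumU cEG cF) Fv'; right.
- by left; left.
- by right.
- move=> z zE; rewrite ballEmdist /=; apply/negP; rewrite -leNgt.
  by case: zE => [[/EP|/GP]|/FP].
Qed.

End LocalConnectivity.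

(** * Limits along a free ultrafilter *)

Section FreeUltrafilter.
Context {R : realType}.

(** Along a fixed free ultrafilter all sequences of a compact set converge at
    once, which spares the extraction of subsequences for uncountably many
    parameters. *)
Lemma free_ultrafilter : exists U : set_system nat,
  [/\ ProperFilter U, forall N, U [set n | (N <= n)%N] & forall A, U A \/ U (~` A)].
Proof.
have [U [UU sU]] := @ultraFilterLemma nat \oo _.
exists U; split.
- exact: ultra_proper.
- by move=> N; apply: sU; exists N.
- by move=> A; exact: in_ultra_setVsetC.
Qed.

Lemma ultra_limit (X : metricType R) (U : set_system nat) (K : set X) (u : nat -> X) :
  ProperFilter U -> (forall A, U A \/ U (~` A)) -> compact K -> (forall n, K (u n)) ->
  exists2 z, K z & forall e : R, 0 < e -> U [set n | mdist (u n) z < e].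
Proof.
move=> PU UU cK Ku; have [|z [Kz zu]] := cK _ (fmap_proper_filter u PU).
  by apply: (@filterS _ U _ setT _ _ filterT) => n _; exact: Ku.
exists z => // e e0; have [//|nU] := UU [set n | mdist (u n) z < e].
have [||w [[n /= nn <-] zw]] := zu (u @` (~` [set n | mdist (u n) z < e])) [set y | mdist z y < e].
- by apply: (@filterS _ U _ _ _ _ nU) => n nn; exists n.
- by apply/nbhs_distP; exists e.
by exfalso; apply: nn; rewrite metric_sym.
Qed.

End FreeUltrafilter.

(** * Chains of bounded length *)

Section Chains.
Context {R : realType}.

Section ChainBasics.
Context {X : metricType R}.
Implicit Types (x y : X) (s : seq X) (F : set X) (eps l : R).

Fixpoint chain_sum (phi : R -> R) x s : R :=
  if s is y :: s' then phi (mdist x y) + chain_sum phi y s' else 0.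

Definition chain_length := chain_sum id.

Definition step_le eps x y := mdist x y <= eps.

Lemma chain_sum_cat phi x s t :
  chain_sum phi x (s ++ t) = chain_sum phi x s + chain_sum phi (last x s) t.
Proof. by elim: s x => [|y s IH] x /=; rewrite ?add0r// IH addrA. Qed.

Lemma chain_sum_ge0 phi x s : (forall r, 0 <= r -> 0 <= phi r) -> 0 <= chain_sum phi x s.
Proof. by move=> p0; elim: s x => [|y s IH] x //=; rewrite addr_ge0// p0// mdist_ge0. Qed.

Lemma chain_length_ge0 x s : 0 <= chain_length x s.
Proof. exact: chain_sum_ge0. Qed.

Lemma chain_length_mem x s z : z \in x :: s -> mdist x z <= chain_length x s.
Proof.
elim: s x => [|y s IH] x; first by rewrite inE => /eqP ->; rewrite mdistxx.
rewrite inE => /orP[/eqP ->|/IH zy].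
  by rewrite mdistxx; exact: chain_length_ge0.
by rewrite (le_trans (metric_triangle x y _))// lerD2l.
Qed.

Lemma fine_path_weaken eps eps' x s : eps <= eps' -> path (step_le eps) x s -> path (step_le eps') x s.
Proof.
by move=> ee'; apply: sub_path => u v; rewrite /step_le => /le_trans; apply.
Qed.

Lemma chain_rev phi (e : rel X) x s : symmetric e -> path e x s -> exists s',
  [/\ path e (last x s) s', last (last x s) s' = x,
      chain_sum phi (last x s) s' = chain_sum phi x s & forall z, (z \in last x s :: s') = (z \in x :: s)].
Proof.
move=> eC; elim: s x => [|y s IH] x /=; first by exists [::].
move=> /andP[xy /IH[s' [p' l' c' m']]]; exists (rcons s' x); split.
- by rewrite rcons_path p' l' eC.
- by rewrite last_rcons.
- by rewrite -cats1 chain_sum_cat c' l' /= addr0 metric_sym addrC.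
- by move=> z; rewrite -rcons_cons mem_rcons inE m' [in RHS]inE.
Qed.

Lemma step_le_sym eps : symmetric (step_le eps).
Proof. by move=> x y; rewrite /step_le metric_sym. Qed.

(** In a proper space and for closed [F], this amounts to a curve of length at
    most [l] in [F], by [linked_curve]. Stated with chains it passes to
    Lipschitz images and concatenations without any choice of parameters. *)
Definition linked F x y l := forall eps : R, 0 < eps -> exists s,
  [/\ path (step_le eps) x s, last x s = y, chain_length x s <= l &
      forall z, z \in x :: s -> F z].

Lemma linked_ge0 F x y l : linked F x y l -> 0 <= l.
Proof.
by move=> /(_ 1 ltr01)[s [_ _ + _]]; exact/le_trans/chain_length_ge0.
Qed.

Lemma linked_refl F x l : F x -> 0 <= l -> linked F x x l.
Proof. by move=> Fx l0 eps e0; exists [::]; split=> // z; rewrite inE => /eqP ->. Qed.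

Lemma linked_weaken F F' x y l l' : F `<=` F' -> l <= l' -> linked F x y l -> linked F' x y l'.
Proof.
move=> FF' ll' h eps /h[s [s1 s2 s3 s4]]; exists s; split => //.
  exact: le_trans ll'.
by move=> z /s4 /FF'.
Qed.

Lemma linked_sym F x y l : linked F x y l -> linked F y x l.
Proof.
move=> h eps /h[s [s1 <- s3 s4]]; have [s' [p' l' c' m']] := chain_rev id (step_le_sym eps) s1.
exists s'; split => //; first by rewrite /chain_length c'.
by move=> z; rewrite m'; exact: s4.
Qed.

Lemma linked_trans F x y z l l' : linked F x y l -> linked F y z l' -> linked F x z (l + l').
Proof.
move=> h h' eps e0; have [s [s1 s2 s3 s4]] := h eps e0; have [t [t1 t2 t3 t4]] := h' eps e0.
exists (s ++ t); split.
- by rewrite cat_path s1 s2.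
- by rewrite last_cat s2.
- by rewrite /chain_length chain_sum_cat s2; exact: lerD.
- move=> u; rewrite -cat_cons mem_cat => /orP[/s4//|ut]; apply: t4.
  by rewrite inE ut orbT.
Qed.

Lemma linked_ball x y l : linked setT x y l -> linked [set z | mdist x z <= l] x y l.
Proof.
move=> h eps /h[s [s1 s2 s3 s4]]; exists s; split => // z /chain_length_mem /= h'.
exact: le_trans s3.
Qed.

End ChainBasics.

Lemma chain_sum_map (X Y : metricType R) (h : X -> Y) (F : set X) (K : R) x s :
  (forall u v, F u -> F v -> mdist (h u) (h v) <= K * mdist u v) ->
  (forall z, z \in x :: s -> F z) ->
  chain_length (h x) (map h s) <= K * chain_length x s.
Proof.
move=> hK; elim: s x => [|y s IH] x sF /=; first by rewrite /chain_length /= mulr0.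
rewrite /chain_length /= mulrDr lerD//.
  by apply: hK; apply: sF; rewrite !inE eqxx ?orbT.
by apply: IH => z zs; apply: sF; rewrite inE zs orbT.
Qed.

Lemma linked_image (X Y : metricType R) (h : X -> Y) (F : set X) (G : set Y) (K : R) x y l :
  0 <= K ->
  (forall u v, F u -> F v -> mdist (h u) (h v) <= K * mdist u v) ->
  (forall u, F u -> G (h u)) ->
  linked F x y l -> linked G (h x) (h y) (K * l).
Proof.
move=> K0 hK FG hl eps e0; have K1 : 0 < K + 1 by rewrite ltr_wpDl.
have [|s [s1 s2 s3 s4]] := hl (eps / (K + 1)); first by rewrite divr_gt0.
exists (map h s); split.
- elim: s x s1 s4 {s2 s3 hl} => [//|z s IH] x /= /andP[xz zs] sF.
  apply/andP; split; last by apply: IH => // u us; apply: sF; rewrite inE us orbT.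
  rewrite /step_le (le_trans (hK _ _ _ _))//; try by apply: sF; rewrite !inE eqxx ?orbT.
  move: xz; rewrite /step_le ler_pdivlMr// => /(le_trans _); apply.
  by rewrite mulrC ler_wpM2l ?mdist_ge0// lerDl.
- by rewrite last_map s2.
- by rewrite (le_trans (chain_sum_map hK s4))// ler_wpM2l.
- by rewrite -map_cons => z /mapP[u us ->]; apply: FG; exact: s4.
Qed.

Section LimitCurve.
Context {X : metricType R}.

(** The parametrization of a chain by arc length, rounded down to the points
    of the chain. *)
Fixpoint chain_at (x : X) (s : seq X) (a : R) : X :=
  if s is y :: s' then if a < mdist x y then x else chain_at y s' (a - mdist x y) else x.

Lemma chain_at_mem x s a : chain_at x s a \in x :: s.
Proof.
elim: s x a => [|y s IH] x a /=; first by rewrite inE.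
by case: ifP => _; [rewrite inE eqxx|rewrite inE IH orbT].
Qed.

Lemma chain_at_end x s a : chain_length x s <= a -> chain_at x s a = last x s.
Proof.
elim: s x a => [//|y s IH] x a; rewrite /chain_length /= => h.
have := chain_length_ge0 y s; rewrite /chain_length => h0.
case: ltP => [?|_]; first by exfalso; lra.
by apply: IH; rewrite /chain_length; lra.
Qed.

Lemma chain_at_dist x s a : 0 <= a -> mdist x (chain_at x s a) <= a.
Proof.
elim: s x a => [|y s IH] x a a0 /=; first by rewrite mdistxx.
case: ltP => [_|h]; first by rewrite mdistxx.
rewrite (le_trans (metric_triangle x y _))// -lerBrDl; apply: IH.
by rewrite subr_ge0.
Qed.

Lemma chain_at_lipschitz eps x s a b : 0 <= eps -> path (step_le eps) x s -> a <= b ->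
  mdist (chain_at x s a) (chain_at x s b) <= b - a + eps.
Proof.
move=> e0; elim: s x a b => [|y s IH] x a b /=.
  by move=> _ ab; rewrite mdistxx; lra.
move=> /andP[xy p] ab; rewrite /step_le in xy.
case: ltP => ha; case: ltP => hb.
- by rewrite mdistxx; lra.
- have hb' : 0 <= b - mdist x y by rewrite subr_ge0.
  have := chain_at_dist y s hb'; have := metric_triangle x y (chain_at y s (b - mdist x y)); lra.
- by exfalso; lra.
- by have := IH y _ _ p (lerB ab (lexx (mdist x y))); lra.
Qed.

(** The arc length parametrizations of finer and finer chains are
    [l]-Lipschitz up to an error that tends to 0, and so is their limit
    without error. *)
Lemma linked_curve (F : set X) x y l : proper_space X -> closed F -> linked F x y l ->
  exists g : R -> X, [/\ g 0 = x, g 1 = y, forall t, F (g t) &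
    forall s t, mdist (g s) (g t) <= l * `|s - t|].
Proof.
move=> Xp cF xy; have l0 := linked_ge0 xy.
have e0 n : 0 < n.+1%:R^-1 :> R by rewrite invr_gt0.
have [S SP] := choice (fun n => xy n.+1%:R^-1 (e0 n)).
pose f n t := chain_at x (S n) (t * l).
have fL n s t : mdist (f n s) (f n t) <= l * `|s - t| + n.+1%:R^-1.
  have [S1 _ _ _] := SP n.
  wlog st : s t / s <= t.
    by move=> W; case: (leP s t) => [/W//|/ltW/W]; rewrite metric_sym distrC.
  rewrite distrC ger0_norm ?subr_ge0// mulrBr !(mulrC l).
  by apply: chain_at_lipschitz => //; exact: ler_wpM2r.
have f0 n : f n 0 = x.
  rewrite /f mul0r; apply/esym/le0_eq.
  exact: chain_at_dist.
have f1 n : f n 1 = y.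
  by have [_ S2 S3 _] := SP n; rewrite /f mul1r chain_at_end.
have fF n t : F (f n t) by have [_ _ _ S4] := SP n; apply/S4/chain_at_mem.
have [U [PU Utail UU]] := free_ultrafilter.
have /choice[g gP] : forall t, exists z, forall e : R, 0 < e -> U [set n | mdist (f n t) z < e].
  move=> t; have cK := Xp x (l * `|t| + 1).
  have fK n : [set z | mdist x z <= l * `|t| + 1] (f n t).
    rewrite /=; have := fL n 0 t; rewrite f0 sub0r normrN => /le_trans; apply.
    by rewrite lerD2l invf_le1// ler1n.
  have [z _ zP] := ultra_limit PU UU cK fK.
  by exists z.
have ex2 (A B : set nat) : U A -> U B -> exists2 n, A n & B n.
  move=> UA UB; have [n [An Bn]] := filter_ex (filterI UA UB).
  by exists n.
have fix_val t z : (forall n, f n t = z) -> g t = z.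
  move=> fz; apply/esym/le0_eq/ler_addgt0Pr => e e_gt0; rewrite add0r.
  have [n /= nP] := filter_ex (gP t e e_gt0).
  by rewrite -(fz n) ltW.
exists g; split.
- exact: fix_val.
- exact: fix_val.
- move=> t; move/closed_distP : cF; apply => e e_gt0.
  have [n /= nP] := filter_ex (gP t e e_gt0).
  by exists (f n t) => //; rewrite metric_sym.
- move=> s t; apply/ler_addgt0Pr => e e_gt0.
  have e3 : 0 < e / 3 by rewrite divr_gt0.
  have Un : U [set n | n.+1%:R^-1 <= e / 3].
    apply: filterS (Utail (Num.truncn (e / 3)^-1)) => n /= nP.
    rewrite -[leRHS]invrK lef_pV2 ?posrE ?invr_gt0//.
    by rewrite (le_trans (ltW (truncnS_gt _)))// ler_nat ltnS.
  have [n [/= n1 n2] n3] := ex2 _ _ (filterI (gP s _ e3) (gP t _ e3)) Un.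
  have := fL n s t; have := metric_triangle (g s) (f n s) (g t).
  have := metric_triangle (f n s) (f n t) (g t).
  rewrite /= (metric_sym (g s) (f n s)) => h1 h2 h3.
  by move: n3 h3; rewrite /=; move: (n.+1%:R^-1) => k n3 h3; lra.
Qed.

Lemma lipschitz_curve_length (g : R -> X) l a b : 
  (forall s t, mdist (g s) (g t) <= l * `|s - t|) -> a <= b ->
  (curve_length a b g <= (l * (b - a))%:E)%E.
Proof.
move=> gL ab; apply: ub_ereal_sup => t [s [sp /eqP sb] <-].
have -> : b - a = last a s - a by rewrite sb.
rewrite lee_fin; elim: s a sp {sb ab} => [|c s IH] a /=.
  by rewrite big_nil subrr mulr0.
move=> /andP[ac cs]; rewrite big_nat_recl//=.
have := IH c cs; have := gL a c; rewrite distrC gtr0_norm ?subr_gt0// => h1 h2.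
rewrite (le_trans (lerD h1 h2))//; lra.
Qed.

End LimitCurve.

End Chains.

(** * Chains along rectifiable curves *)

Section RectifiableCurves.
Context {R : realType} {X : metricType R}.

Lemma path_lt_mem (a t : R) (s : seq R) : path <%R a s -> t \in s -> a < t <= last a s.
Proof.
elim: s a => [//|c s IH] a /= /andP[ac cs]; rewrite inE => /orP[/eqP ->|/(IH _ cs)/andP[ct tl]].
  rewrite ac/=; case: s cs {IH} => [//|d s] cs.
  have := @order_path_min _ <%R c (d :: s) lt_trans cs => /allP/(_ (last d s)).
  by rewrite mem_last => /(_ isT) /ltW.
by rewrite (lt_trans ac ct).
Qed.

Lemma partition_sum (G : R -> X) (b a : R) (s : seq R) :
  \sum_(0 <= i < size s) mdist (G (nth b (a :: s) i)) (G (nth b s i)) =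
  chain_length (G a) (map G s).
Proof.
elim: s a => [|c s IH] a; first by rewrite big_nil.
by rewrite /= big_nat_recl//= IH.
Qed.

Lemma fine_partition (eta : R) (m : nat) (a c : R) : 0 < eta -> a <= c ->
  c <= a + m%:R * eta ->
  exists s, [/\ path (fun u v => (u < v) && (v - u <= eta)) a s & last a s = c].
Proof.
move=> eta0; elim: m a => [|m IH] a ac.
  by rewrite mul0r addr0 => ca; exists [::]; split => //=; apply/le_anti; rewrite ac.
rewrite -natr1 mulrDl mul1r => h.
have [c_le|c_gt] := leP c (a + eta).
  move: ac; rewrite le_eqVlt => /orP[/eqP ->|ac]; first by exists [::].
  by exists [:: c]; split => //=; rewrite ac lerBlDl c_le.
have [|s [s1 s2]] := IH (a + eta) (ltW c_gt); first by lra.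
exists (a + eta :: s); split => //=.
by rewrite s1 ltrDl eta0 addrC addKr lexx.
Qed.

Lemma uniform_modulus (G : R -> X) (a b eps : R) : continuous G -> 0 < eps ->
  exists2 eta : R, 0 < eta & forall s t, s \in `[a, b] -> `|s - t| <= eta ->
    mdist (G s) (G t) <= eps.
Proof.
move=> cG e0.
pose P (n : nat) := [set s : R^o | forall t, `|s - t| <= n.+1%:R^-1 -> mdist (G s) (G t) <= eps].
have [||n nP] := @compact_nested _ (R^o) `[a, b]%classic P (@segment_compact R a b).
- move=> m n s mn sm t st; apply: sm; apply: le_trans st _.
  by rewrite lef_pV2 ?posrE// ler_nat.
- move=> s _; have e2 : 0 < eps / 2 by rewrite divr_gt0.
  have [d d0 dP] := (continuous_curveP _ _).1 (cG s) _ e2.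
  exists (Num.truncn (d / 2)^-1); apply/(@nbhs_distP _ R^o); exists (d / 2).
    by rewrite divr_gt0.
  move=> t; rewrite mdist_line => st u tu.
  have tu' : `|t - u| <= d / 2.
    apply: le_trans tu _; rewrite -[leRHS]invrK lef_pV2 ?posrE ?invr_gt0 ?divr_gt0//.
    exact: ltW (truncnS_gt _).
  have h1 : mdist (G s) (G t) < eps / 2 by apply: dP; lra.
  have h2 : mdist (G s) (G u) < eps / 2.
    by apply: dP; have := ler_distD t s u; lra.
  have := metric_triangle (G t) (G s) (G u); rewrite (metric_sym (G t) (G s)); lra.
exists n.+1%:R^-1; first by rewrite invr_gt0.
by move=> s t sI; apply: nP.
Qed.

Lemma fine_partition_image (G : R -> X) (I : interval R) (eta eps a : R) s :
  (forall u v, u \in I -> `|u - v| <= eta -> mdist (G u) (G v) <= eps) ->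
  path (fun u v => (u < v) && (v - u <= eta)) a s ->
  (forall t, t \in a :: s -> t \in I) -> path (step_le eps) (G a) (map G s).
Proof.
move=> etaP; elim: s a => [//|d s IH] a /= /andP[/andP[ad da] ds] mem.
have aI : a \in I by apply: mem; rewrite inE eqxx.
rewrite {1}/step_le etaP//=; last by rewrite distrC gtr0_norm ?subr_gt0.
by apply: IH => // t ts; apply: mem; rewrite inE ts orbT.
Qed.

(** The curve is sampled along a fine partition of [a, c]; appending [b] makes
    it a partition of the whole interval, so its sum is bounded by the length. *)
Lemma rectifiable_linked (G : R -> X) (a b c l : R) (F : set X) : continuous G ->
  (curve_length a b G <= l%:E)%E -> a <= c <= b ->
  (forall t, a <= t <= c -> F (G t)) -> linked F (G a) (G c) l.
Proof.
move=> cG Gl /andP[ac cb] FG eps e0.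
have [eta eta0 etaP] := uniform_modulus a b cG e0.
have cm : c <= a + (Num.truncn ((c - a) / eta)).+1%:R * eta.
  rewrite -lerBlDl -ler_pdivrMr//; exact: ltW (truncnS_gt _).
have [s [s1 s2]] := fine_partition eta0 ac cm.
have slt : path <%R a s by apply: sub_path s1 => u v /andP[].
have mem t : t \in a :: s -> a <= t <= c.
  rewrite inE => /orP[/eqP ->|/(path_lt_mem slt)]; first by rewrite lexx.
  by rewrite s2 => /andP[/ltW -> ->].
exists (map G s); split.
- have mem' t : t \in a :: s -> t \in `[a, b].
    by rewrite in_itv/= => /mem/andP[-> /le_trans]; apply.
  exact: fine_partition_image etaP s1 mem'.
- by rewrite last_map s2.
- suff : ((chain_length (G a) (map G s))%:E <= curve_length a b G)%E.
    by move=> h; have := le_trans h Gl; rewrite lee_fin.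
  move: cb; rewrite le_eqVlt => /orP[/eqP cb|cb].
    apply: ereal_sup_ubound; exists s; first by split => //; rewrite s2 cb.
    by rewrite partition_sum.
  apply: (@le_trans _ _ (chain_length (G a) (map G (rcons s b)))%:E).
    rewrite lee_fin map_rcons -cats1 /chain_length chain_sum_cat lerDl /=.
    by rewrite addr0 mdist_ge0.
  apply: ereal_sup_ubound; exists (rcons s b).
    by split; [rewrite rcons_path slt s2|rewrite last_rcons].
  by rewrite partition_sum.
- by rewrite -map_cons => z /mapP[t /mem ts ->]; exact: FG.
Qed.

Lemma rectifiable_arc : has_nondegenerate_rectifiable_curve X ->
  exists (G : R -> X) (a b c l : R), [/\ continuous G, a <= c <= b, G a <> G c &
    (curve_length a b G <= l%:E)%E].
Proof.
move=> [a [b [g [cg [s [t [sI tI st]]] rg]]]].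
have [G cG GE] := curve_extend cg; have [ab _] := cg.
have aI : a \in `[a, b] by rewrite in_itv/= lexx ab.
have E : curve_length a b G = curve_length a b g.
  congr ereal_sup; apply/seteqP; split => _ [r [r1 /eqP r2] <-]; exists r;
    try (by split => //; rewrite r2); congr EFin; rewrite !partition_sum (GE a aI);
    congr chain_length; apply/eq_in_map => u /(path_lt_mem r1); rewrite r2 => /andP[/ltW au ub];
    by rewrite GE// in_itv/= au.
have [l gl] : exists l : R, (curve_length a b g <= l%:E)%E.
  move: rg; rewrite /rectifiable; case: (curve_length a b g) => [l _|//|_].
    by exists l.
  by exists 0; rewrite leNye.
rewrite -E in gl.
have [c [cI ac]] : exists c, c \in `[a, b] /\ G a <> G c.
  apply: contrapT => /forallNP nc; apply: st; rewrite -GE// -GE//.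
  have h u : u \in `[a, b] -> G a = G u.
    by move=> uI; apply: contrapT => au; apply: (nc u).
  by rewrite -(h s)// -(h t).
by exists G, a, b, c, l; split => //; move: cI; rewrite in_itv.
Qed.

End RectifiableCurves.

(** * Points joined by rectifiable curves *)

Section QuasiConvexity.
Context {R : realType} {X : metricType R} {M : R}.
Context (M1 : 1 <= M) (dil : dilations X M) (inv : inversions X M).
Context (cX : connected [set: X]) (Xr : has_nondegenerate_rectifiable_curve X).

Let M0 : 0 < M. Proof. by move: M1; lra. Qed.

Definition rect_linked (x y : X) := exists l, linked setT x y l.

Lemma rect_linked_refl x : rect_linked x x.
Proof. by exists 0; exact: linked_refl. Qed.

Lemma rect_linked_sym x y : rect_linked x y -> rect_linked y x.
Proof. by move=> [l h]; exists l; exact: linked_sym. Qed.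

Lemma rect_linked_trans x y z : rect_linked x y -> rect_linked y z -> rect_linked x z.
Proof. by move=> [l h] [l' h']; exists (l + l'); exact: linked_trans h h'. Qed.

Lemma rect_linked_similarity lam (h h' : X -> X) x y : 0 < lam ->
  quasi_similarity M lam h h' -> rect_linked x y -> rect_linked (h x) (h y).
Proof.
move=> lam0 [_ _ hP] [l xy]; exists (M * lam * l).
apply: (linked_image (F := setT)) xy => //; first by rewrite mulr_ge0// ltW.
by move=> u v _ _; rewrite -mulrA; exact: (hP u v).1.
Qed.

(** A closed set that avoids the pole stays at a positive distance from it,
    and there the map is Lipschitz. *)
Lemma linked_quasi_mobius C w (f : option X -> option X) (F : set X) x y l x' y' :
  0 <= C -> quasi_mobius C w f -> closed F -> (forall z, F z -> f (Some z) <> None) ->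
  f (Some x) = Some x' -> f (Some y) = Some y' -> linked F x y l -> rect_linked x' y'.
Proof.
move=> C0 fQ cF Fpole fx fy xy; have [[g fK gK] _ _] := fQ.
pose pole := g None; have fp : f pole = None by rewrite gK.
have [c c0 cP] : exists2 c : R, 0 < c & forall z, F z -> c <= odist (Some z) pole.
  case E : pole => [p|]; last by exists 1.
  have Fp : ~ F p by move=> Fp; apply: (Fpole p) => //; rewrite -E.
  exact: closed_away cF Fp.
have [K K0 KP] := quasi_mobius_lipschitz C0 fQ fp c0.
pose h z := if f (Some z) is Some z' then z' else z.
have hE z : F z -> f (Some z) = Some (h z).
  by move=> /Fpole; rewrite /h; case: (f (Some z)).
exists (K * l).
have -> : x' = h x by rewrite /h fx.
have -> : y' = h y by rewrite /h fy.
apply: (linked_image (F := F)) xy => // u v Fu Fv.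
have := KP (Some u) (Some v) (cP u Fu) (cP v Fv).
by rewrite !hE.
Qed.

(** An inversion at the end [v] of the rectifiable curve, followed by a
    translation, gives a curve from [x] to infinity. Either it meets [q] on
    its way, or it avoids [q], and then the inversion [f] at [q] turns it into
    a rectifiable curve from [x'] to [q]. *)
Lemma rect_linked_or_inverse (q x x' : X) w f : quasi_mobius M w f ->
  f (Some q) = None -> f None = Some q -> f (Some x) = Some x' ->
  rect_linked x q \/ rect_linked x' q.
Proof.
move=> fQ fq fN fx; have MM := ltW M0.
have [G [a [b [c [l [cG /andP[ac cb] Gac Gl]]]]]] := rectifiable_arc Xr.
set u := G a in Gac; set v := G c in Gac.
have [wv [fv [fvQ fvv fvN]]] := inv v.
have [u' fvu] : exists u', fv (Some u) = Some u'.
  case E : (fv (Some u)) => [u'|]; first by exists u'.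
  have [[g fK gK] _ _] := fvQ.
  by have [uv] : Some u = Some v by apply: (can_inj fK); rewrite E fvv.
have [h [h' [hh hu']]] := dil u' x ltr01.
have hQ := translation_omap M1 hh.
pose t1 := omap h \o fv; pose t2 := f \o t1.
have Q1 : quasi_mobius (M * M) _ t1 := quasi_mobius_comp MM MM fvQ hQ.
have Q2 : quasi_mobius (M * (M * M)) _ t2 := quasi_mobius_comp (mulr_ge0 MM MM) MM Q1 fQ.
have t1u : t1 (Some u) = Some x by rewrite /t1 /= fvu /= hu'.
have t1v : t1 (Some v) = None by rewrite /t1 /= fvv.
have t2u : t2 (Some u) = Some x' by rewrite /t2 /= t1u.
have t2v : t2 (Some v) = Some q by rewrite /t2 /= t1v.
have [[g1 t1K g1K] _ _] := Q1.
(* The curve is followed up to the first point that is sent to infinity or to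
   [q]. *)
pose S := [set z | z = v \/ Some z = g1 (Some q)].
have cS : closed S.
  have -> : S = [set v] `|` [set z | Some z = g1 (Some q)].
    by apply/seteqP; split.
  apply: closedU; first exact: closed_point.
  case: (g1 (Some q)) => [q'|].
    have -> : [set z | Some z = Some q'] = [set q'] :> set X.
      by apply/seteqP; split => z /= => [[]|->].
    exact: closed_point.
  have -> : [set z | Some z = None] = set0 :> set X by apply/seteqP; split.
  exact: closed0.
have [|d [/andP[ad dc] Sd dN]] := first_hit cG cS ac; first by left.
pose F := G @` `[a, d].
have cF : closed F.
  apply: compact_closed; first exact: metric_hausdorff.
  by apply: continuous_compact; [exact: continuous_subspaceT|exact: segment_compact].
have Flink : linked F u (G d) l.
  apply: (rectifiable_linked cG Gl); first by rewrite ad (le_trans dc).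
  by move=> t tI; exists t => //; rewrite /= in_itv.
have Fmem z : F z -> z = G d \/ ~ S z.
  move=> [t]; rewrite /= in_itv/= => /andP[at_]; rewrite le_eqVlt => /orP[/eqP -> <-|td <-].
    by left.
  by right; apply: dN; rewrite at_.
have MMM := mulr_ge0 MM MM.
case: (pselect (G d = v)) => [Gdv|Gdv].
- right; have Fpole z : F z -> t2 (Some z) <> None.
    move=> Fz E; have [[g2 t2K g2K] _ _] := fQ.
    have E1 : t1 (Some z) = Some q by apply: (can_inj t2K); rewrite fq.
    case: (Fmem z Fz) => [zd|]; last by apply; right; rewrite -E1 t1K.
    by move: E1; rewrite zd Gdv t1v.
  have t2d : t2 (Some (G d)) = Some q by rewrite Gdv.
  exact: (linked_quasi_mobius (mulr_ge0 MM MMM) Q2 cF Fpole t2u t2d Flink).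
- left; have t1d : t1 (Some (G d)) = Some q.
    by case: Sd => // ->; rewrite g1K.
  have Fpole z : F z -> t1 (Some z) <> None.
    move=> Fz E; have [zv] : Some z = Some v by apply: (can_inj t1K); rewrite E t1v.
    case: (Fmem z Fz) => [zd|]; last by apply; left.
    by apply: Gdv; rewrite -zd.
  exact: (linked_quasi_mobius MMM Q1 cF Fpole t1u t1d Flink).
Qed.

(** If no point of a ball about [x] is linked to [q], then by
    [rect_linked_or_inverse] all points of its image under the inversion at
    [q] are. This image is open, so by homogeneity every point is linked to
    all points of a neighbourhood. Then the set of points linked to [q] is
    clopen, and contains [x]. *)
Lemma rect_linked_dense (q x : X) (e : R) : 0 < e ->
  exists2 y, rect_linked q y & mdist x y < e.
Proof.
move=> e0; apply: contrapT => nE.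
have nlink y : mdist x y < e -> ~ rect_linked q y.
  by move=> xy qy; apply: nE; exists y.
have [w [f [fQ fq fN]]] := inv q; have [[g fK gK] _ _] := fQ; have MM := ltW M0.
have oB : open (fin_image f [set y | mdist x y < e]).
  by apply: open_fin_image fQ _ => //; exact: open_dist_ball.
have sub y : fin_image f [set y | mdist x y < e] y -> rect_linked q y.
  move=> [z xz fz]; apply: rect_linked_sym.
  case: (rect_linked_or_inverse fQ fq fN fz) => // /rect_linked_sym.
  by move=> /(nlink _ xz).
have [y0 By0] : exists y0, fin_image f [set y | mdist x y < e] y0.
  case E : (f (Some x)) => [y|]; first by exists y, x => //=; rewrite mdistxx.
  have [xq] : Some x = Some q by apply: (can_inj fK); rewrite E fq.
  exfalso; apply: (nlink x); first by rewrite mdistxx.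
  by rewrite xq; exact: rect_linked_refl.
have loc z : exists2 d, 0 < d & forall z', mdist z z' < d -> rect_linked z z'.
  have [d d0 dP] := (open_distP _).1 oB y0 By0.
  have [h [h' [hh hz]]] := dil z y0 ltr01; have [hK h'K hP] := hh.
  exists (d / M); first by rewrite divr_gt0.
  move=> z'; rewrite ltr_pdivlMr// mulrC => zz'.
  have : rect_linked y0 (h z').
    apply: rect_linked_trans (rect_linked_sym (sub _ By0)) (sub _ _); apply: dP.
    by rewrite -hz; apply: le_lt_trans zz'; have := (hP z z').1; rewrite mul1r.
  have i1 : 0 < 1^-1 :> R by rewrite invr1.
  move=> /(rect_linked_similarity i1 (quasi_similarity_inv ltr01 hh)).
  by rewrite hK -hz hK.
suff : rect_linked q x by apply: nlink; rewrite mdistxx.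
apply: (connected_clopen cX (A := rect_linked q)).
- apply/open_distP => z qz; have [d d0 dP] := loc z; exists d => // z' /dP.
  exact: rect_linked_trans.
- apply/closed_distP => z zP; have [d d0 dP] := loc z; have [y qy zy] := zP d d0.
  exact: rect_linked_trans qy (rect_linked_sym (dP _ zy)).
- by exists q; exact: rect_linked_refl.
Qed.

End QuasiConvexity.

(** * Quasi-convexity *)

Section AnnularQuasiConvexity.
Context {R : realType} {X : metricType R} {M : R}.
Context (M1 : 1 <= M) (dil : dilations X M) (inv : inversions X M).
Context (Xp : proper_space X) (cX : connected [set: X]) (iX : inhabited X).
Context (Xr : has_nondegenerate_rectifiable_curve X).

Let M0 : 0 < M. Proof. by move: M1; lra. Qed.

(** Compactness bounds the lengths in [rect_linked_dense] on the unit ball,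
    and dilations make the bound proportional to the distance. *)
Lemma linked_halfway : exists2 K : R, 0 <= K & forall x y : X, exists2 y',
  linked setT x y' (K * mdist x y) & mdist y' y <= mdist x y / 2.
Proof.
have [p] := iX; pose eps := (2 * M ^+ 2)^-1.
have M2 : 0 < M ^+ 2 by rewrite exprn_gt0.
have e0 : 0 < eps by rewrite invr_gt0 mulr_gt0.
have cK := @Xp p M.
have [||n nP] := @compact_nested _ _ _ (fun n => [set y | exists2 y',
    linked setT p y' n%:R & mdist y y' <= eps]) cK.
- move=> m n y mn [y' py' yy']; exists y' => //; apply: linked_weaken py' => //.
  by rewrite ler_nat.
- move=> y _; have [y' [l py'] yy'] := rect_linked_dense M1 dil inv cX Xr p y (divr_gt0 e0 (ltr0Sn R 1)).
  exists (Num.truncn l).+1; apply/nbhs_distP; exists (eps / 2); first by rewrite divr_gt0.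
  move=> z yz; exists y'.
    by apply: linked_weaken py' => //; exact: ltW (truncnS_gt _).
  have := metric_triangle z y y'; rewrite (metric_sym z y); move: yz yy'; lra.
exists (M * n%:R); first by rewrite mulr_ge0// ltW.
move=> x y; have [->|xy] := eqVneq x y.
  exists y; last by rewrite mdistxx mul0r.
  by apply: linked_refl; rewrite // mdistxx mulr0.
have D0 : 0 < mdist x y by rewrite mdist_gt0.
have lam0 : 0 < (mdist x y)^-1 by rewrite invr_gt0.
have [h [h' [hh hx]]] := dil x p lam0; have [hK h'K hP] := hh.
have [|z pz hyz] := nP (h y).
  by rewrite /= -hx; have := (hP x y).1; rewrite mulVf ?gt_eqF// mulr1.
have [_ _ h'P] := quasi_similarity_inv lam0 hh.
rewrite invrK in h'P.
exists (h' z).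
  have -> : x = h' p by rewrite -hx hK.
  have -> : M * n%:R * mdist (h' p) y = M * mdist x y * n%:R by rewrite -hx hK; ring.
  apply: (linked_image (F := setT)) pz => //; first by rewrite mulr_ge0 ?mdist_ge0// ltW.
  by move=> u v _ _; rewrite -mulrA; exact: (h'P u v).1.
rewrite metric_sym -{1}(hK y) (le_trans (h'P _ _).1)//.
have -> : mdist x y / 2 = M * (mdist x y * (M * eps)).
  by rewrite /eps; field; rewrite gt_eqF.
rewrite ler_pM2l// ler_pM2l// (le_trans hyz)// ler_peMl// ltW//.
Qed.

(** By [linked_halfway] the distance that remains is halved again and again,
    until it is less than the step [eps]; the lengths form a geometric series. *)
Lemma quasi_convex : exists2 K : R, 1 <= K & forall x y : X, linked setT x y (K * mdist x y).
Proof.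
have [K K0 KP] := linked_halfway; exists (2 * K + 1); first by lra.
move=> x y eps e0.
have [k kP] : exists k, mdist x y <= 2 ^+ k * eps.
  have [k kP] := small_dyadic (mdist_ge0 x y) e0; exists k.
  by move: kP; rewrite ltr_pdivrMr ?exprn_gt0// mulrC => /ltW.
elim: k x kP => [|k IH] x.
  rewrite expr0 mul1r => xy; exists [:: y]; split => //=.
  - by rewrite andbT.
  - rewrite /chain_length /= addr0 ler_peMl ?mdist_ge0//; lra.
rewrite exprS => xy; have [y' xy' y'y] := KP x y.
have [|t [t1 t2 t3 _]] := IH y'; first by move: xy y'y; lra.
have [s [s1 s2 s3 _]] := xy' eps e0.
exists (s ++ t); split => //.
- by rewrite cat_path s1 s2.
- by rewrite last_cat s2.
- rewrite /chain_length chain_sum_cat s2.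
  have h := lerD s3 t3; apply: (le_trans h).
  have : (2 * K + 1) * mdist y' y <= (2 * K + 1) * (mdist x y / 2).
    by rewrite ler_wpM2l//; lra.
  have := mdist_ge0 x y; lra.
Qed.

(** The complement of [p] is connected, and locally quasi-convex. By
    [chain_uniform], points of an annulus about [p] are linked by chains of
    bounded length in a larger annulus, and dilations spread this to all
    annuli. *)
Lemma linked_in_annulus : ~ (exists x : X, cut_point x) -> exists2 N : R, 1 <= N &
  forall (z : X) (r : R), 0 < r -> forall x y, annulus z r (2 * r) x -> annulus z r (2 * r) y ->
    linked [set w | r / N <= mdist z w <= N * r] x y (N * r).
Proof.
move=> ncut; have [p] := iX; have [K K1 KP] := quasi_convex.
have cA : connected (~` [set p]) by apply: contrapT => nc; apply: ncut; exists p.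
pose J n (u v : X) := linked [set z | n.+1%:R^-1 <= mdist p z <= n.+1%:R] u v n%:R.
have Fle m n : (m <= n)%N -> [set z : X | m.+1%:R^-1 <= mdist p z <= m.+1%:R] `<=`
    [set z | n.+1%:R^-1 <= mdist p z <= n.+1%:R].
  move=> mn z /andP[h1 h2]; apply/andP; split.
    by apply: le_trans h1; rewrite lef_pV2 ?posrE// ler_nat.
  by apply: (le_trans h2); rewrite ler_nat.
have [|||||n nP] := @chain_uniform _ _ (~` [set p]) _ J cA (compact_annulus p M^-1 (2 * M) Xp).
- move=> z /andP[h1 _] /= zp; move: h1; rewrite zp mdistxx leNgt invr_gt0.
  by rewrite M0.
- move=> m n u v mn; apply: linked_weaken; first exact: Fle.
  by rewrite ler_nat.
- by move=> n u v; exact: linked_sym.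
- move=> m n u v w uv vw; rewrite /J natrD.
  apply: (@linked_trans _ _ _ _ v); first by apply: linked_weaken uv => //; apply: Fle; exact: leq_addr.
  by apply: linked_weaken vw => //; apply: Fle; exact: leq_addl.
- move=> u up; have pu0 : 0 < mdist p u.
    by rewrite mdist_gt0; apply/eqP => pu; apply: up.
  pose b := Num.max (mdist p u / 2)^-1 (mdist p u + K * mdist p u).
  have bN : b <= (Num.truncn b).+1%:R := ltW (truncnS_gt b).
  exists (Num.truncn b).+1; apply/nbhs_distP.
  exists (mdist p u / (2 * K)); first by rewrite divr_gt0// mulr_gt0//; lra.
  have K0 : 0 < K by lra.
  move=> v; rewrite ltr_pdivlMr ?mulr_gt0// => uv.
  have b1 : (mdist p u / 2)^-1 <= b by rewrite le_max lexx.
  have b2 : mdist p u + K * mdist p u <= b by rewrite le_max lexx orbT.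
  have KM : 0 <= (K - 1) * mdist p u by rewrite mulr_ge0// ?subr_ge0// ltW.
  have bN' : b <= (Num.truncn b).+2%:R by apply: (le_trans bN); rewrite ler_nat.
  apply: (linked_weaken (F := [set z | mdist u z <= K * mdist u v]) (l := K * mdist u v)).
  + move=> z /= uz; apply/andP; split.
      apply: (@le_trans _ _ (mdist p u / 2)).
        rewrite -[leRHS]invrK lef_pV2 ?posrE ?invr_gt0 ?divr_gt0//.
        exact: le_trans bN'.
      by have := metric_triangle p z u; rewrite (metric_sym z u); lra.
    by apply: le_trans bN'; have := metric_triangle p u z; lra.
  + by apply: le_trans bN; lra.
  + exact/linked_ball/KP.
pose N := M * n.+1%:R; have n1 : 1 <= n.+1%:R :> R by rewrite ler1n.
exists N; first exact: mulr_ege1.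
move=> z r r0 x y /andP[x1 x2] /andP[y1 y2].
have lam0 : 0 < r^-1 by rewrite invr_gt0.
have [h [h' [hh hz]]] := dil z p lam0; have [hK h'K hP] := hh.
have [_ _ h'P] := quasi_similarity_inv lam0 hh; rewrite invrK in h'P.
have inS w : r < mdist z w -> mdist z w < 2 * r -> M^-1 <= mdist p (h w) <= 2 * M.
  move=> w1 w2; rewrite -hz; have [h1 h2] := hP z w.
  have e1 : 1 <= r^-1 * mdist z w by rewrite ler_pdivlMl// mulr1 ltW.
  have e2 : r^-1 * mdist z w <= 2 by rewrite ler_pdivrMl// mulrC ltW.
  apply/andP; split.
    by rewrite -[M^-1]mulr1 ler_pdivrMl//; exact: le_trans h2.
  by rewrite (le_trans h1)// mulrC ler_pM2r.
have := nP _ _ (inS x x1 x2) (inS y y1 y2).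
rewrite /J => xy.
have -> : x = h' (h x) by rewrite hK.
have -> : y = h' (h y) by rewrite hK.
apply: (@linked_weaken _ _ [set w | r / N <= mdist z w <= N * r] _ _ _ (M * r * n%:R)) => //.
  by rewrite /N mulrAC ler_pM2r// ler_pM2l// ler_nat.
apply: (linked_image _ _ _ xy); first by rewrite mulr_ge0// ltW.
  by move=> u v _ _; rewrite -mulrA; exact: (h'P u v).1.
move=> u /= /andP[u1 u2]; have [h1 h2] := h'P p u.
have zE : h' p = z by rewrite -hz hK.
rewrite zE in h1 h2; apply/andP; split.
  rewrite /N ler_pdivrMr ?mulr_gt0//.
  rewrite mulrA -ler_pdivrMr// [_ * M]mulrC; apply: le_trans h2.
  by rewrite ler_pM2l.
rewrite (le_trans h1)// /N -mulrA ler_pM2l// mulrC ler_pM2r//.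
Qed.

(** Between close points a chain provided by [quasi_convex] is too short to
    leave the larger annulus. For points that are not close, the length given
    by [linked_in_annulus] is at most a multiple of their distance. *)
Lemma annularly_quasi_convex : ~ (exists x : X, cut_point x) -> annularly_quasiconvex X.
Proof.
move=> /linked_in_annulus[N N1 NP]; have [K K1 KP] := quasi_convex.
have K0 : 0 < K by lra.
have NK : 1 <= N * K by exact: mulr_ege1.
have NKN : N <= N * K by rewrite ler_peMr//; lra.
have NKK : K <= N * K by rewrite ler_peMl//; lra.
pose L := 4 * (N * K); have L1 : 1 <= L by rewrite /L; lra.
exists L; split => // z r r0 x y xA yA.
suff [A [B [l [AL BL lL xyl]]]] : exists A, exists B, exists l, [/\ r / L < A, B < 2 * L * r,
    l <= L * mdist x y & linked [set w | A <= mdist z w <= B] x y l].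
  have [g [g0 g1 gF gL]] := linked_curve Xp (closed_annulus z A B) xyl.
  have cg : continuous g by apply: (@lipschitz_continuous _ R^o) => s t; rewrite mdist_line; exact: gL.
  have len : (curve_length 0 1 g <= l%:E)%E.
    by have := lipschitz_curve_length gL ler01; rewrite subr0 mulr1.
  exists 0, 1, g; split.
    split.
    - by split; [split; [exact: ler01|exact: continuous_subspaceT]| |].
    - exact: le_lt_trans len (ltry _).
    - by apply: (le_trans len); rewrite lee_fin.
  move=> _ [t _ <-]; have /andP[h1 h2] := gF t.
  by rewrite /annulus /= (lt_le_trans AL h1) (le_lt_trans h2).
have [x1 x2] := andP xA.
have rN : r / L < r / N.
  rewrite ltr_pM2l// ltf_pV2 ?posrE /L; lra.
have rNL : N * r < 2 * L * r by rewrite ltr_pM2r// /L; lra.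
have [near|far] := leP (mdist x y) (r / (2 * K)).
  have near' : K * mdist x y <= r / 2.
    by move: near; rewrite ler_pdivlMr ?mulr_gt0// => ?; lra.
  exists (r / 2), (5 / 2 * r), (K * mdist x y); split.
  - by rewrite ltr_pM2l// ltf_pV2 ?posrE /L; lra.
  - by rewrite ltr_pM2r// /L; lra.
  - by rewrite ler_wpM2r ?mdist_ge0// /L; lra.
  - apply: (linked_weaken _ (lexx _) (linked_ball (KP x y))) => w /= xw.
    have := metric_triangle z x w; have := metric_triangle z w x; rewrite (metric_sym w x).
    by move=> h1 h2; apply/andP; split; lra.
exists (r / N), (N * r), (N * r); split => //.
  have : r <= 2 * K * mdist x y by move: far; rewrite ltr_pdivrMr ?mulr_gt0// mulrC => /ltW.
  move=> far'; apply: (@le_trans _ _ (N * (2 * K * mdist x y))).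
    by rewrite ler_wpM2l//; lra.
  have := mdist_ge0 x y; have -> : N * (2 * K * mdist x y) = 2 * (N * K) * mdist x y by ring.
  by move=> d0; rewrite ler_wpM2r// /L; lra.
exact: NP.
Qed.

End AnnularQuasiConvexity.

(** * The metric of power sums along chains *)

Section ChainMetric.
Context {R : realType} {X : metricType R}.
Context (s c0 : R) (s0 : 0 < s) (c00 : 0 < c0).
Context (lower : forall (x : X) c,
  c0 * mdist x (last x c) `^ s <= chain_sum (fun r => r `^ s) x c).

(** The bounds are arguments of the type so that it determines the metric
    attached to it below. *)
Definition chain_space (_ : forall (x : X) c,
  c0 * mdist x (last x c) `^ s <= chain_sum (fun r => r `^ s) x c)
  (_ : 0 < s) (_ : 0 < c0) : Type := X.

Let T := chain_space lower s0 c00.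

Let sums (x y : X) : set R :=
  [set chain_sum (fun r => r `^ s) x c | c in [set c | last x c = y]].

Definition chain_dist (x y : T) : R := inf (sums x y).

Let sums_lb x y : lbound (sums x y) (c0 * mdist x y `^ s).
Proof. by move=> _ [c <- <-]; exact: lower. Qed.

Let sums_direct x y : sums x y (mdist x y `^ s).
Proof. by exists [:: y]; rewrite //= addr0. Qed.

Let sums_inf x y : has_inf (sums x y).
Proof.
by split; [exists (mdist x y `^ s); exact: sums_direct|exists (c0 * mdist x y `^ s); exact: sums_lb].
Qed.

Lemma chain_dist_ge x y : c0 * mdist (x : X) y `^ s <= chain_dist x y.
Proof. by apply: lb_le_inf; [case: (sums_inf x y)|exact: sums_lb]. Qed.

Lemma chain_dist_le x y : chain_dist x y <= mdist (x : X) y `^ s.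
Proof. by apply: ge_inf; [case: (sums_inf x y)|exact: sums_direct]. Qed.

Lemma chain_distxx x : chain_dist x x = 0.
Proof.
apply/le_anti; have := chain_dist_le x x; have := chain_dist_ge x x.
by rewrite mdistxx powR0 ?gt_eqF// mulr0 => -> ->.
Qed.

Lemma chain_dist_positivity x y : chain_dist x y = 0 -> x = y.
Proof.
move=> xy; have := chain_dist_ge x y; rewrite xy pmulr_rle0// => h.
apply: (@mdist_positivity _ X); apply: (@powR_eq0_eq0 _ _ s).
by apply/le_anti; rewrite h powR_ge0.
Qed.

Lemma chain_dist_sym x y : chain_dist x y = chain_dist y x.
Proof.
suff H u v : sums u v `<=` sums v u by congr inf; apply/seteqP; split; exact: H.
move=> _ [c uv <-]; have eT : symmetric (fun _ _ : X => true) by [].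
have pT : path (fun _ _ => true) u c by elim: c u {uv} => [|z c IH] u //=.
have [c' [_ l' cs' _]] := chain_rev (fun r => r `^ s) eT pT.
by exists c'; rewrite -uv.
Qed.

Lemma chain_dist_triangle y x z : chain_dist x z <= chain_dist x y + chain_dist y z.
Proof.
apply/ler_addgt0Pr => e e0; have e2 : 0 < e / 2 by rewrite divr_gt0.
have [_ [c cl <-] h1] := inf_adherent e2 (sums_inf x y).
have [_ [d dl <-] h2] := inf_adherent e2 (sums_inf y z).
have : chain_dist x z <= chain_sum (fun r => r `^ s) x (c ++ d).
  apply: ge_inf; first by case: (sums_inf x z).
  by exists (c ++ d) => //=; rewrite last_cat cl.
rewrite chain_sum_cat cl /chain_dist; lra.
Qed.

HB.instance Definition _ := Choice.copy T (Choice.sort X).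

HB.instance Definition _ := isMetric.Build R T chain_distxx
  chain_dist_positivity chain_dist_sym chain_dist_triangle.

Lemma mdist_chain_space (x y : X) : mdist (x : T) (y : T) = chain_dist x y.
Proof. by []. Qed.

(** The metric [chain_dist] is comparable to the power [s] of the given one,
    so its power [s^-1] is comparable to the given one. *)
Lemma chain_space_snowflake : 1 < s -> exists (alpha : R) (alpha01 : 0 < alpha <= 1),
  alpha < 1 /\ exists Z : metricType R, is_snowflake alpha01 Z /\ bilipschitz_homeomorphic X Z.
Proof.
move=> s1; have i01 : 0 < s^-1 <= 1 by rewrite invr_gt0 s0 invf_le1// ltW.
exists s^-1, i01; split; first by rewrite invf_lt1.
exists (snowflake i01 T); split.
  by exists T, id; split => //; exists id.
have c0s : 0 < c0 `^ s^-1 by rewrite powR_gt0.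
pose L := 1 + (c0 `^ s^-1)^-1.
have iL : 0 < (c0 `^ s^-1)^-1 by rewrite invr_gt0.
have L0 : 0 < L by rewrite /L; lra.
have root (d : R) (d0 : 0 <= d) : (d `^ s) `^ s^-1 = d := powR_root d0 s0.
have up (x y : X) : mdist (x : snowflake i01 T) y <= mdist x y.
  rewrite (mdist_snowflake i01 (x : T) y) mdist_chain_space -[leRHS]root ?mdist_ge0//.
  apply: ge0_ler_powR; rewrite ?nnegrE ?powR_ge0 ?invr_ge0 ?(ltW s0)//.
    by rewrite -mdist_chain_space mdist_ge0.
  exact: chain_dist_le.
have low (x y : X) : mdist x y <= (c0 `^ s^-1)^-1 * mdist (x : snowflake i01 T) y.
  rewrite ler_pdivlMl// -[X in _ * X]root ?mdist_ge0// -powRM ?powR_ge0 ?(ltW c00)//.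
  rewrite (mdist_snowflake i01 (x : T) y) mdist_chain_space.
  apply: ge0_ler_powR; rewrite ?nnegrE ?mulr_ge0 ?powR_ge0 ?invr_ge0 ?(ltW s0) ?(ltW c00)//.
    by rewrite -mdist_chain_space mdist_ge0.
  exact: chain_dist_ge.
exists L; split; first by rewrite /L; lra.
exists (id : X -> snowflake i01 T); split.
  exists (id : snowflake i01 T -> X); split => //.
  - apply: (@lipschitz_continuous _ X (snowflake i01 T) 1) => u v.
    by rewrite mul1r; exact: up.
  - exact: (@lipschitz_continuous _ (snowflake i01 T) X (c0 `^ s^-1)^-1 id low).
move=> x y; apply: within_factor_simeq => //; split.
  rewrite (le_trans (up x y))// ler_peMl ?mdist_ge0//; rewrite /L; lra.
rewrite (le_trans (low x y))// ler_wpM2r ?mdist_ge0//; rewrite /L; lra.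
Qed.

End ChainMetric.

(** * Spaces without rectifiable curves *)

Section NoRectifiableCurves.
Context {R : realType} {X : metricType R} {M : R}.
Context (M1 : 1 <= M) (dil : dilations X M) (Xp : proper_space X) (iX : inhabited X).
Context (Xnr : ~ has_nondegenerate_rectifiable_curve X).

Let M0 : 0 < M. Proof. by move: M1; lra. Qed.

Lemma no_linked (x y : X) (l : R) : linked setT x y l -> x = y.
Proof.
move=> xy; apply: contrapT => nxy; apply: Xnr.
have [g [g0 g1 _ gL]] := linked_curve Xp closedT xy.
have cg : continuous g by apply: (@lipschitz_continuous _ R^o) => s t; rewrite mdist_line; exact: gL.
exists 0, 1, g; split.
- by split; [exact: ler01|exact: continuous_subspaceT].
- by exists 0, 1; split; rewrite ?in_itv/= ?lexx ?ler01// g0 g1.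
- exact: le_lt_trans (lipschitz_curve_length gL ler01) (ltry _).
Qed.

(** Otherwise there are chains of bounded length and of steps tending to 0
    that, after rescaling, lead from [p] to a compact annulus. Their ends
    accumulate at a point linked to [p], which is a point joined to [p] by a
    rectifiable curve. *)
Lemma fine_chains_long (K : R) : exists2 eta : R, 0 < eta & forall (x : X) s,
  path (step_le (eta * mdist x (last x s))) x s -> K * mdist x (last x s) <= chain_length x s.
Proof.
apply: contrapT => nE; have [p] := iX.
have bad n : exists x : X * seq X, path (step_le (n.+1%:R^-1 * mdist x.1 (last x.1 x.2))) x.1 x.2 /\
    chain_length x.1 x.2 < K * mdist x.1 (last x.1 x.2).
  apply: contrapT => /forallNP nb; apply: nE; exists n.+1%:R^-1; first by rewrite invr_gt0.
  move=> x s ps; rewrite leNgt; apply/negP => lt_s; apply: (nb (x, s)).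
  by split.
have norm n : exists s : seq X, [/\ path (step_le (M * n.+1%:R^-1)) p s,
    chain_length p s <= M * K & M^-1 <= mdist p (last p s) <= M].
  have [[x s] /= [ps ls]] := bad n.
  have D0 : 0 < mdist x (last x s).
    rewrite lt_neqAle mdist_ge0 andbT; apply: contraTneq ls => <-.
    by rewrite mulr0 -leNgt chain_length_ge0.
  set D := mdist x (last x s) in ps ls D0.
  have lam0 : 0 < D^-1 by rewrite invr_gt0.
  have [h [h' [hh hx]]] := dil x p lam0; have [hK h'K hP] := hh.
  have hL u v : mdist (h u) (h v) <= M * D^-1 * mdist u v.
    by rewrite -mulrA; exact: (hP u v).1.
  have MD : 0 <= M * D^-1 by rewrite mulr_ge0// ltW.
  exists (map h s); rewrite -hx; split.
  - move: ps {ls}; move: D D0 hL MD {lam0 hh hP} => D D0 hL MD.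
    elim: s x {hx} => [//|y s IH] x /= /andP[xy ys]; rewrite IH// andbT /step_le.
    rewrite (le_trans (hL x y))//; apply: le_trans (ler_wpM2l MD xy) _.
    have E q : M * D^-1 * (q * D) = M * q by field; rewrite gt_eqF.
    by rewrite E.
  - rewrite (le_trans (chain_sum_map (F := setT) (fun u v _ _ => hL u v) _))//.
    rewrite (@le_trans _ _ (M * D^-1 * (K * D)))//; first by rewrite ler_wpM2l// ltW.
    by have -> : M * D^-1 * (K * D) = M * K by field; rewrite gt_eqF.
  - rewrite last_map; have [h1 h2] := hP x (last x s).
    rewrite mulVf ?gt_eqF// in h1 h2; rewrite mulr1 in h1.
    by rewrite h1 andbT -[M^-1]mulr1 ler_pdivrMl.
have /choice[S SP] := norm.
have cA : compact [set z : X | M^-1 <= mdist p z <= M].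
  exact: compact_annulus.
have mA n : [set z : X | M^-1 <= mdist p z <= M] (last p (S n)) by have [] := SP n.
have [y /andP[py _] yP] := compact_seq_cluster cA mA.
suff /no_linked py' : linked setT p y (M * K + 1).
  by move: py; rewrite -py' mdistxx leNgt invr_gt0 M0.
move=> eps e0; have e1 : 0 < Num.min eps 1 by rewrite lt_min e0 ltr01.
have [n nN] := yP (Num.min eps 1) (Num.truncn (M / eps)) e1.
rewrite lt_min => /andP[ny1 ny2].
have [s1 s2 _] := SP n.
exists (rcons (S n) y); split => //.
- rewrite rcons_path {2}/step_le (ltW ny1) andbT; apply: fine_path_weaken s1.
  rewrite ler_pdivrMr// mulrC -ler_pdivrMr// (le_trans (ltW (truncnS_gt _)))//.
  by rewrite ler_nat ltnS.
- by rewrite last_rcons.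
- by rewrite -cats1 /chain_length chain_sum_cat /= addr0 lerD// ltW.
Qed.

(** The chain is cut at its first exit from the ball, which exceeds the radius
    by one step at most. *)
Lemma first_block (tau : R) (w x : X) c : path (step_le tau) x c -> mdist w x < tau ->
  mdist w (last x c) < tau \/
  exists c1 c2, [/\ c = c1 ++ c2, c1 != [::] & tau <= mdist w (last x c1) <= 2 * tau].
Proof.
elim: c x => [|y c IH] x /=; first by left.
move=> /andP[xy yc] wx; case: (ltP (mdist w y) tau) => wy.
  have [|[c1 [c2 [-> c1n c1P]]]] := IH y yc wy; [by left|right].
  by exists (y :: c1), c2.
right; exists [:: y], c; split => //=; rewrite wy/=.
by have := metric_triangle w x y; rewrite /step_le in xy; lra.
Qed.

(** Cutting the chain whenever it leaves the ball of radius [tau] about the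
    last cut gives a coarse chain, each step of which accounts for [b] in the
    sum. *)
Lemma blocks (phi : R -> R) (tau b : R) n (x : X) c : (forall r, 0 <= r -> 0 <= phi r) -> 0 < tau ->
  (size c <= n)%N -> path (step_le tau) x c ->
  (forall (u : X) c', (size c' <= n)%N -> tau <= mdist u (last u c') -> b <= chain_sum phi u c') ->
  exists ws, [/\ path (step_le (2 * tau)) x ws, mdist (last x ws) (last x c) < tau &
    (size ws)%:R * b <= chain_sum phi x c].
Proof.
move=> phi0 tau0; elim: n x c => [|n IH] x c.
  rewrite leqn0 size_eq0 => /eqP -> _ _; exists [::]; split => //=.
    by rewrite mdistxx.
  by rewrite mul0r.
move=> cn pc H; have [|cx|[c1 [c2 [cE c1n /andP[c11 c12]]]]] := first_block (w := x) pc.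
- by rewrite mdistxx.
- exists [::]; split => //=.
  by rewrite mul0r chain_sum_ge0.
have s1 : (0 < size c1)%N by rewrite lt0n size_eq0.
move: cn pc; rewrite cE size_cat cat_path => cn /andP[p1 p2].
have [||ws [w1 w2 w3]] := IH (last x c1) c2 _ p2.
- by rewrite -ltnS (leq_trans _ cn)// -[X in (X < _)%N]add0n ltn_add2r.
- by move=> u c' c'n; apply: H; exact: leqW.
exists (last x c1 :: ws); split => /=.
- by rewrite w1 andbT.
- by rewrite last_cat.
- rewrite chain_sum_cat -nat1r mulrDl mul1r lerD// H//.
  by rewrite (leq_trans _ cn)// leq_addr.
Qed.

(** Let [k = eta / 2], where chains of steps at most [eta * D] have length at
    least [8 * D], and choose [s] with [k ^ s = k / 2]. The bound is proved by
    induction on the number of steps, for a chain with ends at distance [D].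
    If some step exceeds [tau = k * D], it suffices alone. Otherwise [blocks]
    gives a coarse chain with steps at most [2 * tau = eta * D], hence with at
    least [8 / eta] steps. By induction nearly all of them contribute [c0 *
    tau ^ s], which is [c0 * (eta / 4) * D ^ s]. The first block is left
    aside, so that induction applies to strictly shorter chains. *)
Lemma power_sum_bound : exists s c0 : R, [/\ 1 < s, 0 < c0 &
  forall (x : X) c, c0 * mdist x (last x c) `^ s <= chain_sum (fun r => r `^ s) x c].
Proof.
have [eta0 eta00 long0] := fine_chains_long 8.
pose eta := Num.min eta0 1.
have eta1 : eta <= 1 by rewrite ge_min lexx orbT.
have etaP : 0 < eta by rewrite lt_min eta00 ltr01.
have long (x : X) c : path (step_le (eta * mdist x (last x c))) x c ->
    8 * mdist x (last x c) <= chain_length x c.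
  move=> pc; apply: (long0 x c); apply: fine_path_weaken pc.
  by rewrite ler_wpM2r ?mdist_ge0// ge_min lexx.
pose k := eta / 2; have k0 : 0 < k by rewrite divr_gt0.
have k1 : k < 1 by rewrite /k; lra.
have lnk : ln k < 0 by rewrite ln_lt0// k0.
pose t := ln 2^-1 / ln k.
have t0 : 0 < t.
  by rewrite /t -mulrNN -invrN divr_gt0// oppr_gt0// ln_lt0// invr_gt0 ltr0n invf_lt1 ?ltr1n.
have kt : k `^ t = 2^-1.
  rewrite /powR gt_eqF// /t divfK ?lt_eqF// lnK// posrE; lra.
pose s := 1 + t; have s1 : 1 < s by rewrite /s; lra.
have s0 : 0 < s by lra.
have ks : k `^ s = k / 2 by rewrite /s powRD ?powRr1 ?kt ?(ltW k0)// gt_eqF.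
pose c0 := k `^ s; have c00 : 0 < c0 by rewrite powR_gt0.
exists s, c0; split => // x c.
have phi0 (r : R) : 0 <= r -> 0 <= r `^ s by move=> _; exact: powR_ge0.
move: {2}(size c) (leqnn (size c)) => n; elim: n x c => [|n IH] x c cn.
  move: cn; rewrite leqn0 size_eq0 => /eqP -> /=.
  by rewrite mdistxx powR0 ?gt_eqF// mulr0.
set D := mdist x (last x c).
have [D0|D0] := leP D 0.
  have -> : D = 0 by apply/le_anti; rewrite D0 mdist_ge0.
  by rewrite powR0 ?gt_eqF// mulr0 chain_sum_ge0.
pose tau := k * D; have tau0 : 0 < tau by rewrite mulr_gt0.
have tauD : tau < D by rewrite /tau -[ltRHS]mul1r ltr_pM2r.
have taus : tau `^ s = c0 * D `^ s by rewrite /tau powRM// ltW.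
have big_step c' (x' : X) : ~~ path (step_le tau) x' c' ->
    tau `^ s <= chain_sum (fun r => r `^ s) x' c'.
  elim: c' x' => [//|y c' IHc] x' /=; rewrite negb_and => /orP[xy|/IHc h].
    rewrite ler_wpDr ?chain_sum_ge0//; apply: ge0_ler_powR.
    - exact: ltW.
    - by rewrite nnegrE ltW.
    - by rewrite nnegrE mdist_ge0.
    - by move: xy; rewrite /step_le -ltNge => /ltW.
  by rewrite ler_wpDl// phi0// mdist_ge0.
have [pc|npc] := boolP (path (step_le tau) x c); last by rewrite -taus; exact: big_step.
have [|xc|[c1 [c2 [cE c1n /andP[c11 c12]]]]] := first_block (w := x) pc.
- by rewrite mdistxx.
- by exfalso; move: xc; rewrite -/D => /(lt_trans tauD); rewrite ltxx.
have s1c : (0 < size c1)%N by rewrite lt0n size_eq0.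
move: cn pc; rewrite cE size_cat cat_path => cn /andP[p1 p2].
have c2n : (size c2 <= n)%N.
  by rewrite -ltnS (leq_trans _ cn)// -[X in (X < _)%N]add0n ltn_add2r.
have [|ws [w1 w2 w3]] := @blocks (fun r => r `^ s) tau (c0 * tau `^ s) n _ c2 phi0 tau0 c2n p2.
  move=> u c' c'n uc'; apply: le_trans (IH u c' c'n); rewrite ler_pM2l//.
  by apply: ge0_ler_powR; rewrite ?nnegrE ?mdist_ge0// ltW.
have lastE : last (last x c1) c2 = last x c by rewrite cE last_cat.
rewrite lastE in w2.
have coarse : path (step_le (2 * tau)) x ((last x c1 :: ws) ++ [:: last x c]).
  rewrite cat_path /= w1 !andbT; apply/andP; split => //.
  by rewrite /step_le; move: w2 tau0; lra.
have len (e : R) (y : X) r : path (step_le e) y r -> chain_length y r <= (size r)%:R * e.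
  elim: r y => [|z r IHr] y /=; first by rewrite mul0r.
  move=> /andP[yz zr]; rewrite -nat1r mulrDl mul1r lerD//; exact: IHr.
have := len _ _ _ coarse; rewrite size_cat /= addn1.
have := long x ((last x c1 :: ws) ++ [:: last x c]).
rewrite last_cat /= -/D => h1 h2.
have {}h1 := le_trans (h1 _) h2.
have {h1}h1 : 8 * D <= (size ws).+2%:R * (2 * tau).
  apply: h1; apply: fine_path_weaken coarse; rewrite /tau /k; lra.
rewrite chain_sum_cat ler_wpDl ?chain_sum_ge0//; apply: le_trans w3.
rewrite taus [leRHS]mulrA -[leLHS]mul1r ler_wpM2r//; first by rewrite mulr_ge0 ?powR_ge0 ?(ltW c00).
rewrite /c0 ks /k.
have : 8 <= (size ws).+2%:R * eta.
  rewrite -(ler_pM2r D0); apply: (le_trans h1); rewrite /tau /k; lra.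
rewrite -addn2 natrD; lra.
Qed.

Lemma no_rectifiable_snowflake : exists (alpha : R) (alpha01 : 0 < alpha <= 1),
  alpha < 1 /\ exists Z : metricType R, is_snowflake alpha01 Z /\ bilipschitz_homeomorphic X Z.
Proof.
have [s [c0 [s1 c00 low]]] := power_sum_bound.
exact: (chain_space_snowflake (lt_trans ltr01 s1) c00 low s1).
Qed.

End NoRectifiableCurves.

(** * Covering numbers *)

Section Coverings.
Context {R : realType} {X : metricType R}.
Implicit Types (A : set X) (c s : seq X) (r : R).

Definition covers A r c := forall y, A y -> exists2 z, z \in c & mdist z y <= r.

Definition scattered r s := pairwise (fun u v => r < mdist u v) s.

Lemma covers_subset A B r r' c : B `<=` A -> r <= r' -> covers A r c -> covers B r' c.
Proof.
by move=> BA rr' cA y /BA /cA[z zc zy]; exists z => //; exact: le_trans rr'.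
Qed.

Lemma compact_covers A r : compact A -> 0 < r -> exists c, covers A r c.
Proof.
move=> cA r0; apply: contrapT => /forallNP nc.
have /choice[pick pickP] : forall c, exists y, A y /\ forall z, z \in c -> r < mdist z y.
  move=> c; apply: contrapT => /forallNP ny; apply: (nc c) => y Ay.
  apply: contrapT => nz; apply: (ny y); split => // z zc; rewrite ltNge.
  by apply/negP => zy; apply: nz; exists z.
pose cs := fix F n := if n is m.+1 then pick (F m) :: F m else [::].
have far m n : (m < n)%N -> r < mdist (pick (cs m)) (pick (cs n)).
  move=> mn; apply: (pickP (cs n)).2.
  elim: n mn => [//|n IH]; rewrite ltnS leq_eqVlt => /orP[/eqP ->|/IH h] /=.
    by rewrite inE eqxx.
  by rewrite inE h orbT.
have [z _ zP] := compact_seq_cluster (u := fun n => pick (cs n)) cA (fun n => (pickP _).1).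
have r2 : 0 < r / 2 by rewrite divr_gt0.
have [m _ mz] := zP _ 0%N r2; have [n mn nz] := zP _ m.+1 r2.
have := far m n mn; have := metric_triangle (pick (cs m)) z (pick (cs n)).
rewrite (metric_sym z); lra.
Qed.

Lemma scattered_le_covers r s c :
  scattered (2 * r) s -> covers (fun v => v \in s) r c -> (size s <= size c)%N.
Proof.
elim: s c => [//|y s IH] c; rewrite /scattered /= => /andP[ys sep] cov.
have [z zc zy] := cov y (mem_head _ _).
have : (size s <= size (rem z c))%N.
  apply: IH => // v vs; have [|z' z'c z'v] := cov v; first by rewrite inE vs orbT.
  exists z' => //; have z'z : z' != z.
    apply/eqP => E; move/allP : ys => /(_ v vs); rewrite E in z'v.
    have := metric_triangle y z v; rewrite (metric_sym y z); lra.
  by move: z'c; rewrite (perm_mem (perm_to_rem zc)) inE (negbTE z'z).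
rewrite size_rem//; case: c zc {cov} => //= a c _.
Qed.

Lemma covnum_ex A r : exists n : nat, (exists c, covers A r c) ->
  (exists2 c, covers A r c & size c = n) /\ forall c, covers A r c -> (n <= size c)%N.
Proof.
have [[c0 c0P]|nc] := pselect (exists c, covers A r c); last by exists 0%N.
have ex : exists n, `[< exists2 c, covers A r c & size c = n >].
  by exists (size c0); apply/asboolP; exists c0.
case: (ex_minnP ex) => n /asboolP nP nmin; exists n => _; split => // c cP.
by apply: nmin; apply/asboolP; exists c.
Qed.

(** The covering number of [A], provided that [A] has some finite cover. *)
Definition covnum A r : nat := projT1 (cid (covnum_ex A r)).

Lemma covnumP A r c : covers A r c -> exists2 c, covers A r c & size c = covnum A r.
Proof.
by move=> cP; rewrite /covnum; case: cid => n /= nP; have [] := nP (ex_intro _ c cP).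
Qed.

Lemma covnum_le A r c : covers A r c -> (covnum A r <= size c)%N.
Proof.
move=> cP; rewrite /covnum; case: cid => n /= nP.
by have [_] := nP (ex_intro _ c cP); exact.
Qed.

(** A scattered set of maximal size is a cover, and the size is bounded by
    that of any cover at half the scale. *)
Lemma large_scattered A r : compact A -> 0 < r ->
  exists s, [/\ forall y, y \in s -> A y, scattered r s & (covnum A r <= size s)%N].
Proof.
move=> cA r0; have r2 : 0 < r / 2 by rewrite divr_gt0.
have [c0 c0P] := compact_covers cA r2.
pose P n := `[< exists s, [/\ forall y, y \in s -> A y, scattered r s & size s = n] >].
have P0 : exists n, P n by exists 0%N; apply/asboolP; exists [::].
have Pb n : P n -> (n <= size c0)%N.
  move=> /asboolP[s [sA sep <-]]; apply: (@scattered_le_covers (r / 2)).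
    by have -> : 2 * (r / 2) = r by lra.
  by move=> v /sA; exact: c0P.
case: (ex_maxnP P0 Pb) => n /asboolP[s [sA sep sn]] nmax.
exists s; split => //; apply: covnum_le => y Ay.
apply: contrapT => nz.
have : (n.+1 <= n)%N; last by rewrite ltnn.
apply: nmax; apply/asboolP; exists (y :: s); split.
- by move=> u; rewrite inE => /orP[/eqP ->//|/sA].
- rewrite /scattered /= -/(scattered r s) sep andbT; apply/allP => u us; rewrite ltNge; apply/negP => uy.
  by apply: nz; exists u => //; rewrite metric_sym.
- by rewrite /= sn.
Qed.

Lemma covers_similarity M lam (h h' : X -> X) A B r c : 0 < lam -> 0 <= M ->
  quasi_similarity M lam h h' -> (forall y, B y -> A (h y)) ->
  covers A r c -> covers B (M * (lam^-1 * r)) (map h' c).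
Proof.
move=> lam0 M0 hh BA cov y /BA /cov[z zc zy]; exists (h' z); first exact: map_f.
have [hK _ _] := hh; have [_ _ h'P] := quasi_similarity_inv lam0 hh.
rewrite -{1}(hK y) (le_trans (h'P z (h y)).1)// ler_wpM2l// ler_wpM2l// invr_ge0 ltW//.
Qed.

Lemma covers_flatten A r r' c n : covers A r c ->
  (forall z, z \in c -> exists2 d, covers [set y | mdist z y <= r] r' d & (size d <= n)%N) ->
  exists2 d, covers A r' d & (size d <= size c * n)%N.
Proof.
move=> cov small.
have /choice[f fP] : forall z, exists d, z \in c ->
    covers [set y | mdist z y <= r] r' d /\ (size d <= n)%N.
  move=> z; have [zc|_] := boolP (z \in c); last by exists [::].
  by have [d d1 d2] := small z zc; exists d.
exists (flatten (map f c)).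
  move=> y /cov[z zc zy]; have [+ _] := fP z zc => /(_ y zy)[u uf uy]; exists u => //.
  by apply/flattenP; exists (f z) => //; exact: map_f.
elim: c {cov small} fP => [//|z c IH] fP /=; rewrite size_cat mulSn leq_add//.
  by have [] := fP z (mem_head _ _).
by apply: IH => u uc; apply: fP; rewrite inE uc orbT.
Qed.

(** The related pairs are counted in two ways. *)
Lemma disjoint_count (T : eqType) (S : Type) (P : T -> S -> bool) (s : seq T) (c : seq S) n :
  (forall u, u \in s -> (n <= count (P u) c)%N) ->
  (forall z, (count (fun u => P u z) s <= 1)%N) -> (size s * n <= size c)%N.
Proof.
move=> low up; apply: (@leq_trans (\sum_(u <- s) count (P u) c)).
  elim: s low {up} => [|u s IH] low; first by rewrite big_nil mul0n.
  rewrite big_cons mulSn leq_add// ?low ?mem_head// IH// => v vs.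
  by rewrite low// inE vs orbT.
elim: c {low} => [|z c IH]; first by rewrite big1_seq.
rewrite (eq_bigr (fun u => (P u z + count (P u) c)%N)) ; last by move=> u _ /=.
rewrite big_split /=; apply: (@leq_add _ _ 1 (size c)) IH => //.
apply: leq_trans (up z); elim: s {up} => [|u s IHs] /=; first by rewrite big_nil.
by rewrite big_cons leq_add2l.
Qed.

End Coverings.

(** * Quasi-additive sequences *)

Section QuasiAdditive.
Context {R : realType}.

(** Computing [b (n * m)] in two ways shows that [(b n - k) / n] never exceeds
    [(b m + k) / m]. The supremum of the former is the slope. *)
Lemma quasi_additive_slope (b : nat -> R) (k : R) :
  (forall i j, `|b (i + j)%N - b i - b j| <= k) ->
  exists l : R, forall n, `|b n.+1 - n.+1%:R * l| <= k.
Proof.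
move=> bP; have bP1 i j : b i + b j - k <= b (i + j)%N.
  by have := bP i j; rewrite ler_norml => /andP[h _]; lra.
have bP2 i j : b (i + j)%N <= b i + b j + k.
  by have := bP i j; rewrite ler_norml => /andP[_ h]; lra.
have k0 : 0 <= k := le_trans (normr_ge0 _) (bP 0%N 0%N).
have low n m : m.+1%:R * b n - m%:R * k <= b (n * m.+1)%N.
  elim: m => [|m IH]; first by rewrite mul1r mul0r subr0 muln1.
  rewrite mulnS; have := bP1 n (n * m.+1)%N; move: IH; rewrite -!natr1; lra.
have up n m : b (n * m.+1)%N <= m.+1%:R * b n + m%:R * k.
  elim: m => [|m IH]; first by rewrite mul1r mul0r addr0 muln1.
  rewrite mulnS; have := bP2 n (n * m.+1)%N; move: IH; rewrite -!natr1; lra.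
pose S := [set (b n.+1 - k) / n.+1%:R | n in [set: nat]].
have S0 : S !=set0 by exists ((b 1%N - k) / 1%:R), 0%N.
have Sub m : ubound S ((b m.+1 + k) / m.+1%:R).
  move=> _ [n _ <-]; rewrite ler_pdivrMr// mulrAC ler_pdivlMr//.
  have := low n.+1 m; have := up m.+1 n; rewrite mulnC => h1 h2.
  have := le_trans h2 h1; rewrite -!natr1; lra.
have sS : has_sup S by split => //; exists ((b 1%N + k) / 1%:R); exact: Sub.
exists (sup S) => n; rewrite ler_norml; apply/andP; split.
  have : sup S <= (b n.+1 + k) / n.+1%:R by apply: ge_sup => //; exact: Sub.
  rewrite ler_pdivlMr// mulrC; lra.
have : (b n.+1 - k) / n.+1%:R <= sup S by apply: ub_le_sup; [case: sS|exists n].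
by rewrite ler_pdivrMr// mulrC; lra.
Qed.

End QuasiAdditive.

(** * Growth of covering numbers *)

Section Growth.
Context {R : realType} {X : metricType R} {M : R}.
Context (M1 : 1 <= M) (dil : dilations X M) (Xp : proper_space X).
Context (cX : connected [set: X]) (Xu : unbounded_space X) (p : X).

Let M0 : 0 < M. Proof. by move: M1; lra. Qed.
Let M20 : 0 < M ^+ 2. Proof. by rewrite exprn_gt0. Qed.

Local Notation B x r := [set y : X | mdist x y <= r].

Definition ball_covnum (s : R) : nat := covnum (B p 1) s.

Lemma ball_covnum_cover s : 0 < s -> exists2 c, covers (B p 1) s c & size c = ball_covnum s.
Proof.
move=> s0; have cB := @Xp p 1; have [c cP] := compact_covers cB s0.
exact: covnumP cP.
Qed.

Lemma ball_covnum_mono s s' : 0 < s -> s <= s' -> (ball_covnum s' <= ball_covnum s)%N.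
Proof.
move=> s0 ss'; have [c cP <-] := ball_covnum_cover s0; apply: covnum_le.
exact: covers_subset cP.
Qed.

Lemma ball_covnum_upper x r s r' : 0 < r -> 0 < s -> M ^+ 2 * s * r <= r' ->
  exists2 c, covers (B x r) r' c & (size c <= ball_covnum s)%N.
Proof.
move=> r0 s0 rr'; have [c cP cs] := ball_covnum_cover s0.
have lam0 : 0 < (M * r)^-1 by rewrite invr_gt0 mulr_gt0.
have [h [h' [hh hx]]] := dil x p lam0; have [hK h'K hP] := hh.
exists (map h' c); last by rewrite size_map cs.
apply: (@covers_subset _ _ (B x r) _ (M * ((M * r)^-1^-1 * s))) => //.
  by move: rr'; rewrite invrK; congr (_ <= _); ring.
apply: (covers_similarity lam0 (ltW M0) hh _ cP) => y /= xy.
rewrite -hx (le_trans (hP x y).1)//.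
have -> : 1 = M * ((M * r)^-1 * r) by field; rewrite !gt_eqF.
by rewrite ler_pM2l// ler_pM2l.
Qed.

Lemma ball_covnum_lower x r s c : 0 < r -> 0 < s -> covers (B x r) s c ->
  (ball_covnum (M ^+ 2 * s / r) <= size c)%N.
Proof.
move=> r0 s0 cP; have lam0 : 0 < r / M by rewrite divr_gt0.
have [h [h' [hh hp]]] := dil p x lam0; have [hK h'K hP] := hh.
rewrite -(size_map h' c); apply: covnum_le.
have -> : M ^+ 2 * s / r = M * ((r / M)^-1 * s) by field; rewrite !gt_eqF.
apply: (covers_similarity lam0 (ltW M0) hh _ cP) => y /= py.
rewrite -hp (le_trans (hP p y).1)// mulrA mulrC -{2}[r]mul1r.
have -> : M * (r / M) = r by field; rewrite gt_eqF.
by rewrite ler_pM2r.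
Qed.

(** Each ball of a cover is covered in turn by a rescaled cover of the unit
    ball. *)
Lemma ball_covnum_submult s t : 0 < s -> 0 < t ->
  (ball_covnum (M ^+ 2 * s * t) <= ball_covnum s * ball_covnum t)%N.
Proof.
move=> s0 t0; have [c cP <-] := ball_covnum_cover s0.
have [z _|d dP] := covers_flatten (r' := M ^+ 2 * s * t) (n := ball_covnum t) cP.
  by apply: ball_covnum_upper => //; rewrite mulrAC.
by apply: leq_trans; exact: covnum_le.
Qed.

Lemma count_le1 (P : pred X) (r : R) s : scattered r s ->
  (forall u v, P u -> P v -> mdist u v <= r) -> (count P s <= 1)%N.
Proof.
move=> sep Pr; elim: s sep => [//|u s IH]; rewrite /scattered /= => /andP[us sep].
have [Pu|_] := boolP (P u); last exact: IH.
rewrite -(addn0 1%N) leq_add2l leqn0 -(count_pred0 s); apply/eqP/eq_in_count => v vs /=.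
apply/negbTE/negP => Pv; move/allP : us => /(_ v vs).
by rewrite ltNge (Pr _ _ Pu Pv).
Qed.

(** Balls of radius [s / 4] about the points of an [s]-scattered set are
    disjoint, and each of them needs its own share of small balls, at least a
    rescaled covering number of the unit ball. *)
Lemma ball_covnum_supmult s t : 0 < s -> s <= 1 -> 0 < t -> t <= 1 ->
  (ball_covnum s * ball_covnum t <= ball_covnum (s * t / (8 * M ^+ 4)))%N.
Proof.
move=> s0 s1 t0 t1; pose rho := s * t / (4 * M ^+ 2).
have M40 : 0 < M ^+ 4 by rewrite exprn_gt0.
have M21 : 1 <= M ^+ 2 by exact: exprn_ege1.
have rho0 : 0 < rho by rewrite divr_gt0 ?mulr_gt0.
have rhos : rho <= s / 4.
  have -> : rho = (s / 4) * (t / M ^+ 2) by rewrite /rho; field; rewrite gt_eqF.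
  by rewrite ler_piMr ?divr_ge0 ?(ltW s0)// ler_pdivrMr// mul1r (le_trans t1).
have [||c cP cs] := @ball_covnum_upper p 2 (s * t / (8 * M ^+ 4)) rho (ltr0Sn _ _).
- by rewrite divr_gt0 ?mulr_gt0.
- rewrite (_ : _ * 2 = rho)// /rho; field; rewrite gt_eqF//.
apply: leq_trans cs.
have cB := @Xp p 1; have [S [SB Ssep Ss]] := large_scattered cB s0.
apply: (@leq_trans (size S * ball_covnum t)); first by rewrite leq_mul2r Ss orbT.
pose P (u z : X) := `[< exists y, mdist u y <= s / 4 /\ mdist z y <= rho >].
apply: (disjoint_count (P := P)).
- move=> u /SB /= pu; rewrite -size_filter.
  have <- : M ^+ 2 * rho / (s / 4) = t by rewrite /rho; field; rewrite !gt_eqF.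
  apply: (@ball_covnum_lower u) => //; first by rewrite divr_gt0.
  move=> y /= uy; have [|z zc zy] := cP y.
    by rewrite /=; have := metric_triangle p u y; lra.
  by exists z => //; rewrite mem_filter zc andbT; apply/asboolP; exists y.
- move=> z; apply: (count_le1 Ssep) => u v /asboolP[y [uy zy]] /asboolP[y' [vy' zy']].
  have := metric_triangle u y v; have := metric_triangle y z v.
  have := metric_triangle z y' v.
  rewrite (metric_sym y z) (metric_sym y' v); lra.
Qed.

Lemma ball_covnum_gt0 s : 0 < s -> (0 < ball_covnum s)%N.
Proof.
move=> s0; have [c cP <-] := ball_covnum_cover s0.
have [|z zc _] := cP p; first by rewrite /= mdistxx.
by case: c zc {cP}.
Qed.

Local Notation a k := (ball_covnum (2 ^- k)).
Let two0 k : 0 < 2 ^- k :> R. Proof. by rewrite invr_gt0 exprn_gt0. Qed.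
Let two1 k : 2 ^- k <= 1 :> R.
Proof. by rewrite invf_le1 ?exprn_gt0// exprn_ege1// ler1n. Qed.

Lemma dyadic_covnum_mult : exists2 K : R, 1 <= K & forall i j,
  (a (i + j)%N)%:R <= K * ((a i)%:R * (a j)%:R) /\ (a i)%:R * (a j)%:R <= K * (a (i + j)%N)%:R.
Proof.
have M40 : 0 < M ^+ 4 by rewrite exprn_gt0.
have M60 : 0 < M ^+ 6 by rewrite exprn_gt0.
have M40i : 0 < M ^- 4 by rewrite invr_gt0.
have M86 : 0 < (8 * M ^+ 6)^-1 by rewrite invr_gt0 mulr_gt0.
pose K1 := ball_covnum (M ^- 4); pose K2 := ball_covnum ((8 * M ^+ 6)^-1).
have two i j : 2 ^- (i + j) = 2 ^- i * 2 ^- j :> R by rewrite exprD invfM.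
exists (1 + K1%:R + K2%:R); first by rewrite -addrA lerDl addr_ge0.
move=> i j; split.
  apply: (@le_trans _ _ (K1%:R * ((a i)%:R * (a j)%:R))); last first.
    by rewrite ler_wpM2r ?mulr_ge0// -addrA [1 + _]addrC -addrA lerDl addr_ge0.
  rewrite -!natrM ler_nat mulnC -mulnA.
  have tM : 0 < 2 ^- j / M ^+ 2 by rewrite divr_gt0.
  have -> : a (i + j)%N = ball_covnum (M ^+ 2 * 2 ^- i * (2 ^- j / M ^+ 2)).
    by rewrite two; congr ball_covnum; field; rewrite !gt_eqF ?exprn_gt0.
  apply: leq_trans (ball_covnum_submult (two0 i) tM) _; rewrite leq_mul2l; apply/orP; right.
  have -> : 2 ^- j / M ^+ 2 = M ^+ 2 * 2 ^- j * M ^- 4.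
    by field; rewrite !gt_eqF ?exprn_gt0.
  exact: ball_covnum_submult.
apply: (@le_trans _ _ (K2%:R * (a (i + j)%N)%:R)); last first.
  by rewrite ler_wpM2r// lerDr addr_ge0.
rewrite -!natrM ler_nat.
apply: leq_trans (ball_covnum_supmult (two0 i) (two1 i) (two0 j) (two1 j)) _.
have -> : 2 ^- i * 2 ^- j / (8 * M ^+ 4) = M ^+ 2 * 2 ^- (i + j) * (8 * M ^+ 6)^-1.
  by rewrite two; field; rewrite !gt_eqF ?exprn_gt0.
by rewrite mulnC; exact: ball_covnum_submult.
Qed.

Lemma sphere_nonempty t : 0 <= t -> exists y, mdist p y = t.
Proof.
move=> t0; apply: contrapT => ny; have [y yt] := unbounded_far Xu p t.
have : [set z | mdist p z < t] y.
  apply: (connected_clopen cX).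
  - exact: open_dist_ball.
  - have -> : [set z | mdist p z < t] = [set z | mdist p z <= t].
      apply/seteqP; split => z /=; first exact: ltW.
      by rewrite le_eqVlt => /orP[/eqP zt|//]; case: ny; exists z.
    exact: closed_closed_ball.
  - exists p; rewrite /= mdistxx lt_neqAle t0 andbT; apply/eqP => tz.
    by apply: ny; exists p; rewrite mdistxx.
by rewrite /= ltNge ltW.
Qed.

(** By connectedness there are points at all distances from [p]; hence the
    exponent of growth will be at least 1. *)
Lemma dyadic_covnum_ge k : (2 ^ k <= a k.+2)%N.
Proof.
have [c cP cs] := ball_covnum_cover (two0 k.+2).
rewrite -cs.
have /choice[y yP] : forall j : nat, exists y, mdist p y = j%:R * 2 ^- k.
  by move=> j; apply: sphere_nonempty; rewrite mulr_ge0.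
pose s := [seq y j | j <- iota 0 (2 ^ k)].
have -> : (2 ^ k)%N = size s by rewrite size_map size_iota.
apply: (@scattered_le_covers _ _ (2 ^- k.+2)).
  rewrite /scattered pairwise_map.
  apply: (@sub_pairwise _ ltn); last by rewrite -sorted_pairwise ?iota_ltn_sorted//; exact: ltn_trans.
  move=> i j ij /=; have := mdist_abs_sub p (y j) (y i).
  rewrite !yP -mulrBl -natrB ?(ltnW ij)// ger0_norm ?mulr_ge0// (metric_sym (y j)).
  apply: lt_le_trans; apply: (@lt_le_trans _ _ (1 * 2 ^- k)).
    by rewrite !exprS !invfM mul1r; have := two0 k; lra.
  by rewrite ler_wpM2r// ler1n subn_gt0.
move=> v /mapP[j]; rewrite mem_iota add0n => /andP[_ jk] ->; apply: cP => /=.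
by rewrite yP ler_pdivrMr ?exprn_gt0// mul1r -natrX ler_nat ltnW.
Qed.

(** The logarithm of the covering number is quasi-additive in the scale, and
    its slope is [Q * ln 2]. *)
Lemma growth_exponent : exists Q K : R, [/\ 1 <= Q, 1 <= K & forall k : nat,
  (a k)%:R <= K * (2 ^+ k) `^ Q /\ (2 ^+ k) `^ Q <= K * (a k)%:R].
Proof.
have [K K1 KP] := dyadic_covnum_mult; have K0 : 0 < K by lra.
have a0 k : 0 < (a k)%:R :> R by rewrite ltr0n ball_covnum_gt0.
pose b k : R := ln (a k)%:R.
have badd i j : `|b (i + j)%N - b i - b j| <= ln K.
  have [h1 h2] := KP i j.
  have e1 : ln (a (i + j)%N)%:R <= ln K + (b i + b j).
    by rewrite /b -!lnM ?posrE ?mulr_gt0// ler_ln ?posrE ?mulr_gt0.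
  have e2 : b i + b j <= ln K + ln (a (i + j)%N)%:R.
    by rewrite /b -!lnM ?posrE ?mulr_gt0// ler_ln ?posrE ?mulr_gt0.
  rewrite ler_norml /b; rewrite /b in e1 e2; apply/andP; split; lra.
have [l lP] := quasi_additive_slope badd.
have bl k : `|b k - k%:R * l| <= ln K.
  case: k => [|k]; last exact: lP.
  by have := badd 0%N 0%N; rewrite addn0 subrr sub0r normrN mul0r subr0.
have ln2 : 0 < ln 2 :> R by rewrite ln_gt0// ltr1n.
pose Q := l / ln 2.
have pow k : (2 ^+ k) `^ Q = expR (k%:R * l).
  rewrite /powR gt_eqF ?exprn_gt0// lnXn// /Q -[ln 2 *+ k]mulr_natl; congr expR.
  by field; rewrite gt_eqF.
exists Q, K; split => //.
- rewrite /Q ler_pdivlMr// mul1r leNgt; apply/negP => l2.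
  pose k := Num.truncn ((ln K + 2 * l) / (ln 2 - l)).
  have d0 : 0 < ln 2 - l by rewrite subr_gt0.
  have := truncnS_gt ((ln K + 2 * l) / (ln 2 - l)); rewrite -/k ltr_pdivrMr//.
  have := bl k.+3; rewrite ler_norml => /andP[_ h].
  have : k.+1%:R * ln 2 <= b k.+3.
    rewrite /b mulr_natl -lnXn//; rewrite ler_ln ?posrE ?exprn_gt0//.
    by rewrite -natrX ler_nat; exact: dyadic_covnum_ge.
  have k3 : k.+3%:R = k.+1%:R + 2 :> R by rewrite -!natr1; ring.
  move: h; rewrite k3; lra.
move=> k; have := bl k; rewrite ler_norml => /andP[h1 h2].
have aE : (a k)%:R = expR (b k) by rewrite /b lnK// posrE.
have KE : K = expR (ln K) by rewrite lnK// posrE.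
rewrite pow aE {1 2}KE -!expRD !ler_expR; split; lra.
Qed.

Lemma dyadic_floor (u : R) : 0 < u -> u <= 1 -> exists k, 2 ^- k <= u < 2 * 2 ^- k.
Proof.
move=> u0 u1; have ex : exists k, 2 ^- k <= u.
  by have [k kP] := small_dyadic ler01 u0; exists k; move: kP; rewrite mul1r => /ltW.
case: (ex_minnP ex) => k ku kmin; exists k; rewrite ku/=.
case: k ku kmin => [|k] ku kmin; first by rewrite expr0 invr1; lra.
rewrite exprS invfM mulrA mulfV// mul1r ltNge; apply/negP => /kmin.
by rewrite ltnn.
Qed.

Lemma ball_cover_growth : exists Q C : R, [/\ 1 <= Q, 1 <= C,
  forall x r r', 0 < r' -> r' <= r ->
    exists2 c, covers (B x r) r' c & (size c)%:R <= C * (r / r') `^ Q &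
  forall x r r' c, 0 < r' -> r' <= r -> covers (B x r) r' c ->
    (r / r') `^ Q <= C * (size c)%:R].
Proof.
have [Q [K [Q1 K1 KP]]] := growth_exponent; have K0 : 0 < K by lra.
have Q0 : 0 <= Q by lra.
have M2 : 1 <= 2 * M ^+ 2 by rewrite mulr_ege1 ?ler1n// exprn_ege1.
have MQ : 1 <= (2 * M ^+ 2) `^ Q.
  apply: (@le_trans _ _ (1 `^ Q)); first by rewrite powR1.
  by apply: ge0_ler_powR; rewrite ?nnegrE//; lra.
have C1 : 1 <= K * (2 * M ^+ 2) `^ Q by exact: mulr_ege1.
exists Q, (K * (2 * M ^+ 2) `^ Q); split => //.
- move=> x r r' r'0 r'r; have r0 : 0 < r by exact: lt_le_trans r'r.
  pose u := r' / (M ^+ 2 * r).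
  have u0 : 0 < u by rewrite divr_gt0// mulr_gt0.
  have u1 : u <= 1.
    rewrite ler_pdivrMr ?mulr_gt0// mul1r (le_trans r'r)// ler_peMl ?(ltW r0)//.
    exact: exprn_ege1.
  have [k /andP[ku uk]] := dyadic_floor u0 u1.
  have [|c cP cs] := @ball_covnum_upper x r (2 ^- k) r' r0 (two0 k).
    rewrite mulrAC mulrC -ler_pdivlMr// mulr_gt0//.
  exists c => //; apply: (@le_trans _ _ (a k)%:R); first by rewrite ler_nat.
  have [h _] := KP k; apply: (le_trans h); rewrite -mulrA ler_pM2l//.
  rewrite -powRM ?divr_ge0 ?(ltW r0) ?(ltW r'0) ?(le_trans ler01 M2)//.
  apply: ge0_ler_powR; rewrite ?nnegrE ?exprn_ge0//.
    by rewrite mulr_ge0 ?divr_ge0 ?(ltW r0) ?(ltW r'0) ?(le_trans ler01 M2).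
  have -> : 2 * M ^+ 2 * (r / r') = 2 / u by rewrite /u; field; rewrite !gt_eqF.
  rewrite ler_pdivlMr// mulrC -ler_pdivlMr ?exprn_gt0//; exact: ltW.
- move=> x r r' c r'0 r'r cP; have r0 : 0 < r by exact: lt_le_trans r'r.
  have sc : 1 <= (size c)%:R :> R.
    by rewrite ler1n; have [|z zc _] := cP x; [rewrite /= mdistxx ltW|case: c zc {cP}].
  pose u := M ^+ 2 * r' / r; have u0 : 0 < u by rewrite divr_gt0// mulr_gt0.
  have uE : r / r' = M ^+ 2 / u by rewrite /u; field; rewrite !gt_eqF.
  have rr0 : 0 <= r / r' by rewrite divr_ge0// ltW.
  have [u1|u1] := leP 1 u.
    apply: (@le_trans _ _ (K * (2 * M ^+ 2) `^ Q)); last by rewrite ler_peMr// (le_trans ler01).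
    apply: (@le_trans _ _ ((2 * M ^+ 2) `^ Q)); last by rewrite ler_peMl ?powR_ge0.
    apply: ge0_ler_powR; rewrite ?nnegrE ?(le_trans ler01 M2)//.
    by rewrite uE ler_pdivrMr//; have := ltW M20; nra.
  have [[|j] /andP[ku uk]] := dyadic_floor u0 (ltW u1).
    by move: ku; rewrite expr0 invr1 leNgt u1.
  have uj : u <= 2 ^- j.
    by move: uk; rewrite exprS invfM mulrA mulfV// mul1r => /ltW.
  have : (a j)%:R <= (size c)%:R :> R.
    rewrite ler_nat; apply: leq_trans (ball_covnum_lower r0 r'0 cP).
    exact: ball_covnum_mono.
  have [_ h] := KP j => ac.
  apply: (@le_trans _ _ ((2 * M ^+ 2) `^ Q * (2 ^+ j) `^ Q)).
    rewrite -powRM ?exprn_ge0 ?(le_trans ler01 M2)//.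
    apply: ge0_ler_powR; rewrite ?nnegrE ?rr0 ?mulr_ge0 ?exprn_ge0 ?(ltW M0)//.
    rewrite uE ler_pdivrMr//.
    have : 1 <= 2 * 2 ^+ j * u.
      move: ku; rewrite exprS -[X in X <= _]mul1r ler_pdivrMr ?mulr_gt0 ?exprn_gt0//.
      by rewrite mulrC.
    by have := ltW M20; nra.
  rewrite mulrC mulrAC ler_wpM2r ?powR_ge0// (le_trans h)//.
  by rewrite ler_pM2l.
Qed.

End Growth.

(** * Hausdorff measure of balls *)

Section AhlforsRegularity.
Context {R : realType} {X : metricType R} (Q C : R).
Context (Q1 : 1 <= Q) (C1 : 1 <= C) (Xp : proper_space X).
Context (upper : forall (x : X) (r r' : R), 0 < r' -> r' <= r ->
  exists2 c, covers [set y | mdist x y <= r] r' c & (size c)%:R <= C * (r / r') `^ Q).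
Context (lower : forall (x : X) (r r' : R) c, 0 < r' -> r' <= r ->
  covers [set y | mdist x y <= r] r' c -> (r / r') `^ Q <= C * (size c)%:R).

Let Q0 : 0 < Q. Proof. by move: Q1; lra. Qed.
Let C0 : 0 < C. Proof. by move: C1; lra. Qed.

Lemma diam_ge0 (A : set X) : (0 <= diam A)%E.
Proof. by apply: ereal_sup_ubound; left. Qed.

Lemma diam_ge (A : set X) x y : A x -> A y -> ((mdist x y)%:E <= diam A)%E.
Proof. by move=> Ax Ay; apply: ereal_sup_ubound; right; exists (x, y). Qed.

Lemma diam_le (A : set X) (x : X) (r : R) : 0 <= r -> (forall y, A y -> mdist x y <= r) ->
  (diam A <= (2 * r)%:E)%E.
Proof.
move=> r0 Ar; apply: ub_ereal_sup => t [->|[[u v] [/= Au Av] <-]].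
  by rewrite lee_fin mulr_ge0.
rewrite lee_fin (le_trans (metric_triangle u x v))//.
by have := Ar u Au; have := Ar v Av; rewrite (metric_sym u x); lra.
Qed.

Lemma common_radius (n : nat) (rho : nat -> R) (r : R) : 0 < r -> (forall i, 0 < rho i) ->
  exists r', [/\ 0 < r', r' <= r & forall i, (i < n)%N -> r' <= rho i].
Proof.
move=> r0 rho0; elim: n => [|n [r' [r'0 r'r r'P]]]; first by exists r.
exists (Num.min r' (rho n)); split.
- by rewrite lt_min r'0 rho0.
- by rewrite ge_min r'r.
- move=> i; rewrite ltnS leq_eqVlt => /orP[/eqP ->|/r'P h]; rewrite ge_min ?lexx ?orbT//.
  by rewrite h.
Qed.

(** All balls of the cover are subdivided into balls of one common radius. The
    number of these is known from above by [upper] and from below by [lower]. *)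
Lemma finite_cover_content (x : X) (r : R) (n : nat) (z : nat -> X) (rho : nat -> R) :
  0 < r -> (forall i, 0 < rho i) ->
  (forall y, mdist x y <= r -> exists2 i, (i < n)%N & mdist (z i) y <= rho i) ->
  r `^ Q <= C ^+ 2 * \sum_(i < n) rho i `^ Q.
Proof.
move=> r0 rho0 cov; have [r' [r'0 r'r r'P]] := common_radius n r0 rho0.
have /choice[c cP] : forall i, exists c, (i < n)%N ->
    covers [set y | mdist (z i) y <= rho i] r' c /\ (size c)%:R <= C * (rho i / r') `^ Q.
  move=> i; have [ilt|_] := boolP (i < n)%N; last by exists [::].
  by have [c c1 c2] := upper (z i) r'0 (r'P i ilt); exists c.
pose d := flatten [seq c i | i <- iota 0 n].
have dcov : covers [set y | mdist x y <= r] r' d.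
  move=> y /cov[i ilt ziy]; have [h _] := cP i ilt; have [w wc wy] := h y ziy.
  exists w => //; apply/flattenP; exists (c i) => //; apply: map_f.
  by rewrite mem_iota add0n.
have := lower r'0 r'r dcov.
have r'Q : 0 < r' `^ Q by rewrite powR_gt0.
rewrite powR_div ?(ltW r0)// => h1.
have h2 : (size d)%:R <= \sum_(i < n) C * (rho i / r') `^ Q.
  rewrite size_flatten /shape -map_comp sumnE big_map natr_sum.
  rewrite -[in leLHS](subn0 n) -/(index_iota 0 n) big_mkord.
  by apply: ler_sum => i _; have [] := cP i (ltn_ord i).
have h3 : \sum_(i < n) C * (rho i / r') `^ Q = C * (\sum_(i < n) rho i `^ Q) / r' `^ Q.
  rewrite mulr_sumr mulr_suml; apply: eq_bigr => i _.
  by rewrite powR_div ?(ltW (rho0 i))// mulrA.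
rewrite -(ler_pM2r (x := (r' `^ Q)^-1)) ?invr_gt0//; apply: (le_trans h1).
rewrite expr2 -!mulrA ler_pM2l// mulrA -h3; exact: h2.
Qed.

Lemma geometric_sum (n : nat) : \sum_(i < n) (2 ^- i.+1 : R) <= 1.
Proof.
suff -> : \sum_(i < n) (2 ^- i.+1 : R) = 1 - 2 ^- n by rewrite lerBlDr lerDl invr_ge0 exprn_ge0.
elim: n => [|n IH]; first by rewrite big_ord0 expr0 invr1 subrr.
by rewrite big_ord_recr /= IH exprS invfM; lra.
Qed.

(** Each set of a countable cover is enlarged to an open ball of slightly
    larger radius; by compactness finitely many of these balls cover the
    closed ball of half the radius, and [finite_cover_content] applies. *)
Lemma hausdorff_lower (x : X) (r : R) : 0 < r ->
  (((C ^+ 2)^-1 * (r / 2) `^ Q)%:E <= hausdorff_measure Q (ball x r))%E.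
Proof.
move=> r0; have r20 : 0 < r / 2 by rewrite divr_gt0.
apply: (@le_trans _ _ (hausdorff_premeasure Q 1 (ball x r))); last first.
  by apply: ereal_sup_ubound; exists 1 => //=.
apply: le_ereal_inf_tmp => v [F [Fcov Fdiam] <-].
have dfin i : diam (F i) = (fine (diam (F i)))%:E.
  rewrite fineK// ge0_fin_numE ?diam_ge0//.
  by rewrite (le_lt_trans (Fdiam i))// ltry.
pose d i := fine (diam (F i)).
have d0 i : 0 <= d i by rewrite /d fine_ge0// diam_ge0.
apply/lee_addgt0Pr => e e0.
(* The enlargement costs [e] in total, and makes the radius larger than the
   diameter. *)
pose rho i := (d i `^ Q + e * 2 ^- i.+1) `^ Q^-1.
have p0 i : 0 < 2 ^- i :> R by rewrite invr_gt0 exprn_gt0.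
have s0 i : 0 < d i `^ Q + e * 2 ^- i.+1 by rewrite ltr_wpDl ?powR_ge0// mulr_gt0.
have rho0 i : 0 < rho i by rewrite powR_gt0.
have rhoQ i : rho i `^ Q = d i `^ Q + e * 2 ^- i.+1.
  by rewrite /rho -powRrM mulVf ?gt_eqF// powRr1// ltW.
have drho i : d i < rho i.
  rewrite ltNge; apply/negP => h.
  have : rho i `^ Q <= d i `^ Q by apply: ge0_ler_powR; rewrite ?nnegrE ?(ltW Q0) ?(ltW (rho0 i)).
  by rewrite rhoQ gerDl leNgt mulr_gt0.
have /choice[z zP] : forall i, exists z, forall y, F i y -> mdist z y < rho i.
  move=> i; have [[z Fz]|nF] := pselect (F i !=set0).
    exists z => y Fy; apply: le_lt_trans (drho i).
    by have := diam_ge Fz Fy; rewrite dfin lee_fin.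
  by exists x => y Fy; exfalso; apply: nF; exists y.
have cK := @Xp x (r / 2).
have [||n nP] := @compact_nested _ _ _ (fun n => [set y | exists2 i, (i < n)%N & mdist (z i) y < rho i]) cK.
- by move=> m n y mn [i im zy]; exists i => //; exact: leq_trans mn.
- move=> y /= xy; have [|i _ Fy] := Fcov y; first by rewrite ballEmdist /=; lra.
  exists i.+1; apply/nbhs_distP; exists (rho i - mdist (z i) y); first by rewrite subr_gt0 zP.
  move=> w yw; exists i => //; have := metric_triangle (z i) y w; lra.
have := @finite_cover_content x (r / 2) n z rho r20 rho0.
have cov y : mdist x y <= r / 2 -> exists2 i, (i < n)%N & mdist (z i) y <= rho i.
  by move=> /nP[i ilt /ltW]; exists i.
move=> /(_ cov) h.
have {}h : (C ^+ 2)^-1 * (r / 2) `^ Q <= \sum_(i < n) d i `^ Q + e.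
  rewrite ler_pdivrMl ?exprn_gt0//; apply: (le_trans h); rewrite ler_pM2l ?exprn_gt0//.
  rewrite (eq_bigr (fun i : 'I_n => d i `^ Q + e * 2 ^- i.+1)); last by move=> i _.
  rewrite big_split /= lerD2l -mulr_sumr ler_piMr ?(ltW e0)//; exact: geometric_sum.
apply: (@le_trans _ _ ((\sum_(i < n) d i `^ Q)%:E + e%:E)%E).
  by rewrite -EFinD lee_fin.
rewrite leeD2r// -sumEFin -(big_mkord xpredT (fun i => (d i `^ Q)%:E)).
have -> : \sum_(0 <= i < n) (d i `^ Q)%:E = \sum_(0 <= i < n) (diam (F i) `^ Q)%E :> \bar R.
  by apply: eq_bigr => i _; rewrite dfin.
by apply: nneseries_lim_ge => i _ _; exact: poweR_ge0.
Qed.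

Lemma hausdorff_upper (x : X) (r : R) : 0 < r ->
  (hausdorff_measure Q (ball x r) <= (C * 2 `^ Q * r `^ Q)%:E)%E.
Proof.
move=> r0; apply: ub_ereal_sup => _ [delta /= delta0 <-].
pose t := Num.min (delta / 2) r.
have t0 : 0 < t by rewrite lt_min divr_gt0.
have tr : t <= r by rewrite ge_min lexx orbT.
have td : 2 * t <= delta.
  have : t <= delta / 2 by rewrite ge_min lexx.
  lra.
have [c cP cs] := upper x t0 tr.
pose F i := if (i < size c)%N then [set y | mdist (nth x c i) y <= t] else set0.
have Fd i : (diam (F i) <= (if (i < size c)%N then 2 * t else 0)%:E)%E.
  rewrite /F; case: ifP => _; first by apply: (@diam_le _ (nth x c i)) => //; exact: ltW.
  by have := @diam_le set0 x 0 (lexx _); rewrite mulr0; apply.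
apply: ge_ereal_inf.
exists (\sum_(0 <= i <oo) (diam (F i) `^ Q))%E.
  exists F => //; split.
    move=> y; rewrite ballEmdist /= => /ltW xy; have [z zc zy] := cP y xy.
    exists (index z c) => //; rewrite /F index_mem zc /=.
    by rewrite nth_index.
  move=> i; apply: (le_trans (Fd i)); rewrite lee_fin; case: ifP => _ //; exact: ltW.
apply: lime_le; first by apply: is_cvg_nneseries => i _ _; exact: poweR_ge0.
apply: nearW => n.
apply: (@le_trans _ _ (((size c)%:R * (2 * t) `^ Q)%:E)).
  apply: (@le_trans _ _ (((minn n (size c))%:R * (2 * t) `^ Q)%:E)); last first.
    by rewrite lee_fin ler_wpM2r ?powR_ge0// ler_nat geq_minr.
  elim: n => [|n IH]; first by rewrite big_nil min0n mul0r.
  rewrite big_nat_recr//=; apply: (le_trans (leeD IH (_ : _ <= ((n < size c)%N%:R * (2 * t) `^ Q)%:E)%E)).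
    have := Fd n; case: ifP => nc h.
      rewrite mul1r -poweR_EFin; apply: gt0_ler_poweR => //; rewrite ?in_itv/= ?diam_ge0 ?leey//.
        exact: ltW.
      by rewrite andbT lee_fin mulr_ge0// ltW.
    have -> : diam (F n) = 0%E by apply/le_anti; rewrite h diam_ge0.
    by rewrite poweR0r ?gt_eqF// mul0r.
  rewrite -EFinD lee_fin -mulrDl ler_wpM2r ?powR_ge0//.
  rewrite -natrD ler_nat; case: (ltnP n (size c)) => h.
    by rewrite (minn_idPl h) addn1.
  by rewrite (minn_idPr (leqW h)) addn0.
rewrite lee_fin powRM ?(ltW t0)//.
apply: (@le_trans _ _ (C * (r / t) `^ Q * (2 `^ Q * t `^ Q))).
  by rewrite ler_wpM2r// mulr_ge0 ?powR_ge0.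
have -> : C * (r / t) `^ Q * (2 `^ Q * t `^ Q) = C * 2 `^ Q * ((r / t) `^ Q * t `^ Q) by ring.
by rewrite -powRM ?divr_ge0 ?(ltW t0) ?(ltW r0)// divfK// gt_eqF.
Qed.

Lemma regular_ahlfors : ahlfors_regular X.
Proof.
pose D := C ^+ 2 * 2 `^ Q; have D1 : 1 <= D.
  have h : 1 <= 2 `^ Q :> R.
    apply: (@le_trans _ _ (1 `^ Q)); first by rewrite powR1.
    by apply: ge0_ler_powR; rewrite ?nnegrE ?(ltW Q0)// ler1n.
  by rewrite /D mulr_ege1// exprn_ege1.
exists Q, D; split => // x r r0 _; apply/andP; split.
  apply: le_trans (hausdorff_lower x r0); rewrite lee_fin /D invfM -mulrA ler_pM2l ?invr_gt0 ?exprn_gt0//.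
  by rewrite powRM ?(ltW r0)// -powR_inv1// -powR_inv1 ?powR_ge0// -!powRrM mulN1r mulrN1 mulrC.
apply: (le_trans (hausdorff_upper x r0)); rewrite lee_fin /D.
rewrite ler_wpM2r ?powR_ge0// ler_wpM2r ?powR_ge0//.
by rewrite expr2 ler_peMr// ltW.
Qed.

End AhlforsRegularity.

(** * Sides of cut points *)

Section SeparationExistence.
Context {R : realType} {X : metricType R} {M : R}.
Implicit Types (p q x : X) (A : set X).
Context (M1 : 1 <= M) (dil : dilations X M) (inv : inversions X M).

Let M0 : 0 < M. Proof. by move: M1; lra. Qed.

Definition coside (q : X) (A : set X) := ~` (A `|` [set q]).

(** A side of [q] is a witness that [q] is a cut point. *)
Definition side (q : X) (A : set X) := [/\ branch q A, A !=set0 & coside q A !=set0].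

Lemma cosideE q A x : coside q A x <-> ~ A x /\ x <> q.
Proof.
split=> [nAx|[nAx xq] [//|/= ?]]; last exact: xq.
by split=> [Ax|xq]; apply: nAx; [left|right].
Qed.

Lemma branch_coside q A : branch q A -> branch q (coside q A).
Proof.
move=> [oA Aq cA]; split.
- exact: closed_openC.
- by move=> /cosideE[].
- have -> : coside q A `|` [set q] = ~` A.
    apply/seteqP; split => [x [/cosideE[]//|-> //]|x nAx].
    by have [->|xq] := pselect (x = q); [right|left; apply/cosideE].
  exact: open_closedC.
Qed.

Lemma side_coside q A : side q A -> side q (coside q A).
Proof.
move=> [bA [a Aa] cA]; split => //; first exact: branch_coside.
exists a; apply/cosideE; split => [/cosideE[]//|aq].
by case: bA => _ + _; rewrite -aq.
Qed.

Lemma cut_point_side (x : X) : cut_point x -> exists A, side x A.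
Proof.
move=> ncx; apply: contrapT => nA; apply: ncx => B B0 [C oC BC] [D cD BD].
apply: contrapT => BT; apply: nA; exists B; split => //.
- have cx := closed_point x.
  split.
  + by rewrite BC; apply: openI => //; exact: closed_openC.
  + by rewrite BC => -[+ _]; apply.
  + have -> : B `|` [set x] = D `|` [set x].
      apply/seteqP; split => y [By|->]; try by right.
        by left; move: By; rewrite BD => -[].
      by have [->|yx] := pselect (y = x); [right|left; rewrite BD].
    exact: closedU.
- apply: contrapT => nc; apply: BT; apply/seteqP; split => y.
    by rewrite BC => -[].
  move=> yx; apply: contrapT => By; apply: nc; exists y; apply/cosideE.
  by split.
Qed.

Lemma all_sides (x : X) : cut_point x -> forall q, exists A, side q A.
Proof.
move=> /cut_point_side[A [bA [a Aa] [b cb]]] q.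
have [h [h' [hh hx]]] := dil x q ltr01; have [hK h'K _] := hh.
exists (h @` A); split.
- by rewrite -hx; exact: similarity_image_branch hh bA.
- by exists (h a), a.
- have /cosideE[nAb bx] := cb; exists (h b); apply/cosideE; split.
    by move=> [c Ac /(can_inj hK) cE]; apply: nAb; rewrite -cE.
  by move=> hb; apply: bx; apply: (can_inj hK); rewrite hb.
Qed.

(** The gap will turn out to be the set of the points strictly between [p] and
    [q]. *)
Definition gap (p q : X) (Z : set X) :=
  [/\ open Z, bounded_subset Z, ~ Z p /\ ~ Z q, closed (Z `|` [set p; q]) & Z !=set0].

(** Let the inversion at [q] map [p'] to [p]. A side of [p'] that does not
    contain [q] is mapped to a bounded set, which can accumulate only at [p]
    and, coming from infinity, at [q]. *)
Lemma gap_exists : (forall q : X, exists A, side q A) -> forall p q, p <> q -> exists Z, gap p q Z.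
Proof.
move=> sides p q pq; have [w [f [fQ fq fN]]] := inv q.
have [[g fK gK] _ _] := fQ; have MM := ltW M0.
have [p' fp'] : exists p', f (Some p') = Some p.
  case E : (g (Some p)) => [p'|]; first by exists p'; rewrite -E gK.
  by exfalso; apply: pq; have [] : Some p = Some q by rewrite -fN -E gK.
have p'q : p' <> q by move=> e; move: fp'; rewrite e fq.
have [V [[oV Vp' cV] [v Vv] Vq]] : exists V, [/\ branch p' V, V !=set0 & ~ V q].
  have [A sA] := sides p'; have [Aq|nAq] := pselect (A q); last by exists A; case: sA.
  by exists (coside p' A); have [h1 h2 _] := side_coside sA; split => // /cosideE[].
have cVq : ~ (V `|` [set p']) q by move=> -[//|/= qp]; apply: p'q.
have E : fin_image f (V `|` [set p']) = fin_image f V `|` [set p].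
  apply/seteqP; split => y.
    move=> [x [Vx|->] fx]; first by left; exists x.
    by right; move: fx; rewrite fp' => -[].
  by move=> [[x Vx fx]|->]; [exists x => //; left|exists p' => //; right].
exists (fin_image f V); split.
- exact: open_fin_image fQ oV.
- have [x0 [r Br]] := bounded_fin_image MM fQ fq cV cVq.
  by exists x0, r => y [x Vx fx]; apply: Br; exists x => //; left.
- split => -[x Vx].
    by rewrite -fp' => /(can_inj fK)[xp]; apply: Vp'; rewrite -xp.
  by rewrite -fN => /(can_inj fK).
- apply/closure_id/seteqP; split; first exact: subset_closure.
  have -> : fin_image f V `|` [set p; q] = fin_image f (V `|` [set p']) `|` [set q].
    by rewrite E setUA.
  move=> y; rewrite closureU => -[/(closure_fin_image MM fQ cV)[|]|].
  + by left.
  + by rewrite fN => -[->]; right.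
  + by move=> cy; right; move: cy; rewrite -((closure_id _).1 (closed_point q)).
- case Ev : (f (Some v)) => [y|]; first by exists y, v.
  have [vq] : Some v = Some q by apply: (can_inj fK); rewrite Ev fq.
  by exfalso; apply: Vq; rewrite -vq.
Qed.

End SeparationExistence.

(** * Betweenness and arcs *)

Section Betweenness.
Context {R : realType} {X : metricType R}.
Implicit Types (a b p q t x y z : X) (A B E F G S T Z : set X).
Context (cX : connected [set: X]).
Context (NB : forall (p : X) B, branch p B -> bounded_subset B -> B = set0).
Context (sides : forall q : X, exists A, side q A).
Context (gaps : forall p q : X, p <> q -> exists Z, gap p q Z).

Lemma connected_meet (E F G : set X) : connected E -> closed F -> closed G ->
  E `<=` F `|` G -> E `&` F !=set0 -> E `&` G !=set0 -> exists t, [/\ E t, F t & G t].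
Proof.
move=> cE cF cG EFG EF [g [Eg Gg]]; apply: contrapT => nt.
have : E `&` F = E.
  apply: cE => //; last by exists F.
  exists (~` G); first exact: closed_openC.
  apply/seteqP; split => t [Et h]; split => //.
    by move=> Gt; apply: nt; exists t.
  by case: (EFG t Et).
by move=> EFE; apply: nt; exists g; split => //; have : (E `&` F) g by [rewrite EFE]; case.
Qed.

Lemma branch_adherent q A : branch q A -> A !=set0 -> closure A q.
Proof.
move=> [oA Aq cA] A0; apply: contrapT => nq; apply: Aq.
apply: (connected_clopen cX oA _ A0).
apply/closure_id/seteqP; split; first exact: subset_closure.
move=> y cy; have : closure (A `|` [set q]) y by apply: closureS cy; left.
move/closure_id : cA => <- [//|/= yq]; exfalso; apply: nq.
by rewrite -yq.
Qed.

(** A branch at [z] that contains neither [p] nor [q] meets the gap in a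
    bounded branch at [z], which is empty. *)
Lemma gap_branch p q Z z B : gap p q Z -> Z z -> branch z B -> B !=set0 -> B p \/ B q.
Proof.
move=> [oZ [x0 [r Zr]] [Zp Zq] cZ _] Zz bB B0; apply: contrapT => /not_orP[nBp nBq].
have [oB Bz cB] := bB.
have E : B `&` Z = set0.
  apply: (NB (p := z)); last by exists x0, r => y [_ /Zr].
  split; [exact: openI|by case|].
  have -> : (B `&` Z) `|` [set z] = (B `|` [set z]) `&` (Z `|` [set p; q]).
    apply/seteqP; split => y.
      by move=> [[By Zy]|->]; split; [left|left|right|left].
    move=> [[By|/= ->] [Zy|yp]]; try by [left|right].
    by exfalso; case: yp => /= yp; [apply: nBp|apply: nBq]; rewrite -yp.
  exact: closedI.
have [w [Bw Zw]] := branch_adherent bB B0 (open_nbhs_nbhs (conj oZ Zz)).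
by have : (B `&` Z) w by []; rewrite E.
Qed.

Definition separates (z p q : X) := exists A, [/\ branch z A, A p, ~ A q & q <> z].

Lemma separates_sym z p q : separates z p q -> separates z q p.
Proof.
move=> [A [bA Ap nAq qz]]; exists (coside z A); split.
- exact: branch_coside.
- exact/cosideE.
- by move=> /cosideE[].
- by move=> pz; case: bA => _ + _; rewrite -pz.
Qed.

Lemma separates_neq z p q : separates z p q -> [/\ z <> p, z <> q & p <> q].
Proof.
move=> [A [[_ Az _] Ap nAq qz]]; split.
- by move=> zp; apply: Az; rewrite zp.
- by move=> zq; apply: qz.
- by move=> pq; apply: nAq; rewrite -pq.
Qed.

Lemma connected_separates (E : set X) z p q : connected E -> E p -> E q ->
  separates z p q -> E z.
Proof.
move=> cE Ep Eq [A [[oA Az cA] Ap nAq qz]]; apply: contrapT => nEz.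
have : E `&` A = E.
  apply: cE; [by exists p|by exists A|exists (A `|` [set z]) => //].
  apply/seteqP; split => y [Ey h]; split => //; first by left.
  by case: h => // /= yz; exfalso; apply: nEz; rewrite -yz.
by move=> EA; have : (E `&` A) q by [rewrite EA]; case.
Qed.

Lemma gap_side p q Z z A : gap p q Z -> Z z -> side z A -> (A p /\ coside z A q) \/ (A q /\ coside z A p).
Proof.
move=> gZ Zz sA; have [bA A0 cA0] := sA; have bc := branch_coside bA.
have hA := gap_branch gZ Zz bA A0; have hc := gap_branch gZ Zz bc cA0.
have excl t : A t -> coside z A t -> False by move=> At /cosideE[].
case: hA => [Ap|Aq]; case: hc => [cp|cq].
- by exfalso; exact: excl cp.
- by left.
- by right.
- by exfalso; exact: excl cq.
Qed.

Lemma gap_sym p q Z : gap p q Z -> gap q p Z.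
Proof. by move=> [oZ bZ [Zp Zq] cZ Z0]; split => //; rewrite setUC -setUC [[set q; p]]setUC. Qed.

Lemma sub_bounded (S T : set X) : S `<=` T -> bounded_subset T -> bounded_subset S.
Proof. by move=> ST [x [r Tr]]; exists x, r => y /ST /Tr. Qed.

(** A clopen part that contains neither end is a bounded branch, say at [p]. *)
Lemma gap_no_clopen p q Z (S T : set X) : gap p q Z -> closed S -> closed T ->
  S `|` T = Z `|` [set p; q] -> S `&` T = set0 -> S p -> S q -> T = set0.
Proof.
move=> [oZ bZ [Zp Zq] cZ _] cS cT STE ST0 Sp Sq.
have nST y : S y -> T y -> False by move=> Sy Ty; have : (S `&` T) y by []; rewrite ST0.
have TZ : T `<=` Z.
  move=> y Ty; have : (Z `|` [set p; q]) y by rewrite -STE; right.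
  by move=> [//|[|] /= e]; exfalso; apply: (nST y) => //; rewrite e.
apply: (NB (p := p)); last exact: sub_bounded bZ.
split; last by apply: closedU => //; exact: closed_point.
  have -> : T = Z `&` ~` S.
    apply/seteqP; split => y.
      by move=> Ty; split; [exact: TZ|move=> Sy; exact: nST Ty].
    by move=> [Zy nSy]; have : (S `|` T) y by [rewrite STE; left]; case.
  by apply: openI => //; exact: closed_openC.
by move/TZ.
Qed.

(** Without [p], the part [S] would be a bounded branch at [p]. *)
Lemma gap_no_split p q Z (S T : set X) : gap p q Z -> closed S -> closed T ->
  S `|` T = Z `|` [set p; q] -> S `&` T = set0 -> S p -> T q -> S `<=` [set p].
Proof.
move=> [oZ bZ [Zp Zq] cZ _] cS cT STE ST0 Sp Tq.
have nST y : S y -> T y -> False by move=> Sy Ty; have : (S `&` T) y by []; rewrite ST0.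
have SZ : S `\` [set p] = Z `&` ~` T.
  apply/seteqP; split => y.
    move=> [Sy yp]; split; last by move=> Ty; exact: nST Ty.
    have : (Z `|` [set p; q]) y by rewrite -STE; left.
    by move=> [//|[//|/= yq]]; exfalso; apply: (nST y) => //; rewrite yq.
  move=> [Zy nTy]; split; last by move=> /= yp; apply: Zp; rewrite -yp.
  by have : (S `|` T) y by [rewrite STE; left]; case.
suff S0 : S `\` [set p] = set0.
  move=> y Sy; apply: contrapT => yp; have : (S `\` [set p]) y by [].
  by rewrite S0.
apply: (NB (p := p)); last by apply: sub_bounded bZ; rewrite SZ; exact: subIsetl.
split.
- by rewrite SZ; apply: openI => //; exact: closed_openC.
- by case=> _; apply.
- have -> : (S `\` [set p]) `|` [set p] = S; last by [].
  apply/seteqP; split => y; first by case=> [[]//|->].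
  by move=> Sy; have [->|yp] := pselect (y = p); [right|left].
Qed.

(** In a splitting of the closed gap into two clopen parts, either both ends
    lie in the same part and the other part is empty, or each part reduces to
    one end and the gap is empty. *)
Lemma gap_connected p q Z : gap p q Z -> connected (Z `|` [set p; q]).
Proof.
move=> gZ; have [oZ bZ [Zp Zq] cZ [z Zz]] := gZ; have gZ' := gap_sym gZ.
set E := Z `|` [set p; q] in cZ *.
have E' : Z `|` [set q; p] = E by rewrite /E [[set p; q]]setUC.
move=> B [b Bb] [C oC BC] [D cD BD].
have cB : closed B by rewrite BD; exact: closedI.
pose B' := E `\` B.
have B'E : B' = E `&` ~` C.
  rewrite /B' BC; apply/seteqP; split => y [Ey h]; split => //.
    by move=> Cy; apply: h.
  by case.
have cB' : closed B' by rewrite B'E; apply: closedI => //; exact: open_closedC.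
have BE : B `<=` E by rewrite BC; exact: subIsetl.
have U : B `|` B' = E.
  apply/seteqP; split => y; first by case=> [/BE//|[]].
  by move=> Ey; have [By|nBy] := pselect (B y); [left|right].
have I : B `&` B' = set0 by apply/seteqP; split => // y [By [_ nBy]].
have U' : B' `|` B = E by rewrite setUC.
have I' : B' `&` B = set0 by rewrite setIC.
have Ep : E p by right; left.
have Eq : E q by right; right.
have Ez : (B `|` B') z by rewrite U; left.
have no_two S T u v : S `|` T = E -> S `<=` [set u] -> T `<=` [set v] -> ~ Z u -> ~ Z v -> False.
  move=> STE Su Tv Zu Zv; have : (S `|` T) z by rewrite STE; left.
  by move=> [/Su|/Tv] /= e; [apply: Zu|apply: Zv]; rewrite -e.
suff B'0 : B' = set0 by rewrite -U B'0 setU0.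
have [Bp|nBp] := pselect (B p); have [Bq|nBq] := pselect (B q).
- exact: gap_no_clopen gZ cB cB' U I Bp Bq.
- exfalso; have B'q : B' q by [].
  apply: (no_two B B' p q) => //; first exact: gap_no_split gZ cB cB' U I Bp B'q.
  by apply: gap_no_split gZ' cB' cB _ I' B'q Bp; rewrite U' E'.
- exfalso; have B'p : B' p by [].
  apply: (no_two B' B p q) => //; first exact: gap_no_split gZ cB' cB U' I' B'p Bq.
  by apply: gap_no_split gZ' cB cB' _ I Bq B'p; rewrite U E'.
- exfalso; have B0 : B = set0 by apply: gap_no_clopen gZ cB' cB U' I' _ _.
  by rewrite B0 in Bb.
Qed.

(** By [arc_connected] and [arc_min], the smallest connected set containing
    [p] and [q]. *)
Definition arc_between (p q : X) : set X := [set z | [\/ z = p, z = q | separates z p q]].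

Lemma arc_gap p q Z : p <> q -> gap p q Z -> arc_between p q = Z `|` [set p; q].
Proof.
move=> pq gZ; have [_ _ [Zp Zq] _ _] := gZ; apply/seteqP; split => z.
  move=> [->|->|zs]; [by right; left|by right; right|].
  by apply: connected_separates (gap_connected gZ) _ _ zs; [right; left|right; right].
move=> [Zz|[->|->]]; [|exact: Or31|exact: Or32].
apply: Or33; have [A sA] := sides z; have [bA _ _] := sA.
case: (gap_side gZ Zz sA) => -[h /cosideE[h1 h2]]; first by exists A.
exact/separates_sym/(ex_intro _ A).
Qed.

Lemma arc_side p q z A : p <> q -> separates z p q -> side z A ->
  (A p /\ coside z A q) \/ (A q /\ coside z A p).
Proof.
move=> pq zs sA; have [Z gZ] := gaps pq; have [zp zq _] := separates_neq zs.
have : arc_between p q z by apply: Or33.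
rewrite (arc_gap pq gZ) => -[Zz|[//|//]]; exact: gap_side gZ Zz sA.
Qed.

Lemma arcxx p : arc_between p p = [set p].
Proof.
apply/seteqP; split => z; last by move=> ->; apply: Or31.
by move=> [//|//|/separates_neq[]].
Qed.

Lemma arc_sym p q : arc_between p q = arc_between q p.
Proof.
by apply/seteqP; split => z [->|->|/separates_sym]; try by [apply: Or31|apply: Or32|apply: Or33].
Qed.

Lemma arcl p q : arc_between p q p. Proof. exact: Or31. Qed.
Lemma arcr p q : arc_between p q q. Proof. exact: Or32. Qed.

Lemma arc_connected p q : connected (arc_between p q).
Proof.
have [->|pq] := pselect (p = q); first by rewrite arcxx; exact: connected1.
by have [Z gZ] := gaps pq; rewrite (arc_gap pq gZ); exact: gap_connected.
Qed.

Lemma arc_closed p q : closed (arc_between p q).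
Proof.
have [->|pq] := pselect (p = q); first by rewrite arcxx; exact: closed_point.
by have [Z gZ] := gaps pq; rewrite (arc_gap pq gZ); case: gZ.
Qed.

Lemma arc_min E p q : connected E -> E p -> E q -> arc_between p q `<=` E.
Proof.
by move=> cE Ep Eq z [->|->|] //; exact: connected_separates.
Qed.

(** If [x] is not between [y] and [z], the arc from [y] to [z] is covered by
    the arcs from [x] to [y] and to [z]. As it is connected, it has a point
    [t] on both of them. If [t] is none of the ends, then [x], [y] and [z] lie
    on pairwise opposite sides of [t], but there are only two sides. *)
Lemma one_between x y z : x <> y -> x <> z -> y <> z -> ~ separates x y z ->
  separates y x z \/ separates z x y.
Proof.
move=> xy xz yz nx.
have sub : arc_between y z `<=` arc_between x y `|` arc_between x z.
  move=> t [->|->|ts]; [by left; exact: arcr|by right; exact: arcr|].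
  have tx : t <> x by move=> e; apply: nx; rewrite -e.
  have [A sA] := sides t; have [bA _ _] := sA; have bc := branch_coside bA.
  have [ty tz _] := separates_neq ts.
  case: (arc_side yz ts sA) => -[h /cosideE[h1 h2]].
    have [Ax|nAx] := pselect (A x).
      by right; apply: Or33; exists A.
    by left; apply: Or33; apply: separates_sym; exists A; split => // e; apply: tx.
  have [Ax|nAx] := pselect (A x).
    by left; apply: Or33; exists A.
  by right; apply: Or33; apply: separates_sym; exists A; split => // e; apply: tx.
have [||t [t1 t2 t3]] := connected_meet (@arc_connected y z) (@arc_closed x y) (@arc_closed x z) sub.
- by exists y; split; [exact: arcl|exact: arcr].
- by exists z; split; [exact: arcr|exact: arcr].
have yx : y <> x by move=> e; apply: xy.
have zx : z <> x by move=> e; apply: xz.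
case: t1 => [ty|tz|ts].
- by left; move: t3; rewrite ty => -[//|//|].
- by right; move: t2; rewrite tz => -[//|/esym//|].
exfalso; have [ty tz _] := separates_neq ts.
have tx : t <> x by move=> e; apply: nx; rewrite -e.
case: t2 => [//|//|t2]; case: t3 => [//|//|t3].
have [A sA] := sides t.
have h1 := arc_side yz ts sA; have h2 := arc_side xy t2 sA; have h3 := arc_side xz t3 sA.
by case: h1 => -[? /cosideE[? ?]]; case: h2 => -[? /cosideE[? ?]]; case: h3 => -[? /cosideE[? ?]].
Qed.

(** Of two complementary clopen parts of [E `\` A], the one that does not
    contain [q] is away from [A], so it is clopen in [E]. *)
Lemma connected_minus_branch E q A : connected E -> E q -> branch q A -> connected (E `\` A).
Proof.
move=> cE Eq [oA Aq cA] B [b Bb] [C oC BC] [D cD BD].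
apply: contrapT => BE.
have [c [[Ec nAc] nBc]] : exists c, (E `\` A) c /\ ~ B c.
  apply: contrapT => nc; apply: BE; apply/seteqP; split; first by rewrite BC; exact: subIsetl.
  by move=> c Ec; apply: contrapT => nB; apply: nc; exists c.
have nAq : (E `\` A) q by [].
have [Bq|nBq] := pselect (B q).
- have : E `&` (~` A `&` ~` C) = E; last first.
    move=> h; have : (E `&` (~` A `&` ~` C)) q by rewrite h.
    move=> [_ [_ nCq]]; apply: nCq; by move: Bq; rewrite BC => -[].
  apply: cE.
  + by exists c; split => //; split => // Cc; apply: nBc; rewrite BC.
  + exists (coside q A `&` ~` D).
      by apply: openI; [case: (branch_coside (And3 oA Aq cA))|exact: closed_openC].
    apply/seteqP; split => y [Ey [h1 h2]]; split => //; split.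
    * apply/cosideE; split => // yq; apply: h2; rewrite yq; by move: Bq; rewrite BC => -[].
    * move=> Dy; apply: h2; have : B y by rewrite BD. by rewrite BC => -[].
    * by move/cosideE : h1 => [].
    * move=> Cy; apply: h2; have : B y by rewrite BC; split => //; split => //; move/cosideE : h1 => [].
      by rewrite BD => -[].
  + exists (~` A `&` ~` C) => //; apply: closedI; exact: open_closedC.
- have : E `&` (~` A `&` D) = E; last first.
    move=> h; have : (E `&` (~` A `&` D)) q by rewrite h.
    by move=> [_ [_ Dq]]; apply: nBq; rewrite BD.
  apply: cE.
  + by exists b; move: Bb; rewrite BD => -[[? ?] ?].
  + exists (coside q A `&` C).
      by apply: openI => //; case: (branch_coside (And3 oA Aq cA)).
    apply/seteqP; split => y [Ey [h1 h2]]; split => //; split.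
    * apply/cosideE; split => // yq; apply: nBq; rewrite -yq BD; by [].
    * have : B y by rewrite BD. by rewrite BC => -[].
    * by move/cosideE : h1 => [].
    * have : B y by rewrite BC; split => //; split => //; move/cosideE : h1 => [].
      by rewrite BD => -[].
  + by exists (~` A `&` D) => //; apply: closedI => //; exact: open_closedC.
Qed.

Lemma between_side x y z a b : separates y x z -> arc_between x y a -> arc_between y z b ->
  [\/ a = y, b = y | separates y a b].
Proof.
move=> [A [bA Ax nAz zy]] xa zb.
have [ay|ay] := pselect (a = y); first exact: Or31.
have [by_|by_] := pselect (b = y); first exact: Or32.
apply: Or33; exists A; split => //.
- apply: contrapT => nAa; case: xa => [ax|//|as_]; first by apply: nAa; rewrite ax.
  have bc := branch_coside bA.
  have ca : coside y A a by apply/cosideE.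
  have cE := connected_minus_branch (@arc_connected x y) (@arcr x y) bc.
  have [] : (arc_between x y `\` coside y A) a; last by [].
  apply: connected_separates cE _ _ as_.
    by split; [exact: arcl|move=> /cosideE[]].
  by split; [exact: arcr|move=> /cosideE[]].
- move=> Ab; case: zb => [//|bz|bs]; first by apply: nAz; rewrite -bz.
  have cE := connected_minus_branch (@arc_connected y z) (@arcl y z) bA.
  have [] : (arc_between y z `\` A) b; last by [].
  apply: connected_separates cE _ _ bs; last by split => //; exact: arcr.
  by split; [exact: arcl|case: bA].
Qed.

Lemma between_arcU x y z : separates y x z -> arc_between x z = arc_between x y `|` arc_between y z.
Proof.
move=> ys; apply/seteqP; split.
  apply: arc_min; [|by left; exact: arcl|by right; exact: arcr].
  apply: connectedU; [|exact: arc_connected|exact: arc_connected].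
  by exists y; split; [exact: arcr|exact: arcl].
have cxz : connected (arc_between x z) by exact: arc_connected.
have yz : arc_between x z y by apply: Or33.
move=> t [|]; move: t; apply: arc_min => //; by [exact: arcl|exact: arcr].
Qed.

End Betweenness.

(** * An additive measure of arcs *)

Section ArcMeasure.
Context {R : realType} {X : metricType R} (K Q C : R).
Context (cX : connected [set: X]) (Xp : proper_space X).
Context (NB : forall (p : X) B, branch p B -> bounded_subset B -> B = set0).
Context (sides : forall q : X, exists A, side q A).
Context (gaps : forall p q : X, p <> q -> exists Z, gap p q Z).
Context (K1 : 1 <= K).
Context (turning : bounded_turning X K).
Context (Q1 : 1 <= Q) (C1 : 1 <= C).
Context (upper : forall (x : X) (r r' : R), 0 < r' -> r' <= r ->
  exists2 c, covers [set y | mdist x y <= r] r' c & (size c)%:R <= C * (r / r') `^ Q).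
Context (lower : forall (x : X) (r r' : R) c, 0 < r' -> r' <= r ->
  covers [set y | mdist x y <= r] r' c -> (r / r') `^ Q <= C * (size c)%:R).
Implicit Types (a b p q t x y z : X) (r : R).

Let K0 : 0 < K. Proof. by move: K1; lra. Qed.
Let Q0 : 0 < Q. Proof. by move: Q1; lra. Qed.
Let C0 : 0 < C. Proof. by move: C1; lra. Qed.

Let connA p q : connected (arc_between p q).
Proof. exact: arc_connected. Qed.

Let closedA p q : closed (arc_between p q).
Proof. exact: arc_closed. Qed.

Lemma arc_bounded x y z : arc_between x y z -> mdist x z <= K * mdist x y.
Proof.
have [E [[_ _ cE] Ex Ey EK]] := turning_continuum turning x y.
by move=> xyz; apply: EK; exact: (arc_min cE Ex Ey xyz).
Qed.

(** Take a point [z] of the arc at distance half way from [x]. A point close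
    to [z] is joined to [z] by a small connected set; it contains neither end
    of the arc, so it cannot leave the gap. *)
Lemma arc_contains_ball x y : x <> y -> exists z, forall w,
  mdist z w <= mdist x y / (4 * K) -> arc_between x y w.
Proof.
move=> xy; have D0 : 0 < mdist x y by rewrite mdist_gt0; apply/eqP.
set D := mdist x y in D0 *.
have [z xyz xz] : exists2 z, arc_between x y z & mdist x z = D / 2.
  apply: contrapT => nz.
  have far_closed : closed [set w | D / 2 <= mdist x w].
    have -> : [set w | D / 2 <= mdist x w] = ~` [set w | mdist x w < D / 2].
      by apply/seteqP; split => w /=; rewrite leNgt => /negP.
    by apply: open_closedC; exact: open_dist_ball.
  have [|||t [t1 t2 t3]] := connected_meet (@connA x y)
      (@closed_closed_ball _ _ x (D / 2)) far_closed.
  - by move=> w _; case: (leP (mdist x w) (D / 2)) => h; [left|right; exact: ltW].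
  - by exists x; split; [exact: arcl|rewrite /= mdistxx divr_ge0// ltW].
  - by exists y; split; [exact: arcr|rewrite /= -/D; lra].
  - by apply: nz; exists t => //; apply/le_anti; rewrite t2 t3.
have [Z gZ] := gaps xy; have aE := arc_gap cX NB sides xy gZ; have [oZ _ [Zx Zy] cZ _] := gZ.
have zx : z <> x by move=> e; move: xz; rewrite e mdistxx; lra.
have yz2 : D / 2 <= mdist z y by have := metric_triangle x z y; rewrite -/D xz; lra.
have zy : z <> y by move=> e; move: yz2; rewrite e mdistxx; lra.
have Zz : Z z by move: xyz; rewrite aE => -[//|[|]].
exists z => w zw; have [E [[_ _ cE] Ez Ew EK]] := turning_continuum turning z w.
have small v : E v -> mdist z v < D / 2.
  move=> /EK /le_lt_trans; apply; move: zw; rewrite ler_pdivlMr ?mulr_gt0//; lra.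
have nEx : ~ E x by move=> /small; rewrite metric_sym xz ltxx.
have nEy : ~ E y by move=> /small; lra.
rewrite aE; left.
have : E `&` Z = E; last by move=> h; have : (E `&` Z) w by [rewrite h]; case.
apply: cE; [by exists z|by exists Z|exists (Z `|` [set x; y]) => //].
apply/seteqP; split => v [Ev h]; split => //; first by left.
by case: h => // -[|] /= e; exfalso; [apply: nEx|apply: nEy]; rewrite -e.
Qed.

Lemma arc_compact x y : compact (arc_between x y).
Proof.
apply: (subclosed_compact (@closedA x y) (@Xp x (K * mdist x y))).
by move=> z; exact: arc_bounded.
Qed.

Definition arc_count r x y : nat := covnum (arc_between x y) r.

Lemma arc_countP r x y : 0 < r -> exists2 c, covers (arc_between x y) r c & size c = arc_count r x y.
Proof.
by move=> r0; have [c cP] := compact_covers (@arc_compact x y) r0; exact: covnumP cP.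
Qed.

Lemma arc_count_upper r x y : 0 < r ->
  r `^ Q * (arc_count r x y)%:R <= C * (K * mdist x y) `^ Q + r `^ Q.
Proof.
move=> r0; have rQ : 0 < r `^ Q by rewrite powR_gt0.
have KD : 0 <= K * mdist x y by rewrite mulr_ge0 ?mdist_ge0// ltW.
have [rK|Kr] := leP r (K * mdist x y).
  have [c cP cs] := upper x r0 rK.
  have n1 : (arc_count r x y)%:R <= C * ((K * mdist x y) / r) `^ Q.
    apply: le_trans cs; rewrite ler_nat; apply: covnum_le.
    by apply: covers_subset cP => // z; exact: arc_bounded.
  rewrite ler_wpDr ?(ltW rQ)//.
  apply: (le_trans (ler_wpM2l (ltW rQ) n1)).
  by rewrite powR_div// mulrCA mulrC [r `^ Q * _]mulrC divfK ?gt_eqF// mulrC.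
have : (arc_count r x y <= 1)%N.
  apply: (@covnum_le _ _ _ _ [:: x]) => z xyz; exists x; first by rewrite inE.
  exact: le_trans (arc_bounded xyz) (ltW Kr).
rewrite -(ler_nat R) => n1.
rewrite ler_wpDl ?mulr_ge0 ?powR_ge0 ?(ltW C0)//.
by rewrite ler_piMr ?(ltW rQ).
Qed.

Lemma arc_count_lower r x y : 0 < r -> x <> y -> r <= mdist x y / (4 * K) ->
  (mdist x y / (4 * K)) `^ Q <= C * (r `^ Q * (arc_count r x y)%:R).
Proof.
move=> r0 xy rD; have rQ : 0 < r `^ Q by rewrite powR_gt0.
have [z zP] := arc_contains_ball xy; have [c cP <-] := arc_countP x y r0.
have := lower r0 rD (covers_subset zP (lexx _) cP).
rewrite powR_div//; last by rewrite divr_ge0 ?mdist_ge0// mulr_ge0// ltW.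
rewrite ler_pdivrMr// => /le_trans; apply.
by rewrite mulrAC -mulrA.
Qed.

Lemma arc_count_le_add r x y z : 0 < r -> separates y x z ->
  (arc_count r x z <= arc_count r x y + arc_count r y z)%N.
Proof.
move=> r0 ys; have [c cP <-] := arc_countP x y r0; have [d dP <-] := arc_countP y z r0.
rewrite -size_cat; apply: covnum_le => w.
rewrite (between_arcU cX NB sides gaps ys) => -[/cP[v vc vw]|/dP[v vd vw]];
  by exists v => //; rewrite mem_cat ?vc ?vd ?orbT.
Qed.

(** A ball of the cover that meets both halves is close to [y], because [y]
    lies on the arc between points of different halves. In the covers of the
    two halves, all such balls are replaced by a bounded number of balls
    around [y]. *)
Lemma arc_count_add_le r x y z : 0 < r -> separates y x z ->
  (arc_count r x y)%:R + (arc_count r y z)%:R <=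
  (arc_count r x z)%:R + 2 * (C * (2 * K + 2) `^ Q).
Proof.
move=> r0 ys; have [c cP <-] := arc_countP x z r0.
have rK : r <= (2 * K + 2) * r.
  by rewrite ler_peMl ?(ltW r0)//; move: K1; lra.
have [d dP ds] := upper y r0 rK.
have {}ds : (size d)%:R <= C * (2 * K + 2) `^ Q by move: ds; rewrite mulfK// gt_eqF.
pose P1 (w : X) := `[< exists a, arc_between x y a /\ mdist w a <= r >].
pose P2 (w : X) := `[< exists b, arc_between y z b /\ mdist w b <= r >].
have close_by w v : P1 w -> P2 w -> mdist w v <= r -> mdist y v <= (2 * K + 2) * r.
  move=> /asboolP[a [xya wa]] /asboolP[b [yzb wb]] wv.
  have ab : mdist a b <= 2 * r.
    by have := metric_triangle a w b; rewrite (metric_sym a w); lra.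
  have ya : mdist a y <= K * mdist a b.
    case: (between_side cX NB sides gaps ys xya yzb) => [->|->|yab].
    - by rewrite mdistxx mulr_ge0 ?mdist_ge0// ltW.
    - by rewrite ler_peMl ?mdist_ge0.
    - by apply: arc_bounded; exact: Or33.
  have : K * mdist a b <= K * (2 * r) by rewrite ler_pM2l.
  have := metric_triangle y a v; have := metric_triangle a w v.
  rewrite (metric_sym y a) (metric_sym a w); lra.
have cov1 : covers (arc_between x y) r ([seq w <- c | P1 w && ~~ P2 w] ++ d).
  move=> v xyv; have [|w wc wv] := cP v.
    by rewrite (between_arcU cX NB sides gaps ys); left.
  have p1 : P1 w by apply/asboolP; exists v.
  have [p2|np2] := boolP (P2 w).
    have [u ud uv] := dP v (close_by w v p1 p2 wv).
    by exists u => //; rewrite mem_cat ud orbT.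
  by exists w => //; rewrite mem_cat mem_filter p1 np2 wc.
have cov2 : covers (arc_between y z) r ([seq w <- c | P2 w && ~~ P1 w] ++ d).
  move=> v yzv; have [|w wc wv] := cP v.
    by rewrite (between_arcU cX NB sides gaps ys); right.
  have p2 : P2 w by apply/asboolP; exists v.
  have [p1|np1] := boolP (P1 w).
    have [u ud uv] := dP v (close_by w v p1 p2 wv).
    by exists u => //; rewrite mem_cat ud orbT.
  by exists w => //; rewrite mem_cat mem_filter p2 np1 wc.
have h1 := covnum_le cov1; have h2 := covnum_le cov2.
rewrite !size_cat !size_filter in h1 h2.
have h3 : (count (fun w => P1 w && ~~ P2 w) c + count (fun w => P2 w && ~~ P1 w) c <= size c)%N.
  elim: (c) => [//|w s IH] /=; rewrite addnACA -[(size s).+1]add1n leq_add//.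
  by case: (P1 w); case: (P2 w).
have : (arc_count r x y + arc_count r y z <= size c + (size d + size d))%N.
  apply: leq_trans (leq_add h1 h2) _; rewrite addnACA leq_add2r //.
rewrite -(ler_nat R) !natrD; lra.
Qed.

Lemma dyadic_powQ_le n : ((2 : R) ^- n) `^ Q <= 2 ^- n.
Proof.
have p0 : 0 < (2 : R) ^- n by rewrite invr_gt0 exprn_gt0.
have p1 : (2 : R) ^- n <= 1 by rewrite invf_le1 ?exprn_gt0// exprn_ege1// ler1n.
by apply: ge1r_powR => //; rewrite p0.
Qed.

(** The numbers [r ^ Q * arc_count r x y] are bounded, and additive along arcs
    up to a multiple of [r ^ Q]; so their limit as [r] tends to 0, taken along
    an ultrafilter, is additive. *)
Lemma arc_measure : exists mu : X -> X -> R,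
  [/\ forall x y, 0 <= mu x y, forall x y, mu x y = mu y x,
      forall x y z, separates y x z -> mu x z = mu x y + mu y z,
      forall x y, mu x y <= C * (K * mdist x y) `^ Q &
      forall x y, x <> y -> (mdist x y / (4 * K)) `^ Q <= C * mu x y].
Proof.
have [U [PU Utail UU]] := free_ultrafilter.
pose r n : R := 2 ^- n; have r0 n : 0 < r n by rewrite invr_gt0 exprn_gt0.
pose u x y n := r n `^ Q * (arc_count (r n) x y)%:R.
have rQ0 n : 0 < r n `^ Q by rewrite powR_gt0.
have u0 x y n : 0 <= u x y n by rewrite mulr_ge0// ltW.
have small (c e : R) : 0 <= c -> 0 < e -> U [set n | c * r n `^ Q <= e].
  move=> c0 e0; have [N NP] := small_dyadic c0 e0.
  apply: filterS (Utail N) => n /= Nn; apply: le_trans (ltW NP).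
  rewrite ler_wpM2l// (le_trans (dyadic_powQ_le n))// lef_pV2 ?posrE ?exprn_gt0//.
  by rewrite ler_eXn2l// ltr1n.
have rQ1 n : r n `^ Q <= 1.
  by rewrite (le_trans (dyadic_powQ_le n))// invf_le1 ?exprn_gt0// exprn_ege1// ler1n.
have /choice[mu muP] : forall xy : X * X, exists m : R, 0 <= m /\
    forall e : R, 0 < e -> U [set n | `|u xy.1 xy.2 n - m| < e].
  move=> [x y] /=; pose b := C * (K * mdist x y) `^ Q + 1.
  have cI : compact (`[0, b]%classic : set R^o) by exact: segment_compact.
  have uI n : (`[0, b]%classic : set R^o) (u x y n).
    rewrite /= in_itv/= u0/= (le_trans (arc_count_upper x y (r0 n)))//.
    by rewrite lerD2l.
  have [m + mP] := ultra_limit PU UU cI uI; rewrite /= in_itv/= => /andP[m0 _].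
  by exists m; split => // e /mP; apply: filterS => n /=; rewrite mdist_line.
pose m x y := mu (x, y).
have mP x y e : 0 < e -> U [set n | `|u x y n - m x y| < e] := (muP (x, y)).2 e.
have ex A : U A -> exists n, A n by exact: filter_ex.
have usym x y n : u x y n = u y x n by rewrite /u /arc_count (arc_sym x y).
exists m; split.
- by move=> x y; case: (muP (x, y)).
- move=> x y; apply/eqP; rewrite -subr_eq0 -normr_le0; apply/ler_addgt0Pr => e e0.
  have e2 : 0 < e / 2 by rewrite divr_gt0.
  have [n [/= h1 h2]] := ex _ (filterI (mP x y _ e2) (mP y x _ e2)).
  rewrite (usym y x) in h2; rewrite add0r.
  have := ler_distD (u x y n) (m x y) (m y x); rewrite (distrC (m x y) (u x y n)); lra.
- move=> x y z ys; apply/eqP; rewrite -subr_eq0 -normr_le0; apply/ler_addgt0Pr => e e0.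
  pose B := C * (2 * K + 2) `^ Q.
  have B0 : 0 <= B by rewrite mulr_ge0 ?powR_ge0 ?(ltW C0).
  have e4 : 0 < e / 4 by rewrite divr_gt0.
  have [n [[/= h1 h2] [/= h3 h4]]] := ex _ (filterI (filterI (mP x y _ e4) (mP y z _ e4))
      (filterI (mP x z _ e4) (small (2 * B) _ (mulr_ge0 (ler0n R 2) B0) e4))).
  rewrite add0r.
  have a1 : u x z n <= u x y n + u y z n.
    by rewrite /u -mulrDr ler_wpM2l ?(ltW (rQ0 n))// -natrD ler_nat arc_count_le_add.
  have a2 : u x y n + u y z n <= u x z n + 2 * B * r n `^ Q.
    rewrite /u -mulrDr [2 * B * _]mulrC -mulrDr ler_wpM2l ?(ltW (rQ0 n))//.
    exact: arc_count_add_le.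
  move: h1 h2 h3 a1 a2; rewrite !ltr_norml ler_norml.
  by move=> /andP[? ?] /andP[? ?] /andP[? ?] a1 a2; apply/andP; split; lra.
- move=> x y; apply/ler_addgt0Pr => e e0; have e2 : 0 < e / 2 by rewrite divr_gt0.
  have [n [/= h1 h2]] := ex _ (filterI (mP x y _ e2) (small 1 _ ler01 e2)).
  have := arc_count_upper x y (r0 n); rewrite -/(u x y n); rewrite mul1r in h2.
  by move: h1; rewrite ltr_norml => /andP[? ?]; lra.
- move=> x y xy; apply/ler_addgt0Pr => e e0.
  have D0 : 0 < mdist x y / (4 * K).
    by rewrite divr_gt0 ?mulr_gt0// mdist_gt0; apply/eqP.
  have eC : 0 < e / C by rewrite divr_gt0.
  have Ur : U [set n | r n <= mdist x y / (4 * K)].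
    have [N NP] := small_dyadic ler01 D0; apply: filterS (Utail N) => n /= Nn.
    apply: le_trans (ltW NP); rewrite mul1r lef_pV2 ?posrE ?exprn_gt0//.
    by rewrite ler_eXn2l// ltr1n.
  have [n [/= h1 h2]] := ex _ (filterI (mP x y _ eC) Ur).
  apply: (le_trans (arc_count_lower (r0 n) xy h2)).
  have -> : C * m x y + e = C * (m x y + e / C) by field; rewrite gt_eqF.
  rewrite ler_pM2l// -/(u x y n).
  by move: h1; rewrite ltr_norml => /andP[? ?]; lra.
Qed.

End ArcMeasure.

(** * Parametrization by the line *)

Section LineParametrization.
Context {R : realType} {X : metricType R} (K Q C : R) (mu : X -> X -> R).
Context (cX : connected [set: X]).
Context (NB : forall (p : X) B, branch p B -> bounded_subset B -> B = set0).
Context (sides : forall q : X, exists A, side q A).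
Context (gaps : forall p q : X, p <> q -> exists Z, gap p q Z).
Context (iX : inhabited X) (K1 : 1 <= K) (Q1 : 1 <= Q) (C1 : 1 <= C).
Context (mu_ge0 : forall x y, 0 <= mu x y) (mu_sym : forall x y, mu x y = mu y x).
Context (mu_add : forall x y z, separates y x z -> mu x z = mu x y + mu y z).
Context (mu_le : forall x y, mu x y <= C * (K * mdist x y) `^ Q).
Context (mu_ge : forall x y, x <> y -> (mdist x y / (4 * K)) `^ Q <= C * mu x y).

Let K0 : 0 < K. Proof. by move: K1; lra. Qed.
Let Q0 : 0 < Q. Proof. by move: Q1; lra. Qed.
Let C0 : 0 < C. Proof. by move: C1; lra. Qed.

Lemma muxx x : mu x x = 0.
Proof.
apply/le_anti; rewrite mu_ge0 andbT.
by have := mu_le x x; rewrite mdistxx mulr0 powR0 ?gt_eqF// mulr0.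
Qed.

(** The coordinate is the measure of the arc from a base point [p], counted
    negatively on one side of [p]. It is onto because both sides are unbounded
    and [X] is connected. *)
Lemma signed_coordinate : exists f : X -> R,
  (forall x y, `|f x - f y| = mu x y) /\ (forall v, exists x, f x = v).
Proof.
have [p] := iX; have [A sA] := sides p; have [bA A0 cA0] := sA.
pose f x := if `[< A x >] then mu p x else - mu p x.
have fA x : A x -> f x = mu p x by move=> Ax; rewrite /f; case: asboolP.
have fN x : ~ A x -> f x = - mu p x by move=> Ax; rewrite /f; case: asboolP.
have Ap : ~ A p by case: bA.
have opp x y : A x -> ~ A y -> `|f x - f y| = mu x y.
  move=> Ax nAy; rewrite fA// fN// opprK ger0_norm ?addr_ge0//.
  have [->|yp] := pselect (y = p); first by rewrite muxx addr0 mu_sym.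
  have ps : separates p x y by exists A.
  by rewrite (mu_add ps) (mu_sym x).
have same x y : (A x <-> A y) -> x <> p -> y <> p -> `|mu p x - mu p y| = mu x y.
  move=> Axy xp yp; have [->|xy] := pselect (x = y).
    by rewrite subrr normr0 muxx.
  have ns : ~ separates p x y.
    move=> ps; case: (arc_side cX NB sides gaps xy ps sA) => -[h /cosideE[h1 _]]; apply: h1.
      exact/Axy.
    exact/Axy.
  have px : p <> x by move=> e; apply: xp.
  have py : p <> y by move=> e; apply: yp.
  case: (one_between cX NB sides gaps px py xy ns) => s.
    by rewrite (mu_add s) opprD addrA subrr sub0r normrN ger0_norm.
  by rewrite (mu_add s) addrAC subrr add0r ger0_norm// mu_sym.
have fE x y : `|f x - f y| = mu x y.
  have [Ax|nAx] := pselect (A x); have [Ay|nAy] := pselect (A y).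
  - rewrite !fA//; apply: same => //; by move=> e; apply: Ap; rewrite -e.
  - exact: opp.
  - by rewrite distrC mu_sym; exact: opp.
  - rewrite !fN//; have -> : - mu p x - - mu p y = - (mu p x - mu p y) by ring.
    rewrite normrN; have [->|xp] := pselect (x = p).
      by rewrite muxx sub0r normrN ger0_norm.
    have [->|yp] := pselect (y = p).
      by rewrite muxx subr0 ger0_norm// mu_sym.
    exact: same.
exists f; split => // v.
have far B : branch p B -> B !=set0 -> forall T : R, exists2 x, B x & T < mu p x.
  move=> bB [b0 Bb0] T; have Bp : ~ B p by case: bB.
  have [x [Bx px]] : exists x, B x /\ 4 * K * (1 + C * `|T|) < mdist p x.
    apply: contrapT => /forallNP nx.
    have : B = set0.
      apply: NB bB _; exists p, (4 * K * (1 + C * `|T|)) => y By.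
      by rewrite leNgt; apply/negP => py; apply: (nx y).
    by move=> B0; rewrite B0 in Bb0.
  exists x => //; have CT : 0 <= C * `|T| by rewrite mulr_ge0// ltW.
  have d1 : 1 + C * `|T| < mdist p x / (4 * K).
    by rewrite ltr_pdivlMr ?mulr_gt0// mulrC.
  have d2 : 1 <= mdist p x / (4 * K) by lra.
  have px' : p <> x by move=> e; apply: Bp; rewrite e.
  have := le_trans (le1r_powR d2 Q1) (mu_ge px') => h.
  have : C * `|T| < C * mu p x by lra.
  by rewrite ltr_pM2l//; apply: le_lt_trans; exact: ler_norm.
have fcont x (e : R) : 0 < e -> exists2 d : R, 0 < d & forall y, mdist x y < d -> `|f x - f y| < e.
  move=> e0; have eC : 0 < e / C by rewrite divr_gt0.
  exists ((e / C) `^ Q^-1 / K); first by rewrite divr_gt0// powR_gt0.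
  move=> y; rewrite ltr_pdivlMr// mulrC => xy; rewrite fE (le_lt_trans (mu_le x y))//.
  rewrite [C * _]mulrC -ltr_pdivlMr//.
  have -> : e / C = ((e / C) `^ Q^-1) `^ Q.
    by rewrite -powRrM mulVf ?gt_eqF// powRr1// ltW.
  by apply: gt0_ltr_powR; rewrite ?nnegrE ?powR_ge0 ?mulr_ge0 ?mdist_ge0 ?(ltW K0).
apply: contrapT => nv.
have [x1 Ax1 x1v] := far A bA A0 `|v|.
have [x2 /cosideE[nAx2 x2p] x2v] := far _ (branch_coside bA) cA0 `|v|.
have : [set x | f x < v] x1.
  apply: (connected_clopen cX).
  - apply/open_distP => x /= xv; have [|d d0 dP] := fcont x (v - f x); first by rewrite subr_gt0.
    by exists d => // y /dP; rewrite ltr_norml => /andP[h1 h2]; lra.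
  - have -> : [set x | f x < v] = ~` [set x | v < f x].
      apply/seteqP; split => x /=; first by move=> h1 h2; have := lt_trans h1 h2; rewrite ltxx.
      move=> /negP; rewrite -leNgt le_eqVlt => /orP[/eqP xv|//].
      by exfalso; apply: nv; exists x.
    apply: open_closedC; apply/open_distP => x /= xv.
    have [|d d0 dP] := fcont x (f x - v); first by rewrite subr_gt0.
    by exists d => // y /dP; rewrite ltr_norml => /andP[h1 h2]; lra.
  - by exists x2; rewrite /= fN//; have := ler_norm (- v); rewrite normrN; lra.
by rewrite /= fA// ltNge; have := ler_norm v; move=> h; rewrite (le_trans h)// ltW.
Qed.

(** In this coordinate the distance of the line is comparable to the power [Q]
    of the given one. *)
Lemma line_homeomorphic : exists (alpha : R) (alpha01 : 0 < alpha <= 1),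
  bilipschitz_homeomorphic X (snowflake alpha01 R^o).
Proof.
have a01 : 0 < Q^-1 <= 1 by rewrite invr_gt0 Q0 invf_le1.
exists Q^-1, a01; have [f [fE fsurj]] := signed_coordinate.
pose T := snowflake a01 R^o.
have TE (u v : R) : mdist (u : T) (v : T) = `|u - v| `^ Q^-1.
  exact: mdist_snowflake_line.
have root (d : R) (d0 : 0 <= d) : (d `^ Q) `^ Q^-1 = d := powR_root d0 Q0.
have iQ : 0 <= Q^-1 by rewrite invr_ge0 ltW.
have CQ : 1 <= C `^ Q^-1.
  apply: (@le_trans _ _ (1 `^ Q^-1)); first by rewrite powR1.
  by apply: ge0_ler_powR; rewrite ?nnegrE ?(ltW C0).
pose L := C `^ Q^-1 * (4 * K).
have CQ0 : 0 < C `^ Q^-1 by lra.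
have L4 : 4 * K <= L by rewrite ler_peMl// mulr_ge0// ltW.
have L0 : 0 < L by move: L4 K1; lra.
have up x y : mdist (f x : T) (f y : T) <= L * mdist x y.
  rewrite TE fE; apply: (@le_trans _ _ ((C * (K * mdist x y) `^ Q) `^ Q^-1)).
    by apply: ge0_ler_powR; rewrite ?nnegrE ?mulr_ge0 ?powR_ge0 ?(ltW C0).
  rewrite powRM ?powR_ge0 ?(ltW C0)// root ?mulr_ge0 ?mdist_ge0 ?(ltW K0)//.
  rewrite /L -[leRHS]mulrA ler_pM2l// ler_wpM2r ?mdist_ge0//.
  by move: K1; lra.
have low x y : mdist x y <= L * mdist (f x : T) (f y : T).
  have [->|xy] := pselect (x = y); first by rewrite !mdistxx mulr0.
  have K4 : 0 < 4 * K by rewrite mulr_gt0.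
  rewrite TE fE /L -mulrA mulrCA -ler_pdivrMl// mulrC.
  rewrite -[leLHS]root ?divr_ge0 ?mdist_ge0 ?(ltW K4)// -powRM ?(ltW C0)//.
  by apply: ge0_ler_powR; rewrite ?nnegrE ?powR_ge0 ?mulr_ge0 ?(ltW C0)// mu_ge.
have /choice[g gK] := fsurj.
have finj x y : f x = f y -> x = y.
  move=> fxy; apply: le0_eq; apply: (le_trans (low x y)).
  by rewrite fxy mdistxx mulr0.
exists L; split; first by move: L4 K1; lra.
exists (f : X -> T); split.
  exists (g : T -> X); split.
  - by move=> x; apply: finj; rewrite gK.
  - exact: gK.
  - exact: (@lipschitz_continuous _ X T L f up).
  - apply: (@lipschitz_continuous _ T X L g) => u v.
    by rewrite (le_trans (low _ _))// !gK.
move=> x y; apply: within_factor_simeq => //; split; [exact: up|exact: low].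
Qed.

End LineParametrization.

(** * Structure of invertible homogeneous spaces *)

Unset Implicit Arguments.
Set Strict Implicit.

Theorem theorem1p8 (R : realType) (X : metricType R)
    (X_unbounded : unbounded_space X)
    (X_locally_compact : locally_compact [set: X])
    (X_homogeneous : unif_bilipschitz_homogeneous X)
    (X_quasi_invertible : quasi_invertible X)
    (X_curve : has_nondegenerate_curve X) :
  [/\ path_connected [set: X],
      locally_path_connected X,
      proper_space X &
      ahlfors_regular X]
  /\
  ((exists x : X, cut_point x) ->
   exists (alpha : R) (alpha01 : 0 < alpha <= 1),
     bilipschitz_homeomorphic X (snowflake alpha01 R^o))
  /\
  (~ (exists x : X, cut_point x) ->
   linearly_locally_connected X
   /\
   (has_nondegenerate_rectifiable_curve X -> annularly_quasiconvex X)
   /\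
   (~ has_nondegenerate_rectifiable_curve X ->
    exists (alpha : R) (alpha01 : 0 < alpha <= 1), alpha < 1 /\
      exists Z : metricType R,
        is_snowflake alpha01 Z /\ bilipschitz_homeomorphic X Z)).
Proof.
have [M M1 [dil inv Xp]] := invertible_space_structure X_unbounded X_locally_compact
  X_homogeneous X_quasi_invertible X_curve.
have iX := unbounded_inhabited X_unbounded; have [p] := iX.
have cX : connected [set: X] by exact: space_connected M1 dil inv X_curve.
have NB := no_bounded_branch M1 dil X_curve.
have [K K1 turning] := connected_bounded_turning M1 dil Xp cX iX.
have [Q [C [Q1 C1 upper lower]]] := ball_cover_growth M1 dil Xp cX X_unbounded p.
split; last split.
- split => //.
  + exact: turning_path_connected turning.
  + exact: turning_locally_path_connected turning.
  + exact: regular_ahlfors upper lower.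
- move=> [x cx]; have sides := all_sides dil cx.
  have gaps := gap_exists M1 inv sides.
  have [mu [m1 m2 m3 m4 m5]] := arc_measure cX Xp NB sides gaps K1 turning Q1 C1 upper lower.
  exact: (line_homeomorphic cX NB sides gaps iX K1 Q1 C1 m1 m2 m3 m4 m5).
- move=> ncut; split; last split.
  + exact: (turning_LLC K1 turning M1 dil Xp iX ncut).
  + by move=> Xr; exact: (annularly_quasi_convex M1 dil inv Xp cX iX Xr ncut).
  + by move=> Xnr; exact: (no_rectifiable_snowflake M1 dil Xp iX Xnr).
Qed.
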